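(* Let $(V,h)$ be an oriented seven-dimensional real vector space with a non-degenerate metric of signature $(4,3)$ and let $l\in\{-1,+1\}$ be fixed. The stabilizer of a three-form $\phi\in\Lambda^3V^*$ is $\mathrm{G}_2^*\subset\mathrm{SO}_0(4,3)$ if and only if $\langle\phi,\phi\rangle<0$ and, for some sign $\kappa\in\{-1,+1\}$, $$6\,\kappa\sqrt{-\frac{\langle\phi,\phi\rangle}{7}}\;\phi=l*(\phi\triangle_1\phi).$$ If that is the case, then the metric induced by $\phi$ is homothetic to the underlying metric $h$. If in addition $\langle\phi,\phi\rangle=-7$, then the metric induced by $\phi$ is precisely $h$.
   Context: Signature $(4,3)$ means four positive and three negative directions. $\mathrm{SO}_0(4,3)=\mathrm{SO}_0(V,h)$ is the identity component of the special orthogonal group, acting naturally on $\Lambda V^*$; $\langle\cdot,\cdot\rangle$ is the metric induced by $h$ on $\Lambda V^*$ (determinant convention), $\nu$ the volume form of $(V,h)$, and $*$ the Hodge star, $\alpha\wedge*\beta=\langle\alpha,\beta\rangle\nu$. For a basis $e_1,\dots,e_7$ of $V$, $\phi\triangle_1\phi=h^{ij}(\iota_{e_i}\phi)\wedge(\iota_{e_j}\phi)\in\Lambda^4V^*$. $\mathrm{G}_2^*$ is the connected non-compact real form of $\mathrm{G}_2^{\mathbb{C}}$ with trivial center and fundamental group $\mathbb{Z}_2$. As a subgroup of $\mathrm{SO}_0(4,3)$ it is realized as the stabilizer in $\mathrm{GL}(V)$ of the three-form $\phi_0=-e^{127}-e^{135}+e^{146}+e^{236}+e^{245}-e^{347}+e^{567}$,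 where $(e^1,\dots,e^7)$ is an $h^*$-orthonormal basis of $V^*$ with $e^1,\dots,e^4$ of norm $+1$ and $e^5,e^6,e^7$ of norm $-1$ (so $\langle\phi_0,\phi_0\rangle=-7$); equivalently it is the image in $\mathrm{SO}_0(4,3)$ of the stabilizer in $\mathrm{Spin}_0(4,3)$ of an irreducible real spinor of non-zero pseudo-norm. A three-form $\phi$ with stabilizer $\mathrm{G}_2^*$ can be written as $-f^{127}-f^{135}+f^{146}+f^{236}+f^{245}-f^{347}+f^{567}$ in some basis $(f^i)$ of $V^*$; the metric induced by $\phi$ is $\sum_{i=1}^4 f^i\otimes f^i-\sum_{i=5}^7f^i\otimes f^i$, which does not depend on the choice of such basis. Homothetic means equal up to a positive constant factor. *)

(* Defs.v *)
From mathcomp Require Import all_boot all_order all_fingroup all_algebra.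
From mathcomp Require Import classical_sets boolp functions reals.

Set Implicit Arguments.
Unset Strict Implicit.
Unset Printing Implicit Defensive.
Import Order.TTheory GRing.Theory Num.Theory.
Local Open Scope ring_scope.

(* k-forms are functions of k-tuples of vectors; membership in $\Lambda^k V^*$
   is the predicate [alternating]. *)
Definition kform (R : realType) (V : vectType R) (k : nat) : Type :=
  k.-tuple V -> R^o.

Section Forms.
Context {R : realType} {V : vectType R}.

Definition set_tnth (k : nat) (v : k.-tuple V) (i : 'I_k) (x : V) : k.-tuple V :=
  [tuple if j == i then x else tnth v j | j < k].

Definition alternating (k : nat) (a : kform V k) : Prop :=
  (forall (v : k.-tuple V) (i : 'I_k) (c : R) (x y : V),
     a (set_tnth v i (c *: x + y)) =
       c * a (set_tnth v i x) + a (set_tnth v i y)) /\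
  (forall (v : k.-tuple V) (i j : 'I_k),
     i != j -> tnth v i = tnth v j -> a v = 0).

Definition one_form (f : 'Hom(V, R^o)) : kform V 1 := fun v => f (tnth v ord0).

(* The normalization is such that $(f \wedge g)(x, y) = f(x) g(y) - f(y) g(x)$
   for one-forms. *)
Definition wedge (p q : nat) (a : kform V p) (b : kform V q) : kform V (p + q) :=
  fun v => (p`! * q`!)%:R^-1 *
    \sum_(s : 'S_(p + q)) (-1) ^+ s *
      a [tuple tnth v (s (lshift q i)) | i < p] *
      b [tuple tnth v (s (rshift p j)) | j < q].

Definition interior (k : nat) (x : V) (a : kform V k.+1) : kform V k :=
  fun w => a [tuple of x :: w].

Section Metric.
Variable h : V -> V -> R.

Definition gram (n : nat) (b : n.-tuple V) : 'M[R]_n :=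
  \matrix_(i, j) h (tnth b i) (tnth b j).

(* $V$ has signature (p, q): p positive and q negative directions. *)
Definition signature (p q : nat) : Prop :=
  exists b : (p + q).-tuple V, basis_of fullv b /\
    forall i j : 'I_(p + q),
      h (tnth b i) (tnth b j) = if i == j then (-1) ^+ (p <= i)%N else 0.

(* $h^{ij}$ with respect to the basis [vbasis fullv] of $V$; the operations
   below do not depend on the choice of this basis. *)
Definition cometric : 'M[R]_(\dim {:V}) := invmx (gram (vbasis {:V})).

(* Determinant convention: since
   $a = \frac{1}{k!} \sum_I a(e_I)\, e^{I_1} \wedge \dots \wedge e^{I_k}$, the
   formula is the bilinear extension of
   $\langle e^{I_1} \wedge \dots \wedge e^{I_k},
     e^{J_1} \wedge \dots \wedge e^{J_k} \rangle = \det (h^{I_r J_s})_{r,s}$. *)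
Definition form_metric (k : nat) (a b : kform V k) : R :=
  (k`! ^ 2)%:R^-1 *
  \sum_(I : {ffun 'I_k -> 'I_(\dim {:V})})
    \sum_(J : {ffun 'I_k -> 'I_(\dim {:V})})
      \det (\matrix_(r < k, s < k) cometric (I r) (J s)) *
      a [tuple tnth (vbasis {:V}) (I r) | r < k] *
      b [tuple tnth (vbasis {:V}) (J s) | s < k].

(* $a \triangle_1 b = h^{ij} (\iota_{e_i} a) \wedge (\iota_{e_j} b)$ *)
Definition triangle1 (p q : nat) (a : kform V p.+1) (b : kform V q.+1) :
    kform V (p + q) :=
  \sum_(i < \dim {:V}) \sum_(j < \dim {:V})
    cometric i j *: wedge (interior (tnth (vbasis {:V}) i) a)
                          (interior (tnth (vbasis {:V}) j) b).

(* $\sqrt{|\det (h(o_i, o_j))|}\; o^1 \wedge \dots \wedge o^n$, where the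
   orientation of $V$ is the class of the basis o. *)
Definition volume_form (n : nat) (o : n.-tuple V) : kform V n :=
  fun v => Num.sqrt `|\det (gram o)| *
           \det (\matrix_(i < n, j < n) coord o i (tnth v j)).

(* The form $*b$ such that $a \wedge *b = \langle a, b \rangle \nu$ for all a. *)
Definition hodge (k m : nat) (nu : kform V (k + m)) (b : kform V k) : kform V m :=
  xget 0 [set c : kform V m | alternating c /\
    forall a : kform V k, alternating a ->
      wedge a c = form_metric a b *: nu]%classic.

Definition orthonormal_coframe (f : 7.-tuple 'Hom(V, R^o)) : Prop :=
  basis_of fullv f /\
  forall i j : 'I_7, form_metric (one_form (tnth f i)) (one_form (tnth f j)) =
    if i == j then (-1) ^+ (4 <= i)%N else 0.

End Metric.

(* $-f^{127}-f^{135}+f^{146}+f^{236}+f^{245}-f^{347}+f^{567}$, where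
   $f^1, \dots, f^7$ are the entries of the tuple f. *)
Definition phi0 (f : 7.-tuple 'Hom(V, R^o)) : kform V 3 :=
  let w (i j k : nat) : kform V 3 :=
    wedge (wedge (one_form f`_i.-1) (one_form f`_j.-1)) (one_form f`_k.-1) in
  - w 1%N 2%N 7%N - w 1%N 3%N 5%N + w 1%N 4%N 6%N + w 2%N 3%N 6%N
  + w 2%N 4%N 5%N - w 3%N 4%N 7%N + w 5%N 6%N 7%N.

Definition coframe_metric (f : 7.-tuple 'Hom(V, R^o)) (x y : V) : R :=
  \sum_(i < 7) (-1) ^+ (4 <= i)%N * (tnth f i x * tnth f i y).

Definition induced_metric (phi : kform V 3) : V -> V -> R :=
  xget (fun _ _ => 0) [set g : V -> V -> R |
    exists f : 7.-tuple 'Hom(V, R^o),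
      [/\ basis_of fullv f, phi = phi0 f & g = coframe_metric f]]%classic.

Definition stabilizer (k : nat) (a : kform V k) : set 'End(V) :=
  [set g : 'End(V) | lker g == 0%VS /\
    forall v : k.-tuple V, a (map_tuple g v) = a v]%classic.

(* The subgroup G of GL(V) is $\mathrm{G}_2^* \subset \mathrm{SO}_0(V, h)$,
   i.e. the stabilizer of [phi0 e] for an $h^*$-orthonormal coframe e. *)
Definition is_G2star (h : V -> V -> R) (G : set 'End(V)) : Prop :=
  exists e : 7.-tuple 'Hom(V, R^o),
    orthonormal_coframe h e /\ G = stabilizer (phi0 e).

Definition homothetic (g h : V -> V -> R) : Prop :=
  exists c : R, 0 < c /\ forall x y : V, g x y = c * h x y.

End Forms.

(* Main.v *)
(* Let phi act on the spinor module R^8 of Cl(4,3), realised by the left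
   multiplications of the split octonions, as a matrix M. The Clifford square of a
   three-form is the sum of the scalar -<phi,phi> and of a multiple of the four-form
   triangle1 phi phi, which acts as its Hodge dual up to sign. Hence the equation says
   that M^2 = 7 mu^2 + 6 mu M with mu = +-sqrt(-<phi,phi>/7). As M is traceless and
   self-adjoint, (M + mu)/(8 mu) is a self-adjoint idempotent of trace 1, that is, the
   projection onto the line of a non-null spinor u, and phi is a multiple of
   (x, y, z) |-> <u, x y z u>. A product of at most two vectors maps the real unit of
   the octonions, whose form is phi0, to u, and reflecting the frame accordingly shows
   that phi is a multiple of phi0 in some orthonormal coframe.

   Conversely, a three-form invariant under the stabilizer of phi0 is a multiple of
   phi0: sign changes of the frame kill the components off the seven monomials of phi0,
   and three hyperbolic rotations relate the remaining ones. For such a multiple the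
   equation is a computation, and the induced metric g is well defined because
   (i_x phi) /\ (i_y phi) /\ phi is a multiple of g(x, y) vol. *)

Require Import Defs.
From HB Require Import structures.
From mathcomp Require Import all_boot all_order all_fingroup all_algebra.
From mathcomp Require Import classical_sets boolp functions reals.
From mathcomp Require Import zify ring lra.

Set Implicit Arguments.
Unset Strict Implicit.
Unset Printing Implicit Defensive.
Import Order.TTheory GRing.Theory Num.Theory.
Local Open Scope ring_scope.

(** * Alternating forms *)

(** The identities that depend on phi, foremost the Clifford square, are polynomial in its 35
    independent components and are left to [ring]. What concerns only phi0 and the octonions is
    integral and is settled by computation on tables, then transported to [R]. For this the star,
    defined by a condition on all test forms, is reduced to finitely many equations between
    components, and sums that must unfold are written as [foldr] over [iota]. The sign kappa absorbs
    three choices: [l], the orientation, seen in the value nu(b) = 1 or -1 on an orthonormal basis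
    b, and the sign of c in phi = c phi0. The coefficients 6 and 7 make M^2 - 6 mu M - 7 mu^2 split
    as (M - 7 mu)(M + mu). As M is traceless on a space of dimension 8, the root 7 mu has
    multiplicity one, and this singles out one spinor line. The norm -7 arises because each of the
    seven monomials of phi0 has norm -1. Scaling a coframe by r scales phi0 by r^3 and the induced
    metric by r^2; so the homothety factor is positive even when c is negative. *)

Lemma big_ffun_recl (R : nmodType) (k : nat) (J : finType)
    (F : {ffun 'I_k.+1 -> J} -> R) :
  \sum_(f : {ffun 'I_k.+1 -> J}) F f =
  \sum_(i : J) \sum_(f : {ffun 'I_k -> J}) F [ffun r => oapp f i (unlift ord0 r)].
Proof.
rewrite pair_big /=.
pose g (q : J * {ffun 'I_k -> J}) : {ffun 'I_k.+1 -> J} :=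
  [ffun r => oapp q.2 q.1 (unlift ord0 r)].
rewrite (reindex g) //=; exists (fun f => (f ord0, [ffun r => f (lift ord0 r)])) => [q _|f _].
  case: q => i f; congr (_, _); first by rewrite /g ffunE unlift_none.
  by apply/ffunP => r; rewrite !ffunE liftK.
apply/ffunP => r; rewrite /g ffunE /=.
by case: unliftP => [j ->|->] /=; rewrite ?ffunE.
Qed.

Lemma big_ffun0 (R : nmodType) (J : finType) (F : {ffun 'I_0 -> J} -> R)
    (f : {ffun 'I_0 -> J}) : \sum_g F g = F f.
Proof.
rewrite (big_pred1 f) // => g; apply/esym/eqP/ffunP; by case.
Qed.

(** A permutation is determined by the image of 0 and by what it induces on the rest. Injectivity
    suffices, since (n + 1) n! = (n + 1)!. *)
Lemma lift_perm_bij n :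
  bijective (fun u : 'I_n.+1 * 'S_n => lift_perm ord0 u.1 u.2).
Proof.
apply: inj_card_bij; last by rewrite card_prod card_ord !card_Sn factS.
move=> [i s] [i' s'] /permP E; have := E ord0.
rewrite /= !lift_perm_id => ei; subst i'; congr (_, _).
apply/permP => j; have := E (lift ord0 j).
by rewrite /= !lift_perm_lift => /lift_inj.
Qed.

Lemma lift_permP n (s : 'S_n.+1) : exists i t, s = lift_perm ord0 i t.
Proof.
have [g _ gK] := lift_perm_bij n.
by exists (g s).1, (g s).2; rewrite -[LHS]gK.
Qed.

Lemma big_perm_recl (R : nmodType) (n : nat) (F : 'S_n.+1 -> R) :
  \sum_(s : 'S_n.+1) F s =
  \sum_(i < n.+1) \sum_(s : 'S_n) F (lift_perm ord0 i s).
Proof.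
rewrite pair_big /=.
by rewrite (reindex (fun u : 'I_n.+1 * 'S_n => lift_perm ord0 u.1 u.2)) //=;
  apply: onW_bij; apply: lift_perm_bij.
Qed.

Section Multilinear.
Context {R : realType} {V : vectType R}.
Implicit Types (k n : nat).

Definition multilinear k (a : kform V k) : Prop :=
  forall (v : k.-tuple V) (i : 'I_k) (c : R) (x y : V),
    a (set_tnth v i (c *: x + y)) =
      c * a (set_tnth v i x) + a (set_tnth v i y).

Lemma alternating_multilinear k (a : kform V k) : alternating a -> multilinear a.
Proof. by case. Qed.

Lemma tnth_set k (v : k.-tuple V) i x j :
  tnth (set_tnth v i x) j = if j == i then x else tnth v j.
Proof. by rewrite tnth_mktuple. Qed.

Lemma set_tnth_id k (v : k.-tuple V) i : set_tnth v i (tnth v i) = v.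
Proof. by apply: eq_from_tnth => j; rewrite tnth_set; case: eqP => [->|]. Qed.

Lemma set_tnthC k (v : k.-tuple V) i j x y : i != j ->
  set_tnth (set_tnth v i x) j y = set_tnth (set_tnth v j y) i x.
Proof.
move=> nij; apply: eq_from_tnth => r; rewrite !tnth_set.
by case: (r =P j) => [->|//]; rewrite eq_sym (negPf nij).
Qed.

Lemma multilinear0 k (a : kform V k) v i : multilinear a ->
  a (set_tnth v i 0) = 0.
Proof.
move=> la; have := la v i (-1) 0 0; rewrite scaleN1r oppr0 addr0.
by rewrite mulN1r addNr.
Qed.

Lemma multilinear_sum k (a : kform V k) v i (I : Type) (r : seq I)
    (c : I -> R) (x : I -> V) : multilinear a ->
  a (set_tnth v i (\sum_(j <- r) c j *: x j)) =
  \sum_(j <- r) c j * a (set_tnth v i (x j)).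
Proof.
move=> la; elim: r => [|j r IH]; first by rewrite !big_nil multilinear0.
by rewrite !big_cons la IH.
Qed.

Lemma interior_multilinear k x (a : kform V k.+1) :
  multilinear a -> multilinear (interior x a).
Proof.
move=> la v i c y z; rewrite /interior.
have E w : [tuple of x :: set_tnth v i w] =
    set_tnth [tuple of x :: v] (lift ord0 i) w.
  apply: eq_from_tnth => j; rewrite tnth_set.
  by case: (unliftP ord0 j) => [j' ->|->]; rewrite ?tnthS ?tnth0 // tnth_set (inj_eq lift_inj).
by rewrite !E la.
Qed.

Lemma cons_set_tnth k (x : V) (w : k.-tuple V) y :
  [tuple of x :: w] = set_tnth [tuple of y :: w] ord0 x.
Proof.
apply: eq_from_tnth => j; rewrite tnth_set.
by case: (unliftP ord0 j) => [j' ->|->]; rewrite ?tnthS ?tnth0.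
Qed.

Lemma mktuple_cons k (f : 'I_k.+1 -> V) :
  [tuple f i | i < k.+1] =
  [tuple of f ord0 :: [tuple f (lift ord0 i) | i < k]].
Proof.
apply: eq_from_tnth => j; rewrite tnth_mktuple.
by case: (unliftP ord0 j) => [j' ->|->]; rewrite ?tnthS ?tnth0 ?tnth_mktuple.
Qed.

Lemma multilinear_expand k n (e : 'I_n -> V) (P : 'I_k -> 'I_n -> R)
    (a : kform V k) : multilinear a ->
  a [tuple \sum_i P r i *: e i | r < k] =
  \sum_(I : {ffun 'I_k -> 'I_n}) (\prod_r P r (I r)) * a [tuple e (I r) | r < k].
Proof.
elim: k P a => [|k IH] P a la.
  rewrite (big_ffun0 _ (ffun0 (card_ord 0))) big_ord0 mul1r.
  by congr a; apply: eq_from_tnth; case.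
rewrite big_ffun_recl mktuple_cons (cons_set_tnth _ _ 0) multilinear_sum //.
apply: eq_bigr => i _; rewrite -cons_set_tnth.
have := IH (fun r => P (lift ord0 r)) _ (interior_multilinear (e i) la).
rewrite /interior => ->; rewrite big_distrr /=.
apply: eq_bigr => f _; rewrite big_ord_recl !ffunE unlift_none /= mulrA.
congr (_ * _ * _).
  by apply: eq_bigr => r _; rewrite ffunE liftK.
rewrite mktuple_cons ffunE unlift_none /=; congr a; apply: val_inj => /=.
by congr (_ :: _); apply: eq_map => r /=; rewrite ffunE liftK.
Qed.

(** Polarization: expanding the vanishing value with x + y in both slots leaves two mixed terms
    whose sum is zero. *)
Lemma alternating_tperm k (a : kform V k) v (i j : 'I_k) : alternating a ->
  i != j -> a [tuple tnth v (tperm i j r) | r < k] = - a v.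
Proof.
case=> la alt nij; pose u x y := set_tnth (set_tnth v i x) j y.
have u0 x : a (u x x) = 0.
  by apply: (alt _ i j nij); rewrite !tnth_set eqxx (negPf nij) eqxx.
have uD x y z : a (u (x + y) z) = a (u x z) + a (u y z).
  by rewrite /u !(set_tnthC _ _ _ nij) -[x]scale1r la mul1r scale1r.
have uD' x y z : a (u z (x + y)) = a (u z x) + a (u z y).
  by rewrite /u -[x]scale1r la mul1r scale1r.
have -> : [tuple tnth v (tperm i j r) | r < k] = u (tnth v j) (tnth v i).
  apply: eq_from_tnth => r; rewrite tnth_mktuple !tnth_set.
  case: tpermP => [->|->|/eqP ni /eqP nj]; first by rewrite (negPf nij) eqxx.
    by rewrite eqxx.
  by rewrite (negPf ni) (negPf nj).
have : a (u (tnth v i + tnth v j) (tnth v i + tnth v j)) = 0 by [].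
rewrite uD !uD' !u0 add0r addr0 => /eqP; rewrite addrC addr_eq0 => /eqP ->.
by rewrite /u !set_tnth_id.
Qed.

Lemma alternating_perm k (a : kform V k) v (s : 'S_k) : alternating a ->
  a [tuple tnth v (s r) | r < k] = (-1) ^+ s * a v.
Proof.
move=> alt; case: (prod_tpermP s) => ts -> {s}.
elim: ts v => [|[i j] ts IH] v /=.
  move=> _; rewrite big_nil odd_perm1 mul1r; congr a.
  by apply: eq_from_tnth => r; rewrite tnth_mktuple perm1.
case/andP => nij /IH {}IH; rewrite big_cons /=.
set s := (\prod_(t <- ts) _)%g in IH *.
rewrite odd_mul_tperm nij signr_addb expr1 -mulrA -IH mulN1r.
rewrite -(alternating_tperm _ alt nij); congr a.
by apply: eq_from_tnth => r; rewrite !tnth_mktuple permM.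
Qed.

Lemma alternating_noninj k (a : kform V k) (T : eqType) (e : T -> V) (I : 'I_k -> T) :
  alternating a -> ~~ injectiveb I -> a [tuple e (I r) | r < k] = 0.
Proof.
case=> _ alt /injectivePn[i [j nij E]].
by apply: (alt _ i j nij); rewrite !tnth_mktuple E.
Qed.

Lemma basis_expand n (b : n.-tuple V) x : basis_of fullv b ->
  x = \sum_i coord b i x *: tnth b i.
Proof.
move=> hb; rewrite {1}(coord_basis hb (memvf x)).
by apply: eq_bigr => i _; rewrite -tnth_nth.
Qed.

Lemma multilinear_coord k n (b : n.-tuple V) (a : kform V k) v :
  basis_of fullv b -> multilinear a ->
  a v = \sum_(I : {ffun 'I_k -> 'I_n})
    (\prod_r coord b (I r) (tnth v r)) * a [tuple tnth b (I r) | r < k].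
Proof.
move=> hb la.
rewrite -(multilinear_expand _ (fun r i => coord b i (tnth v r))) //.
by congr a; apply: eq_from_tnth => r; rewrite tnth_mktuple -basis_expand.
Qed.

Lemma alternating_ext k n (b : n.-tuple V) (a a' : kform V k) :
  basis_of fullv b -> alternating a -> alternating a' ->
  (forall I : 'I_k -> 'I_n, injective I ->
    a [tuple tnth b (I r) | r < k] = a' [tuple tnth b (I r) | r < k]) ->
  a = a'.
Proof.
move=> hb alt alt' E; apply: funext => v.
rewrite !(multilinear_coord v hb) //; [|by case: alt'|by case: alt].
apply: eq_bigr => I _; case: (boolP (injectiveb I)) => [/injectiveP/E ->//|nI].
by rewrite !alternating_noninj.
Qed.

Lemma alternating_top_ext n (b : n.-tuple V) (a a' : kform V n) :
  basis_of fullv b -> alternating a -> alternating a' -> a b = a' b -> a = a'.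
Proof.
move=> hb alt alt' E; apply: (alternating_ext hb) => // I injI.
(* An injective self-map of ['I_n] is a permutation, so only the value on [b] itself matters. *)
have -> : [tuple tnth b (I r) | r < n] = [tuple tnth b (perm injI r) | r < n].
  by apply: eq_from_tnth => r; rewrite !tnth_mktuple permE.
by rewrite !alternating_perm ?E.
Qed.

Lemma alternatingZ k c (a : kform V k) : alternating a -> alternating (c *: a).
Proof.
move=> [la alt]; split => [v i d x y|v i j nij E].
  by rewrite !fctE la /=; rewrite /GRing.scale /=; ring.
by rewrite !fctE (alt _ _ _ nij E) /GRing.scale /= mulr0.
Qed.

Lemma det_alternating n (o : n.-tuple V) :
  alternating (fun v : n.-tuple V => \det (\matrix_(i < n, j < n) coord o i (tnth v j))).
Proof.
pose M (v : n.-tuple V) : 'M[R]_n := \matrix_(i, j) coord o i (tnth v j).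
split=> [v i c x y|v i j nij E].
  transitivity (c * \det (M (set_tnth v i x))^T + 1 * \det (M (set_tnth v i y))^T).
    rewrite -det_tr; apply: (determinant_multilinear (i0 := i)).
  - by apply/rowP => j; rewrite !mxE !tnth_set eqxx linearP mul1r.
  - by apply/matrixP => k j; rewrite !mxE !tnth_set eq_sym (negPf (neq_lift _ _)).
  - by apply/matrixP => k j; rewrite !mxE !tnth_set eq_sym (negPf (neq_lift _ _)).
  by rewrite mul1r !det_tr.
by rewrite -det_tr; apply: (determinant_alternate nij) => k; rewrite !mxE E.
Qed.

Lemma alternatingD k (a a' : kform V k) :
  alternating a -> alternating a' -> alternating (a + a').
Proof.
move=> [la alt] [la' alt']; split => [v i d x y|v i j nij E].
  by rewrite !fctE la la'; ring.
by rewrite !fctE (alt _ _ _ nij E) (alt' _ _ _ nij E) addr0.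
Qed.

Lemma alternating0 k : alternating (0 : kform V k).
Proof. by split=> [v i c x y|//]; rewrite [RHS]addr0 [RHS]mulr0. Qed.

Lemma alternating_sum k (I : Type) (r : seq I) (F : I -> kform V k) :
  (forall i, alternating (F i)) -> alternating (\sum_(i <- r) F i).
Proof.
move=> altF; elim: r => [|i r IH]; rewrite ?big_nil ?big_cons.
  exact: alternating0.
exact: alternatingD.
Qed.

Lemma alternating_altsum k (a : kform V k) : multilinear a ->
  alternating (fun v => \sum_(s : 'S_k) (-1) ^+ s * a [tuple tnth v (s r) | r < k]).
Proof.
move=> la; split => [v i c x y|v i j nij E].
  rewrite big_distrr -big_split /=; apply: eq_bigr => s _.
  have H z : [tuple tnth (set_tnth v i z) (s r) | r < k] =
      set_tnth [tuple tnth v (s r) | r < k] (s^-1%g i) z.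
    apply: eq_from_tnth => r; rewrite !tnth_mktuple.
    by rewrite (canF_eq (permK s)).
  by rewrite !H la mulrDr mulrCA.
(* Composing with the transposition of the two equal slots keeps every value and reverses every
   sign. *)
set S := \sum_s _; suff : S = - S by move=> H; lra.
rewrite /S [LHS](reindex_inj (mulIg (tperm i j))) -sumrN; apply: eq_bigr => s _ /=.
rewrite odd_permM odd_tperm nij signr_addb expr1 mulrN1 mulNr; congr (- (_ * a _)).
apply: eq_from_tnth => r; rewrite !tnth_mktuple permM.
by case: tpermP => [->|->|//].
Qed.

(** The tensor product of two forms; [wedge] is its antisymmetrization divided by p! q!. *)
Definition shuffle_product p q (a : kform V p) (b : kform V q) : kform V (p + q) :=
  fun v => a [tuple tnth v (lshift q i) | i < p] * b [tuple tnth v (rshift p j) | j < q].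

Lemma shuffle_product_multilinear p q (a : kform V p) (b : kform V q) :
  multilinear a -> multilinear b -> multilinear (shuffle_product a b).
Proof.
move=> la lb v i c x y; rewrite /shuffle_product.
case: (split_ordP i) => j ->.
  have L z : [tuple tnth (set_tnth v (lshift q j) z) (lshift q r) | r < p] =
      set_tnth [tuple tnth v (lshift q r) | r < p] j z.
    by apply: eq_from_tnth => r; rewrite !tnth_mktuple (inj_eq (@lshift_inj _ _)).
  have Rr z : [tuple tnth (set_tnth v (lshift q j) z) (rshift p r) | r < q] =
      [tuple tnth v (rshift p r) | r < q].
    by apply: eq_from_tnth => r; rewrite !tnth_mktuple eq_rlshift.
  by rewrite !L !Rr la; ring.
have L z : [tuple tnth (set_tnth v (rshift p j) z) (lshift q r) | r < p] =
    [tuple tnth v (lshift q r) | r < p].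
  by apply: eq_from_tnth => r; rewrite !tnth_mktuple eq_lrshift.
have Rr z : [tuple tnth (set_tnth v (rshift p j) z) (rshift p r) | r < q] =
    set_tnth [tuple tnth v (rshift p r) | r < q] j z.
  by apply: eq_from_tnth => r; rewrite !tnth_mktuple (inj_eq (@rshift_inj _ _)).
by rewrite !L !Rr lb; ring.
Qed.

Lemma wedgeE p q (a : kform V p) (b : kform V q) :
  wedge a b = (p`! * q`!)%:R^-1 *: (fun v => \sum_(s : 'S_(p + q)) (-1) ^+ s *
    shuffle_product a b [tuple tnth v (s r) | r < p + q]).
Proof.
apply: funext => v; rewrite fctE /wedge; congr (_ * _); apply: eq_bigr => s _.
rewrite /shuffle_product mulrA; congr (_ * a _ * b _).
  by apply: eq_from_tnth => r; rewrite !tnth_mktuple.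
by apply: eq_from_tnth => r; rewrite !tnth_mktuple.
Qed.

Lemma wedge_alternating p q (a : kform V p) (b : kform V q) :
  multilinear a -> multilinear b -> alternating (wedge a b).
Proof.
move=> la lb; rewrite wedgeE; apply: alternatingZ; apply: alternating_altsum.
exact: shuffle_product_multilinear.
Qed.

Lemma one_form_multilinear (f : 'Hom(V, R^o)) : multilinear (one_form f).
Proof.
move=> v i c x y; rewrite /one_form !tnth_set (ord1 i) eqxx.
by rewrite linearP.
Qed.

End Multilinear.

(** * Orthonormal and dual bases *)

Section OrthonormalBases.
Context {R : realType} {V : vectType R} (h : V -> V -> R).

Definition symmetric_bilinear : Prop :=
  (forall x y, h x y = h y x) /\
  (forall c x y z, h (c *: x + y) z = c * h x z + h y z).

Definition orthonormal_basis n (eps : 'I_n -> R) (b : n.-tuple V) : Prop :=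
  [/\ basis_of fullv b, forall i, eps i * eps i = 1 &
      forall i j, h (tnth b i) (tnth b j) = if i == j then eps i else 0].

Hypothesis hbil : symmetric_bilinear.

Lemma bilin0l x : h 0 x = 0.
Proof.
case: hbil => _ /(_ (-1) 0 0 x); rewrite scaleN1r oppr0 addr0.
by rewrite mulN1r addNr.
Qed.

Lemma bilin_suml (I : Type) (r : seq I) (c : I -> R) (x : I -> V) y :
  h (\sum_(i <- r) c i *: x i) y = \sum_(i <- r) c i * h (x i) y.
Proof.
elim: r => [|i r IH]; rewrite ?big_nil ?bilin0l // !big_cons.
by case: hbil => _ ->; rewrite IH.
Qed.

Lemma bilin_sumr (I : Type) (r : seq I) (c : I -> R) (x : I -> V) y :
  h y (\sum_(i <- r) c i *: x i) = \sum_(i <- r) c i * h y (x i).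
Proof.
case: (hbil) => hC _; rewrite hC bilin_suml.
by apply: eq_bigr => i _; rewrite hC.
Qed.

Section Basis.
Context {n : nat} {eps : 'I_n -> R} {b : n.-tuple V}.
Hypothesis ob : orthonormal_basis eps b.

Let hb : basis_of fullv b. Proof. by case: ob. Qed.

Lemma orthonormal_metric x y :
  h x y = \sum_i eps i * (coord b i x * coord b i y).
Proof.
case: ob => _ _ hbb.
rewrite {1}(basis_expand x hb) {1}(basis_expand y hb) bilin_suml.
apply: eq_bigr => i _; rewrite bilin_sumr (bigD1 i) //= hbb eqxx.
rewrite big1 ?addr0; first by ring.
by move=> j ij; rewrite hbb eq_sym (negPf ij) mulr0.
Qed.

Lemma cometricE i j :
  cometric h i j = \sum_m eps m * (coord (vbasis {:V}) i (tnth b m) *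
                                   coord (vbasis {:V}) j (tnth b m)).
Proof.
case: (ob) => _ he hbb.
have vb : basis_of fullv (vbasis {:V}) by exact: vbasisP.
(* The sizes n and [\dim {:V}] are equal but not convertible. The change of basis is therefore a
   pair of rectangular matrices, and both products have to be shown to be the identity. *)
pose d := \dim {:V}.
pose P : 'M[R]_(n, d) := \matrix_(m, j) coord (vbasis {:V}) j (tnth b m).
pose Q : 'M[R]_(d, n) := \matrix_(j, m) coord b m (tnth (vbasis {:V}) j).
pose D : 'M[R]_n := diag_mx (\row_m eps m).
have PQ : P *m Q = 1%:M.
  apply/matrixP => m m'; rewrite !mxE.
  rewrite -(coord_free m m' (basis_free hb)) -tnth_nth [in RHS](basis_expand (tnth b m) vb).
  by rewrite linear_sum /=; apply: eq_bigr => k _; rewrite !mxE linearZ.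
have QP : Q *m P = 1%:M.
  apply/matrixP => m m'; rewrite !mxE.
  rewrite -(coord_free m m' (basis_free vb)) -tnth_nth [in RHS](basis_expand (tnth _ m) hb).
  by rewrite linear_sum /=; apply: eq_bigr => k _; rewrite !mxE linearZ.
have GE : gram h (vbasis {:V}) = Q *m D *m Q^T.
  apply/matrixP => k l; rewrite !mxE orthonormal_metric.
  apply: eq_bigr => m _; rewrite mul_mx_diag !mxE; ring.
have DD : D *m D = 1%:M.
  apply/matrixP => k l; rewrite mul_diag_mx !mxE.
  by case: eqP => [->|] ; rewrite /= ?mulr1n ?mulr0n ?he ?mulr0.
have CE : cometric h = P^T *m D *m P.
  have H : P^T *m D *m P *m gram h (vbasis {:V}) = 1%:M.
    rewrite GE !mulmxA -(mulmxA _ P Q) PQ mulmx1 -(mulmxA _ D D) DD mulmx1.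
    by rewrite -trmx_mul QP trmx1.
  have [_ U] := mulmx1_unit H.
  by rewrite /cometric -[LHS]mul1mx -H -(mulmxA _ (gram _ _)) mulmxV ?mulmx1.
rewrite CE !mxE; apply: eq_bigr => m _; rewrite mul_mx_diag !mxE; ring.
Qed.

(** Contraction with the cometric does not depend on the basis and is diagonal in an orthonormal
    one. This is what makes [triangle1] computable. *)
Lemma cometric_contraction (F : V -> V -> R) :
  (forall c x y z, F (c *: x + y) z = c * F x z + F y z) ->
  (forall c x y z, F z (c *: x + y) = c * F z x + F z y) ->
  \sum_i \sum_j cometric h i j *
     F (tnth (vbasis {:V}) i) (tnth (vbasis {:V}) j) =
  \sum_m eps m * F (tnth b m) (tnth b m).
Proof.
move=> Fl Fr; have vb : basis_of fullv (vbasis {:V}) by exact: vbasisP.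
have F0l z : F 0 z = 0.
  by have := Fl (-1) 0 0 z; rewrite scaleN1r oppr0 addr0 mulN1r addNr.
have F0r z : F z 0 = 0.
  by have := Fr (-1) 0 0 z; rewrite scaleN1r oppr0 addr0 mulN1r addNr.
have Fsl (I : Type) (r : seq I) (c : I -> R) (x : I -> V) z :
    F (\sum_(i <- r) c i *: x i) z = \sum_(i <- r) c i * F (x i) z.
  by elim: r => [|i r IH]; rewrite ?big_nil ?F0l // !big_cons Fl IH.
have Fsr (I : Type) (r : seq I) (c : I -> R) (x : I -> V) z :
    F z (\sum_(i <- r) c i *: x i) = \sum_(i <- r) c i * F z (x i).
  by elim: r => [|i r IH]; rewrite ?big_nil ?F0r // !big_cons Fr IH.
under eq_bigr => i _.
  under eq_bigr => j _ do rewrite cometricE big_distrl /=.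
  rewrite exchange_big /=; over.
rewrite exchange_big /=; apply: eq_bigr => m _.
rewrite [in RHS](basis_expand (tnth b m) vb) Fsl big_distrr /=.
apply: eq_bigr => i _; rewrite Fsr !big_distrr /=.
by apply: eq_bigr => j _; ring.
Qed.

Lemma form_metricE k (a c : kform V k) : alternating a -> multilinear c ->
  form_metric h a c = k`!%:R^-1 * \sum_(I : {ffun 'I_k -> 'I_n})
    (\prod_r eps (I r)) * (a [tuple tnth b (I r) | r < k] *
                           c [tuple tnth b (I r) | r < k]).
Proof.
move=> alt lc; have la := alternating_multilinear alt.
have vb : basis_of fullv (vbasis {:V}) by exact: vbasisP.
set d := \dim {:V}; pose e := tnth (vbasis {:V}).
pose P m j := coord (vbasis {:V}) j (tnth b m).
have expand (f : kform V k) (I : {ffun 'I_k -> 'I_n}) : multilinear f ->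
    f [tuple tnth b (I r) | r < k] =
    \sum_(J : {ffun 'I_k -> 'I_d}) (\prod_r P (I r) (J r)) * f [tuple e (J r) | r < k].
  move=> lf; rewrite -(multilinear_expand _ (fun r j => P (I r) j)) //.
  by congr f; apply: eq_from_tnth => r; rewrite !tnth_mktuple -basis_expand.
(* As [a] is alternating, the k! terms of the determinant contribute equally; this cancels one of
   the two factors k! of the definition. *)
have step (J : {ffun 'I_k -> 'I_d}) :
    \sum_(I : {ffun 'I_k -> 'I_d})
      \det (\matrix_(r < k, s < k) cometric h (I r) (J s)) * a [tuple e (I r) | r < k] =
    k`!%:R * \sum_(I : {ffun 'I_k -> 'I_d})
      (\prod_r cometric h (I r) (J r)) * a [tuple e (I r) | r < k].
  under eq_bigr => I _ do rewrite big_distrl /=.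
  rewrite exchange_big /= -[k`!](card_Sn k) mulr_natl -sumr_const.
  apply: eq_bigr => s _.
  rewrite (reindex (fun I : {ffun 'I_k -> 'I_d} => [ffun r => I (s r)])) /=; last first.
    exists (fun I : {ffun 'I_k -> 'I_d} => [ffun r => I (s^-1%g r)]) => I _.
      by apply/ffunP => r; rewrite !ffunE permKV.
    by apply/ffunP => r; rewrite !ffunE permK.
  apply: eq_bigr => I _.
  have -> : [tuple e ([ffun r => I (s r)] r) | r < k] =
      [tuple tnth [tuple e (I r) | r < k] (s r) | r < k].
    by apply: eq_from_tnth => r; rewrite !tnth_mktuple ffunE.
  rewrite alternating_perm //.
  rewrite mulrACA -signr_addb addbb mul1r; congr (_ * _).
  rewrite [RHS](reindex_inj (@perm_inj _ s)) /=.
  by apply: eq_bigr => r _; rewrite mxE ffunE.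
rewrite /form_metric exchange_big /=.
under eq_bigr => J _ do rewrite -big_distrl /= step -mulrA.
rewrite -big_distrr /= mulrA; congr (_ * _).
  have k0 : k`!%:R != 0 :> R by rewrite pnatr_eq0 -lt0n fact_gt0.
  by rewrite natrX; move: k`!%:R k0 => y y0; field.
under eq_bigr => J _.
  rewrite big_distrl /=.
  under eq_bigr => I _.
    under eq_bigr => r _ do rewrite cometricE.
    rewrite (bigA_distr_bigA (fun r m => eps m * (P m (I r) * P m (J r)))) /= -mulrA big_distrl /=.
    over.
  rewrite exchange_big /=; over.
rewrite exchange_big /=; apply: eq_bigr => M _.
rewrite !expand // big_distrlr /= exchange_big /= big_distrr /=.
apply: eq_bigr => J _; rewrite big_distrr /=; apply: eq_bigr => I _.
by rewrite !big_split /=; ring.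
Qed.
End Basis.
End OrthonormalBases.

Section DualBases.
Context {R : realType} {V : vectType R} {n : nat}.
Implicit Types (f : n.-tuple 'Hom(V, R^o)) (b : n.-tuple V).

Definition dual_basis f b : Prop :=
  forall i j, tnth f i (tnth b j) = (i == j)%:R.

Lemma sum_delta (F : 'I_n -> R) i : \sum_j F j * (i == j)%:R = F i.
Proof.
rewrite (bigD1 i) //= eqxx mulr1 big1 ?addr0 // => j ij.
by rewrite eq_sym (negPf ij) mulr0.
Qed.

Lemma dual_basis_free f b : dual_basis f b -> free b.
Proof.
move=> fb; apply/freeP => c c0 i.
have := congr1 (tnth f i) c0; rewrite linear_sum linear0 /= => E.
rewrite -[LHS](sum_delta c i) -[RHS]E; apply: eq_bigr => j _.
by rewrite linearZ -tnth_nth /= fb.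
Qed.

Lemma dual_basis_free_coframe f b : dual_basis f b -> free f.
Proof.
move=> fb; apply/freeP => c c0 j.
have := congr1 (fun g : 'Hom(V, R^o) => g (tnth b j)) c0.
rewrite sum_lfunE lfunE /= => E.
rewrite -[LHS](sum_delta c j) -[RHS]E; apply: eq_bigr => i _.
by rewrite lfunE /= -tnth_nth fb eq_sym.
Qed.

Hypothesis dimV : \dim {:V} = n.

Lemma dim_dual : \dim {: 'Hom(V, R^o)} = n.
Proof. by rewrite dimvf -[RHS]dimV dimvf /dim /= muln1. Qed.

Lemma dual_basis_basis f b : dual_basis f b -> basis_of fullv b.
Proof.
by move=> fb; rewrite basisEfree (dual_basis_free fb) subvf size_tuple dimV leqnn.
Qed.

Lemma dual_basis_coframe f b : dual_basis f b -> basis_of fullv f.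
Proof.
move=> fb; rewrite basisEfree (dual_basis_free_coframe fb) subvf.
by rewrite size_tuple dim_dual leqnn.
Qed.

Lemma dual_basis_coord f b i x : dual_basis f b -> coord b i x = tnth f i x.
Proof.
move=> fb; have hb := dual_basis_basis fb.
rewrite {2}(basis_expand x hb) linear_sum /=.
rewrite -[LHS](sum_delta (fun j => coord b j x) i); apply: eq_bigr => j _.
by rewrite linearZ /= fb.
Qed.

Lemma exists_dual_basis f : basis_of fullv f -> exists b, dual_basis f b.
Proof.
move=> hf; have vb : basis_of fullv (vbasis {:V}) by exact: vbasisP.
pose e (j : 'I_n) := tnth (vbasis {:V}) (cast_ord (esym dimV) j).
pose A : 'M[R]_n := \matrix_(i, j) tnth f i (e j).
(* A relation between the rows of [A] is a relation between the functionals, so freeness makes [A]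
   invertible. The columns of its inverse give the dual basis. *)
have uA : A \in unitmx.
  rewrite -row_free_unit; apply: inj_row_free => c cA.
  have H : \sum_i c 0 i *: f`_i = 0.
    apply/lfunP => x; rewrite lfunE /= (basis_expand x vb) !linear_sum /=.
    rewrite big1 // => j _; rewrite linearZ /=.
    rewrite sum_lfunE; have := congr1 (fun M : 'rV_n => M 0 (cast_ord dimV j)) cA.
    rewrite !mxE => E; rewrite [X in _ *: X](_ : _ = 0) ?scaler0 // -[RHS]E.
    apply: eq_bigr => i _; rewrite !mxE lfunE /= -tnth_nth /e.
    by congr (_ * tnth f i (tnth _ _)); apply: val_inj.
  by have /freeP free_f := basis_free hf; apply/rowP => i; rewrite (free_f _ H) mxE.
exists [tuple \sum_k (invmx A) k j *: e k | j < n] => i j.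
rewrite tnth_mktuple linear_sum /=.
have := congr1 (fun M : 'M_n => M i j) (mulmxV uA); rewrite !mxE => <-.
by apply: eq_bigr => k _; rewrite linearZ /= mulrC mxE.
Qed.

Lemma exists_dual_coframe b : basis_of fullv b -> exists f, dual_basis f b.
Proof.
move=> hb; exists [tuple linfun (coord b i : V -> R^o) | i < n] => i j.
rewrite tnth_mktuple lfunE /= (tnth_nth 0) coord_free ?(basis_free hb) //.
by rewrite eq_sym.
Qed.

End DualBases.

Section Coframes.
Context {R : realType} {V : vectType R} (h : V -> V -> R).
Context {n : nat} (eps : 'I_n -> R).
Hypothesis hbil : symmetric_bilinear h.
Hypothesis dimV : \dim {:V} = n.

Lemma one_form_metric b (f g : 'Hom(V, R^o)) : orthonormal_basis h eps b ->
  form_metric h (one_form f) (one_form g) =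
  \sum_i eps i * (f (tnth b i) * g (tnth b i)).
Proof.
move=> ob; have alt1 (a : 'Hom(V, R^o)) : alternating (one_form a).
  split; first exact: one_form_multilinear.
  by move=> v i j; rewrite !ord1 eqxx.
rewrite (form_metricE hbil ob) //; last exact: one_form_multilinear.
rewrite invr1 mul1r big_ffun_recl; apply: eq_bigr => i _.
rewrite (big_ffun0 _ (ffun0 (card_ord 0))) big_ord1 /one_form !tnth_mktuple.
by rewrite ffunE unlift_none.
Qed.

(** The Gram matrices of a coframe and of its dual basis are inverse to each other, and the diagonal
    matrix of signs is its own inverse. The reference basis [b0] gives access to [form_metric]
    before [b] is known to be orthonormal. *)
Lemma coframe_orthonormal_basis (b0 b : n.-tuple V) (f : n.-tuple 'Hom(V, R^o)) :
  orthonormal_basis h eps b0 -> dual_basis f b ->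
  (forall i j, form_metric h (one_form (tnth f i)) (one_form (tnth f j)) =
     if i == j then eps i else 0) <->
  orthonormal_basis h eps b.
Proof.
move=> ob0 fb; split=> [E|ob i j]; last first.
  rewrite (one_form_metric _ _ ob) (bigD1 i) //= !fb eqxx big1 => [|k ki].
    by rewrite addr0 mul1r [j == i]eq_sym; case: eqP; rewrite ?mulr1 ?mulr0.
  by rewrite fb eq_sym (negPf ki) mul0r mulr0.
have [hb0 he hbb] := ob0.
split=> // [|i j]; first exact: dual_basis_basis fb.
pose P : 'M[R]_n := \matrix_(i, j) tnth f i (tnth b0 j).
pose Q : 'M[R]_n := \matrix_(i, j) coord b0 i (tnth b j).
pose D : 'M[R]_n := diag_mx (\row_m eps m).
have DD : D *m D = 1%:M.
  apply/matrixP => k l; rewrite mul_diag_mx !mxE.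
  by case: eqP => [->|] ; rewrite /= ?mulr1n ?mulr0n ?he ?mulr0.
have PQ : P *m Q = 1%:M.
  apply/matrixP => k l; rewrite !mxE -fb [in RHS](basis_expand (tnth b l) hb0).
  by rewrite linear_sum; apply: eq_bigr => m _; rewrite linearZ !mxE mulrC.
have PD : P *m D *m P^T = D.
  apply/matrixP => k l; rewrite mul_mx_diag !mxE.
  transitivity (if k == l then eps k else 0); last by case: eqP.
  rewrite -(E k l) (one_form_metric _ _ ob0).
  by apply: eq_bigr => m _; rewrite !mxE; ring.
have QP := mulmx1C PQ.
have QDQ : Q^T *m D *m Q = D.
  have H : Q *m D *m Q^T = D.
    rewrite -{1}PD !mulmxA QP mul1mx -mulmxA -trmx_mul.
    by rewrite QP trmx1 mulmx1.
  have H2 : Q *m (D *m Q^T *m D) = 1%:M by rewrite !mulmxA H DD.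
  have := mulmx1C H2; move=> H3.
  by rewrite -[LHS]mul1mx -{1}DD -!mulmxA [in X in D *m X]mulmxA [in X in D *m X]mulmxA H3 mulmx1.
have := congr1 (fun M : 'M_n => M i j) QDQ; rewrite !mxE => H.
rewrite (orthonormal_metric hbil ob0); transitivity (eps i *+ (i == j)); last first.
  by case: eqP.
rewrite -H; apply: eq_bigr => m _; rewrite mul_mx_diag !mxE; ring.
Qed.

End Coframes.

(** * Evaluation of wedge products *)

(** The signed sum over all orderings of a list, expanded along the first entry. Unlike a sum over
    ['S_n], it unfolds under [/=] and runs under [vm_compute]. *)
Fixpoint altsum (A : pzRingType) (T : Type) (x0 : T) n (s : seq T)
    (F : seq T -> A) : A :=
  if n is m.+1 then
    foldr (fun i acc => (-1) ^+ i *
      altsum x0 m (take i s ++ drop i.+1 s) (fun l => F (nth x0 s i :: l)) + acc)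
      0 (iota 0 m.+1)
  else F [::].

Lemma foldr_sum (A : nmodType) n (F : nat -> A) :
  foldr (fun i acc => F i + acc) 0 (iota 0 n) = \sum_(i < n) F i.
Proof. by rewrite -(big_mkord predT) unlock /= /index_iota subn0. Qed.

Lemma foldr_sum3 (A : nmodType) n (F : nat -> nat -> nat -> A) :
  foldr (fun x acc => foldr (fun y acc => foldr (fun z acc => F x y z + acc)
    0 (iota 0 n) + acc) 0 (iota 0 n) + acc) 0 (iota 0 n) =
  \sum_(x < n) \sum_(y < n) \sum_(z < n) F x y z.
Proof.
rewrite (foldr_sum n); apply: eq_bigr => x _.
rewrite (foldr_sum n (fun y => foldr _ _ _)); apply: eq_bigr => y _.
by rewrite (foldr_sum n (fun z => F x y z)).
Qed.

Lemma altsumS (A : pzRingType) (T : Type) (x0 : T) n (s : seq T) (F : seq T -> A) :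
  altsum x0 n.+1 s F = \sum_(i < n.+1) (-1) ^+ i *
    altsum x0 n (take i s ++ drop i.+1 s) (fun l => F (nth x0 s i :: l)).
Proof. exact: (foldr_sum n.+1 (fun i => (-1) ^+ i * _)). Qed.

Lemma altsum_intr (A : pzRingType) (T : Type) (x0 : T) n s (F : seq T -> int) :
  altsum x0 n s (fun l => (F l)%:~R) = (altsum x0 n s F)%:~R :> A.
Proof.
elim: n s F => [//|n IH] s F; rewrite !altsumS rmorph_sum /=.
by apply: eq_bigr => i _; rewrite IH rmorphM rmorphXn rmorphN1.
Qed.

Lemma altsumE (A : pzRingType) (T : Type) (x0 : T) n (s : seq T) (F : seq T -> A) :
  size s = n ->
  \sum_(t : 'S_n) (-1) ^+ t * F [seq nth x0 s (t i) | i <- enum 'I_n] =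
  altsum x0 n s F.
Proof.
elim: n s F => [|n IH] s F sz.
  have enum0 : enum 'I_0 = [::] by apply/size0nil; rewrite size_enum_ord.
  rewrite (big_pred1 (1%g : 'S_0)) => [|t]; last first.
    by apply/esym/eqP/permP; case.
  by rewrite odd_perm1 mul1r enum0.
rewrite altsumS big_perm_recl; apply: eq_bigr => i _.
rewrite -IH; last first.
  by rewrite size_cat size_take size_drop sz ltn_ord subSS subnKC // -ltnS.
rewrite big_distrr /=; apply: eq_bigr => t _.
rewrite odd_lift_perm /= signr_addb signr_odd mulrA; congr (_ * F _).
rewrite enum_ordSl /= lift_perm_id -map_comp; congr (_ :: _).
apply: eq_map => j /=; rewrite lift_perm_lift /= nth_cat size_take sz ltn_ord.
rewrite /bump; case: (ltnP (t j) i) => ij.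
  by rewrite /= nth_take.
by rewrite nth_drop /= add1n addSn subnKC.
Qed.

Section Evaluation.
Context {R : realType} {V : vectType R}.

(** Lists carry no length proofs, so [take], [drop] and concatenation simplify freely; a list of the
    wrong length is padded with 0 or cut at k. *)
Definition eval_seq k (a : kform V k) (l : seq V) : R :=
  a [tuple nth 0 l i | i < k].

Lemma eval_tuple k (a : kform V k) (v : k.-tuple V) : eval_seq a v = a v.
Proof.
by congr a; apply: eq_from_tnth => i; rewrite tnth_mktuple -tnth_nth.
Qed.

Lemma eval_seq_ext k (a a' : kform V k) : (forall v : k.-tuple V, eval_seq a v = eval_seq a' v) <-> a = a'.
Proof.
split=> [E|-> //]; apply: funext => v; by have := E v; rewrite !eval_tuple.
Qed.

Lemma eval_interior k x (a : kform V k.+1) l :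
  eval_seq (interior x a) l = eval_seq a (x :: l).
Proof.
congr a; apply: eq_from_tnth => j; rewrite tnth_mktuple.
by case: (unliftP ord0 j) => [j' ->|->]; rewrite ?tnthS ?tnth0 ?tnth_mktuple.
Qed.

Lemma eval_linear k (a : kform V k) l l' c x y : multilinear a -> (size l < k)%N ->
  eval_seq a (l ++ (c *: x + y) :: l') =
  c * eval_seq a (l ++ x :: l') + eval_seq a (l ++ y :: l').
Proof.
move=> la lk; have E z : [tuple nth 0 (l ++ z :: l') i | i < k] =
    set_tnth [tuple nth 0 (l ++ 0 :: l') i | i < k] (Ordinal lk) z.
  apply: eq_from_tnth => i; rewrite !tnth_mktuple -val_eqE /= !nth_cat.
  case: (ltngtP i (size l)) => // [il|->]; last by rewrite subnn.
  by case: (i - _)%N (subn_gt0 (size l) i) => [|m] //=; rewrite il.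
by rewrite /eval_seq (E (c *: x + y)) (E x) (E y) la.
Qed.

Lemma eval_swap k (a : kform V k) l l' x y : alternating a ->
  (size l + 2 <= k)%N ->
  eval_seq a (l ++ x :: y :: l') = - eval_seq a (l ++ y :: x :: l').
Proof.
move=> alt lk; have ik : (size l < k)%N by apply: leq_trans lk; rewrite addn2.
have jk : ((size l).+1 < k)%N by apply: leq_trans lk; rewrite addn2.
rewrite /eval_seq -(@alternating_tperm _ _ _ a _ (Ordinal ik) (Ordinal jk)) //.
  congr a; apply: eq_from_tnth => i; rewrite !tnth_mktuple !nth_cat.
  case: tpermP => [->|->|/eqP ni /eqP nj] /=.
  - by rewrite ltnn subnn ltnNge leqnSn /= subSnn.
  - by rewrite ltnn subnn ltnNge leqnSn /= subSnn.
  move: ni nj; rewrite -!val_eqE /=.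
  case: (ltngtP i (size l)) => // il _ nj.
  by have -> : (i - size l = (i - (size l).+2).+2)%N by lia.
by rewrite -val_eqE /= neq_ltn ltnSn.
Qed.

Lemma eval_diag k (a : kform V k) l l' x : alternating a ->
  (size l + 2 <= k)%N -> eval_seq a (l ++ x :: x :: l') = 0.
Proof. by move=> alt lk; have := eval_swap l' x x alt lk; lra. Qed.

Lemma eval_wedge p q (a : kform V p) (b : kform V q) l : size l = (p + q)%N ->
  eval_seq (wedge a b) l = (p`! * q`!)%:R^-1 *
    altsum 0 (p + q) l (fun l => eval_seq a (take p l) * eval_seq b (drop p l)).
Proof.
move=> sz; rewrite -altsumE // /eval_seq /wedge; congr (_ * _).
apply: eq_bigr => s _; rewrite -mulrA; congr (_ * (a _ * b _)).
  apply: eq_from_tnth => i; rewrite !tnth_mktuple nth_take //.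
  rewrite (nth_map (lshift q i)) ?size_enum_ord ?ltn_addr //.
  by rewrite (nth_ord_enum _ (lshift q i)).
apply: eq_from_tnth => i; rewrite !tnth_mktuple nth_drop.
rewrite (nth_map (rshift p i)) ?size_enum_ord ?ltn_add2l //.
by rewrite (nth_ord_enum _ (rshift p i)).
Qed.

Lemma eval_one_form (f : 'Hom(V, R^o)) l : eval_seq (one_form f) l = f (nth 0 l 0).
Proof. by rewrite /eval_seq /one_form tnth_mktuple. Qed.

(** The 24 permutations fall into six shuffles, each met four times, which cancels the denominator
    2! 2!. *)
Lemma eval_wedge22 (a b : kform V 2) w0 w1 w2 w3 :
  alternating a -> alternating b ->
  eval_seq (wedge a b) [:: w0; w1; w2; w3] =
    eval_seq a [:: w0; w1] * eval_seq b [:: w2; w3]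
  - eval_seq a [:: w0; w2] * eval_seq b [:: w1; w3]
  + eval_seq a [:: w0; w3] * eval_seq b [:: w1; w2]
  + eval_seq a [:: w1; w2] * eval_seq b [:: w0; w3]
  - eval_seq a [:: w1; w3] * eval_seq b [:: w0; w2]
  + eval_seq a [:: w2; w3] * eval_seq b [:: w0; w1].
Proof.
move=> alta altb; rewrite eval_wedge //= (_ : (2`! * 2`!)%:R = 4) //.
have Sa x y : eval_seq a [:: y; x] = - eval_seq a [:: x; y] by rewrite (@eval_swap 2 a [::]).
have Sb x y : eval_seq b [:: y; x] = - eval_seq b [:: x; y] by rewrite (@eval_swap 2 b [::]).
rewrite (Sa w0 w1) (Sa w0 w2) (Sa w0 w3) (Sa w1 w2) (Sa w1 w3) (Sa w2 w3).
rewrite (Sb w0 w1) (Sb w0 w2) (Sb w0 w3) (Sb w1 w2) (Sb w1 w3) (Sb w2 w3).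
by field.
Qed.

Definition det3 (A : pzRingType) (T : Type) (f g k : T -> A) (x y z : T) : A :=
  f x * (g y * k z - g z * k y) - f y * (g x * k z - g z * k x)
  + f z * (g x * k y - g y * k x).

Lemma eval_wedge111 (f g k : 'Hom(V, R^o)) x y z :
  eval_seq (wedge (wedge (one_form f) (one_form g)) (one_form k)) [:: x; y; z] =
  det3 f g k x y z.
Proof.
rewrite eval_wedge //= !eval_wedge //= !eval_one_form /= /det3.
rewrite (_ : (2`! * 1`!)%:R = 2) // (_ : (1`! * 1`!)%:R = 1) //.
by field.
Qed.

(** Polymorphic in the ring and in the type of points: the same expression is evaluated at
    functionals, at matrix entries and, for the tables, at integer deltas. *)
Definition phi0_poly (A : pzRingType) (T : Type) (f : nat -> T -> A) (x y z : T) : A :=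
  let w i j k := det3 (f i.-1) (f j.-1) (f k.-1) x y z in
  - w 1%N 2%N 7%N - w 1%N 3%N 5%N + w 1%N 4%N 6%N + w 2%N 3%N 6%N
  + w 2%N 4%N 5%N - w 3%N 4%N 7%N + w 5%N 6%N 7%N.

Lemma eval_phi0 (f : 7.-tuple 'Hom(V, R^o)) x y z :
  eval_seq (phi0 f) [:: x; y; z] = phi0_poly (fun i => f`_i) x y z.
Proof. by rewrite /phi0_poly -!eval_wedge111. Qed.

Lemma wedge111_alternating (f g k : 'Hom(V, R^o)) :
  alternating (wedge (wedge (one_form f) (one_form g)) (one_form k)).
Proof.
apply: wedge_alternating; last exact: one_form_multilinear.
by apply: alternating_multilinear; apply: wedge_alternating;
  exact: one_form_multilinear.
Qed.

Lemma alternatingN k (a : kform V k) : alternating a -> alternating (- a).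
Proof. by move=> alt; rewrite -scaleN1r; apply: alternatingZ. Qed.

Lemma phi0_alternating (f : 7.-tuple 'Hom(V, R^o)) : alternating (phi0 f).
Proof.
have W i j k := wedge111_alternating f`_i f`_j f`_k.
by repeat (apply: alternatingD || apply: alternatingN); apply: W.
Qed.

End Evaluation.

(** * The Hodge star *)

(** Every injection of p indices extends to exactly q! permutations of the p + q indices. *)
Lemma sum_perm_lshift (R : pzRingType) p q (F : ('I_p -> 'I_(p + q)) -> R) :
  \sum_(s : 'S_(p + q)) F (fun i => s (lshift q i)) =
  q`!%:R * \sum_(I : {ffun 'I_p -> 'I_(p + q)} | injectiveb I) F I.
Proof.
elim: p F => [|p IH] F.
  rewrite [X in _ = _ * X](_ : _ = F (ffun0 (card_ord 0))); last first.
    by rewrite big_mkcond (big_ffun0 _ (ffun0 (card_ord 0))) ifT //; apply/injectiveP; case.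
  rewrite -(card_Sn q) mulr_natl -sumr_const; apply: eq_bigr => s _.
  by congr F; apply: funext; case.
rewrite -[(p.+1 + q)%N]/(p + q).+1 big_perm_recl.
rewrite [X in _ = _ * X]big_mkcond big_ffun_recl big_distrr; apply: eq_bigr => i _.
pose G (f : 'I_p -> 'I_(p + q)) : 'I_p.+1 -> 'I_(p + q).+1 :=
  fun r => oapp (fun r' => lift i (f r')) i (unlift ord0 r).
transitivity (\sum_(s : 'S_(p + q)) F (G (fun r => s (lshift q r)))).
  apply: eq_bigr => s _; congr F; apply: funext => r; rewrite /G.
  case: unliftP => [j|] -> /=.
    rewrite [lshift q _](_ : _ = lift ord0 (lshift q j)) ?lift_perm_lift //.
    exact: val_inj.
  by rewrite [lshift q _](_ : _ = ord0) ?lift_perm_id //; apply: val_inj.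
rewrite (IH (fun f => F (G f))); congr (_ * _).
rewrite -big_mkcond /=.
pose u (f : {ffun 'I_p -> 'I_(p + q)}) : {ffun 'I_p -> 'I_(p + q).+1} :=
  [ffun r => lift i (f r)].
pose u' (f : {ffun 'I_p -> 'I_(p + q).+1}) : {ffun 'I_p -> 'I_(p + q)} :=
  [ffun r => odflt (lshift q r) (unlift i (f r))].
have Gu (f : {ffun 'I_p -> 'I_(p + q)}) r :
    [ffun r => oapp (u f) i (unlift ord0 r)] r = G f r.
  by rewrite /G ffunE; case: unliftP => [j|] _ //=; rewrite ffunE.
rewrite [RHS](reindex_onto u u') /=; last first.
  move=> f /injectiveP inj; apply/ffunP => r; rewrite !ffunE.
  case: unliftP => [j -> //|E].
  have := inj (lift ord0 r) ord0; rewrite !ffunE liftK unlift_none /= => /(_ E).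
  by [].
apply: eq_big => [f|f _]; last first.
  by congr F; apply: funext => r; rewrite Gu.
have -> : u' (u f) == f by apply/eqP/ffunP => r; rewrite !ffunE liftK.
rewrite andbT; apply/injectiveP/injectiveP => inj.
  move=> r r'; rewrite !Gu /G.
  case: unliftP => [j|] ->; case: unliftP => [j'|] -> //=.
  - by move=> /lift_inj /inj ->.
  - by move=> /eqP; rewrite eq_sym (negPf (neq_lift _ _)).
  - by move=> /eqP; rewrite (negPf (neq_lift _ _)).
move=> r r' E; apply: (@lift_inj _ ord0); apply: inj.
by rewrite !Gu /G !liftK /= E.
Qed.

(** The deltas select the permutations that fix the first p indices; these are the permutations of
    the last q, with the same sign. *)
Lemma sum_perm_fix (R : pzRingType) p q (F : ('I_q -> 'I_(p + q)) -> R) :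
  \sum_(s : 'S_(p + q)) (-1) ^+ s * ((\prod_(i < p) (lshift q i == s (lshift q i))%:R) *
    F (fun j => s (rshift p j))) =
  \sum_(t : 'S_q) (-1) ^+ t * F (fun j => rshift p (t j)).
Proof.
elim: p F => [|p IH] F.
  apply: eq_bigr => s _; rewrite big_ord0 mul1r; congr (_ * F _).
  apply: funext => j; apply: val_inj => /=; congr (val (s _)); exact: val_inj.
rewrite -[(p.+1 + q)%N]/(p + q).+1 big_perm_recl big_ord_recl [X in _ + X]big1 ?addr0.
  rewrite [RHS](_ : _ = \sum_(t : 'S_q) (-1) ^+ t * F (fun j => lift ord0 (rshift p (t j)))); last first.
    by apply: eq_bigr => t _; congr (_ * F _); apply: funext => j; apply: val_inj.
  rewrite -(IH (fun f => F (fun j => lift ord0 (f j)))); apply: eq_bigr => s _.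
  rewrite odd_lift_perm /= big_ord_recl; congr (_ * (_ * F _)).
    rewrite [lshift q _](_ : _ = ord0) ?lift_perm_id ?eqxx ?mul1r; last exact: val_inj.
    apply: eq_bigr => i _.
    rewrite [lshift q _](_ : _ = lift ord0 (lshift q i)) ?lift_perm_lift; last exact: val_inj.
    by rewrite (inj_eq lift_inj).
  apply: funext => j.
  by rewrite [rshift _ _](_ : _ = lift ord0 (rshift p j)) ?lift_perm_lift //; apply: val_inj.
move=> i _; rewrite big1 // => s _.
rewrite big_ord_recl [lshift q _](_ : _ = ord0); last exact: val_inj.
by rewrite lift_perm_id -val_eqE /= !mul0r mulr0.
Qed.

Lemma exists_block_perm p q (t : 'S_p) : exists s : 'S_(p + q),
  [/\ forall i, s (lshift q i) = lshift q (t i),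
      forall j, s (rshift p j) = rshift p j & odd_perm s = odd_perm t].
Proof.
pose f (k : 'I_(p + q)) : 'I_(p + q) :=
  match fintype.split k with inl i => lshift q (t i) | inr j => rshift p j end.
have fl i : f (lshift q i) = lshift q (t i) by rewrite /f (unsplitK (inl _ : _ + _)).
have fr j : f (rshift p j) = rshift p j by rewrite /f (unsplitK (inr _ : _ + _)).
have inj : injective f.
  move=> k k'; case: (split_ordP k) => i ->; case: (split_ordP k') => i' ->;
    rewrite ?fl ?fr => /eqP; rewrite ?eq_lrshift ?eq_rlshift //.
  - by rewrite (inj_eq (@lshift_inj _ _)) (inj_eq perm_inj) => /eqP ->.
  - by rewrite (inj_eq (@rshift_inj _ _)) => /eqP ->.
exists (perm inj); split=> [i|j|]; rewrite ?permE ?fl ?fr //.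
(* The sign of a permutation is the determinant of its matrix, which here is block diagonal. *)
have E : perm_mx (perm inj) = block_mx (perm_mx t) 0 0 1%:M :> 'M[int]_(p + q).
  apply/matrixP => k k'; rewrite !mxE permE.
  case: (split_ordP k) => i ->; rewrite ?fl ?fr mxE; case: (split_ordP k') => i' ->;
    by rewrite !mxE ?eq_lrshift ?eq_rlshift ?(inj_eq (@rshift_inj _ _)) ?(inj_eq (@lshift_inj _ _)).
have := congr1 determinant E; rewrite det_perm det_lblock det_perm det1 mulr1.
by case: (odd_perm (perm inj)); case: (odd_perm t).
Qed.

Section Hodge.
Context {R : realType} {V : vectType R} (h : V -> V -> R).
Hypothesis hbil : symmetric_bilinear h.
Context {p q : nat}.

Lemma wedge_basis (b : (p + q).-tuple V) (a : kform V p) (c : kform V q) :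
  wedge a c b = (p`! * q`!)%:R^-1 * \sum_(s : 'S_(p + q)) (-1) ^+ s *
    (a [tuple tnth b (s (lshift q i)) | i < p] *
     c [tuple tnth b (s (rshift p j)) | j < q]).
Proof. by rewrite /wedge; congr (_ * _); apply: eq_bigr => s _; rewrite mulrA. Qed.

Let fact0 k : k`!%:R != 0 :> R.
Proof. by rewrite pnatr_eq0 -lt0n fact_gt0. Qed.

(* Obtained by testing the definition on the dual basis p-form e^1 /\ .. /\ e^p. *)
Lemma hodge_component (eps : 'I_(p + q) -> R) (b : (p + q).-tuple V)
    (T : kform V p) (c : kform V q) (nu : kform V (p + q)) :
  orthonormal_basis h eps b -> alternating T -> alternating c ->
  (forall a, alternating a -> wedge a c = form_metric h a T *: nu) ->
  c [tuple tnth b (rshift p j) | j < q] =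
  (\prod_(i < p) eps (lshift q i)) * T [tuple tnth b (lshift q i) | i < p] * nu b.
Proof.
move=> ob altT altc H; have [hb _ _] := ob.
pose G : kform V p := fun v => \prod_i coord b (lshift q i) (tnth v i).
pose a : kform V p := fun v =>
  \sum_(t : 'S_p) (-1) ^+ t * G [tuple tnth v (t i) | i < p].
have alta : alternating a.
  apply: alternating_altsum => v i x y z.
  rewrite /G !(bigD1 i (P := xpredT)) //= !tnth_set eqxx linearP /= mulrDl mulrA.
  by congr (_ * _ * _ + _ * _); apply: eq_bigr => j /negPf ji; rewrite !tnth_set ji.
have Gb (I : 'I_p -> 'I_(p + q)) :
    G [tuple tnth b (I i) | i < p] = \prod_i (lshift q i == I i)%:R.
  apply: eq_bigr => i _; rewrite tnth_mktuple (tnth_nth 0) coord_free ?(basis_free hb) //.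
  by rewrite eq_sym.
have Gt (I : 'I_p -> 'I_(p + q)) (t : 'S_p) :
    G [tuple tnth [tuple tnth b (I i) | i < p] (t i) | i < p] =
    \prod_i (lshift q i == I (t i))%:R.
  by rewrite -Gb; congr G; apply: eq_from_tnth => i; rewrite !tnth_mktuple.
have metricE : form_metric h a T =
    (\prod_(i < p) eps (lshift q i)) * T [tuple tnth b (lshift q i) | i < p].
  rewrite (form_metricE hbil ob) //; last by case: altT.
  apply: (canLR (mulKf (fact0 p))).
  under eq_bigr => I _ do rewrite big_distrl big_distrr /=.
  rewrite exchange_big /= -(card_Sn p) mulr_natl -sumr_const.
  apply: eq_bigr => t _.
  rewrite (reindex (fun I : {ffun 'I_p -> 'I_(p + q)} => [ffun r => I (t^-1%g r)])) /=; last first.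
    exists (fun I : {ffun 'I_p -> 'I_(p + q)} => [ffun r => I (t r)]) => I _.
      by apply/ffunP => r; rewrite !ffunE permK.
    by apply/ffunP => r; rewrite !ffunE permKV.
  rewrite (bigD1 [ffun i => lshift q i]) //= [X in _ + X]big1 ?addr0.
    have -> : [tuple tnth b ([ffun r => [ffun i => lshift q i] (t^-1%g r)] r) | r < p] =
        [tuple tnth [tuple tnth b (lshift q i) | i < p] (t^-1%g r) | r < p].
      by apply: eq_from_tnth => r; rewrite !tnth_mktuple !ffunE.
    rewrite (alternating_perm _ _ altT) odd_permV.
    have -> : G [tuple tnth [tuple tnth [tuple tnth b (lshift q i) | i < p] (t^-1%g r) | r < p] (t i)  | i < p] = 1.
      rewrite [X in G X](_ : _ = [tuple tnth b (lshift q i) | i < p]) ?Gb ?big1 //.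
        by move=> i _; rewrite eqxx.
      by apply: eq_from_tnth => r; rewrite !tnth_mktuple permK.
    rewrite mulr1 mulrA [_ * (-1) ^+ t]mulrC mulrACA -signr_addb addbb mul1r.
    congr (_ * _); rewrite [RHS](reindex_inj (@perm_inj _ (t^-1%g))).
    by apply: eq_bigr => r _; rewrite !ffunE.
  move=> I nI; rewrite (Gt (fun r => [ffun r => I (t^-1%g r)] r)).
  have [i ni] : exists i, lshift q i != I i.
    apply/existsP; apply: contraNT nI; rewrite negb_exists => /forallP E.
    by apply/eqP/ffunP => i; rewrite ffunE; have /negPn/eqP := E i.
  by rewrite [X in _ * (_ * X * _)](bigD1 i) //= ffunE permK (negPf ni) mul0r mulr0 mul0r mulr0.
have E : wedge a c b = form_metric h a T * nu b by rewrite (H a alta).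
rewrite -metricE -E.
rewrite wedge_basis natrM; apply: (canRL (mulKf _)); rewrite ?mulf_neq0 //.
under [RHS]eq_bigr => s _ do rewrite big_distrl big_distrr /=.
rewrite [RHS]exchange_big /= -(card_Sn p) -mulrA mulr_natl -sumr_const.
apply: eq_bigr => t _.
(* Extending [t] by the identity on the last q indices and reindexing by its inverse turns the
   summand of [t] into that of the identity, so the p! summands agree. *)
have [t' [tl tr ot]] := exists_block_perm q t.
rewrite [RHS](reindex_inj (mulgI t'^-1%g)) /=.
pose F (f : 'I_q -> 'I_(p + q)) := c [tuple tnth b (f j) | j < q].
transitivity (\sum_(s : 'S_(p + q)) (-1) ^+ s *
    ((\prod_(i < p) (lshift q i == s (lshift q i))%:R) * F (fun j => s (rshift p j)))).
  rewrite sum_perm_fix -(card_Sn q) mulr_natl -sumr_const; apply: eq_bigr => u _.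
  rewrite /F -[X in _ * c X](_ : [tuple tnth [tuple tnth b (rshift p j) | j < q] (u j) | j < q] = _).
    by rewrite (alternating_perm _ _ altc) mulrA -signr_addb addbb mul1r.
  by apply: eq_from_tnth => r; rewrite !tnth_mktuple.
apply: eq_bigr => s _; rewrite (Gt (fun r => (t'^-1 * s)%g (lshift q r))) /F.
rewrite odd_permM odd_permV ot signr_addb.
have -> : \prod_i (lshift q i == (t'^-1 * s)%g (lshift q (t i)))%:R =
    \prod_(i < p) (lshift q i == s (lshift q i))%:R :> R.
  by apply: eq_bigr => i _; rewrite permM -tl permK.
have -> : [tuple tnth b ((t'^-1 * s)%g (rshift p j)) | j < q] =
    [tuple tnth b (s (rshift p j)) | j < q].
  by apply: eq_from_tnth => r; rewrite !tnth_mktuple permM -{1}tr permK.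
rewrite -!mulrA [RHS]mulrCA; congr (_ * _).
by rewrite !mulrA -signr_addb addbb mul1r.
Qed.

(** Trades the quantification over all test forms for one scalar equation per permutation. In one
    direction the permuted basis is again orthonormal, so [hodge_component] applies to it; in the
    other, both sides are top forms and are compared on [b]. *)
Lemma hodge_criterion (eps : 'I_(p + q) -> R) (b : (p + q).-tuple V)
    (T : kform V p) (c : kform V q) (nu : kform V (p + q)) :
  orthonormal_basis h eps b -> alternating T -> alternating c -> alternating nu ->
  (forall a, alternating a -> wedge a c = form_metric h a T *: nu) <->
  (forall s : 'S_(p + q), c [tuple tnth b (s (rshift p j)) | j < q] =
    (\prod_(i < p) eps (s (lshift q i))) * T [tuple tnth b (s (lshift q i)) | i < p] *
      ((-1) ^+ s * nu b)).
Proof.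
move=> ob altT altc altn; have [hb he hbb] := ob; split=> [H s|H a alta].
  pose b' := [tuple tnth b (s i) | i < p + q].
  have ob' : orthonormal_basis h (fun i => eps (s i)) b'.
    split=> [|i|i j] //; last by rewrite !tnth_mktuple hbb (inj_eq perm_inj).
    by rewrite -(perm_basis (X := b)) // perm_sym; apply/tuple_permP; exists s.
  have := hodge_component ob' altT altc H.
  rewrite /b' (alternating_perm _ _ altn) => E.
  have Eq k (f : 'I_k -> 'I_(p + q)) :
      [tuple tnth b' (f i) | i < k] = [tuple tnth b (s (f i)) | i < k].
    by apply: eq_from_tnth => i; rewrite !tnth_mktuple.
  by move: E; rewrite -/b' !Eq.
have la : multilinear a by case: alta.
have [lT lc] : multilinear T /\ multilinear c by case: altT; case: altc.
apply: (alternating_top_ext hb) => //; first exact: wedge_alternating.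
  exact: alternatingZ.
change (wedge a c b = form_metric h a T * nu b).
rewrite wedge_basis (form_metricE hbil ob) //.
transitivity ((p`! * q`!)%:R^-1 * \sum_(s : 'S_(p + q)) (nu b *
  ((\prod_(i < p) eps (s (lshift q i))) * (a [tuple tnth b (s (lshift q i)) | i < p] *
    T [tuple tnth b (s (lshift q i)) | i < p])))).
  congr (_ * _); apply: eq_bigr => s _; rewrite H.
  have := signr_addb R (odd_perm s) (odd_perm s); rewrite addbb => /esym.
  move: ((-1) ^+ s) (\prod_i _) => e P ee.
  transitivity ((e * e) * (nu b * (P * (a [tuple tnth b (s (lshift q i)) | i < p] *
    T [tuple tnth b (s (lshift q i)) | i < p])))); first by ring.
  by rewrite ee mul1r.
rewrite -big_distrr /=.
rewrite (sum_perm_lshift (fun I : 'I_p -> 'I_(p + q) => (\prod_(i < p) eps (I i)) * (a [tuple tnth b (I i) | i < p] *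
    T [tuple tnth b (I i) | i < p]))).
rewrite natrM; set S1 := \sum_(I | _) _; set S2 := \sum_I _.
have -> : S2 = S1.
  rewrite /S1 big_mkcond; apply: eq_bigr => I _; case: ifP => // /negbT nI.
  by rewrite (alternating_noninj (tnth b) alta nI) mul0r mulr0.
move: (fact0 p) (fact0 q) => p0 q0; by field; rewrite p0 q0.
Qed.
End Hodge.

(** * Components of forms in dimension seven *)

Lemma enum_ord0 : enum 'I_0 = [::].
Proof. by apply/size0nil; rewrite size_enum_ord. Qed.

Lemma enum_ord3 : enum 'I_3 = [:: ord0; lift ord0 ord0; lift ord0 (lift ord0 ord0)].
Proof. by rewrite !enum_ordSl enum_ord0. Qed.

Definition sign4 (A : pzRingType) (i : nat) : A := (-1) ^+ (4 <= i)%N.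

Definition triangle_component (A : pzRingType) (p : nat -> nat -> nat -> A) (i j k l : nat) : A :=
  2 * foldr (fun m acc => sign4 A m *
    (p m i j * p m k l - p m i k * p m j l + p m i l * p m j k) + acc) 0 (iota 0 7).

Section Seven.
Context {R : realType} {V : vectType R} (h : V -> V -> R).
Hypothesis hbil : symmetric_bilinear h.
Context {b : 7.-tuple V}.
Hypothesis ob : orthonormal_basis h (fun i : 'I_7 => sign4 R i) b.

Definition component (a : kform V 3) (i j k : nat) : R := eval_seq a [:: b`_i; b`_j; b`_k].

Lemma eval_sum k (I : Type) (r : seq I) (F : I -> kform V k) l :
  eval_seq (\sum_(i <- r) F i) l = \sum_(i <- r) eval_seq (F i) l.
Proof.
elim: r => [|i r IH]; first by rewrite !big_nil.
by rewrite !big_cons -IH.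
Qed.

Lemma triangle1_alternating (a : kform V 3) : alternating a ->
  alternating (triangle1 h a a).
Proof.
move=> [la _]; apply: alternating_sum => i; apply: alternating_sum => j.
by apply: alternatingZ; apply: wedge_alternating; apply: interior_multilinear.
Qed.

Lemma interior_alternating k x (a : kform V k.+1) :
  alternating a -> alternating (interior x a).
Proof.
case=> la alt; split; first exact: interior_multilinear.
move=> v i j nij E; apply: (alt _ (lift ord0 i) (lift ord0 j)).
  by rewrite (inj_eq lift_inj).
by rewrite !tnthS.
Qed.

(** When both interior products are taken with the same basis vector, the six terms of
    [eval_wedge22] agree in pairs; hence the factor 2. *)
Lemma eval_triangle1 (a : kform V 3) w0 w1 w2 w3 : alternating a ->
  eval_seq (triangle1 h a a) [:: w0; w1; w2; w3] =
  2 * \sum_(m < 7) sign4 R m *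
    (eval_seq a [:: b`_m; w0; w1] * eval_seq a [:: b`_m; w2; w3]
     - eval_seq a [:: b`_m; w0; w2] * eval_seq a [:: b`_m; w1; w3]
     + eval_seq a [:: b`_m; w0; w3] * eval_seq a [:: b`_m; w1; w2]).
Proof.
move=> alta; have la : multilinear a by case: alta.
rewrite eval_sum; under eq_bigr => i _ do rewrite eval_sum.
have E x y : eval_seq (wedge (interior x a) (interior y a)) [:: w0; w1; w2; w3] =
    eval_seq a [:: x; w0; w1] * eval_seq a [:: y; w2; w3]
  - eval_seq a [:: x; w0; w2] * eval_seq a [:: y; w1; w3]
  + eval_seq a [:: x; w0; w3] * eval_seq a [:: y; w1; w2]
  + eval_seq a [:: x; w1; w2] * eval_seq a [:: y; w0; w3]
  - eval_seq a [:: x; w1; w3] * eval_seq a [:: y; w0; w2]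
  + eval_seq a [:: x; w2; w3] * eval_seq a [:: y; w0; w1].
  by rewrite eval_wedge22 ?eval_interior //; apply: interior_alternating.
have L c x y u v : eval_seq a [:: c *: x + y; u; v] =
    c * eval_seq a [:: x; u; v] + eval_seq a [:: y; u; v] by exact: (@eval_linear _ _ _ a [::]).
transitivity (\sum_(m < 7) sign4 R m *
    eval_seq (wedge (interior (tnth b m) a) (interior (tnth b m) a)) [:: w0; w1; w2; w3]).
  rewrite -(cometric_contraction hbil ob (F := fun x y =>
      eval_seq (wedge (interior x a) (interior y a)) [:: w0; w1; w2; w3])) //.
    by move=> c x y z; rewrite !E !L; ring.
  by move=> c x y z; rewrite !E !L; ring.
rewrite big_distrr; apply: eq_bigr => m _.
by rewrite E -tnth_nth /=; ring.
Qed.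

Lemma triangle1_component (a : kform V 3) i j k l : alternating a ->
  eval_seq (triangle1 h a a) [:: b`_i; b`_j; b`_k; b`_l] = triangle_component (component a) i j k l.
Proof.
move=> alta; rewrite eval_triangle1 // /triangle_component.
by rewrite (foldr_sum 7 (fun m => sign4 R m * _)).
Qed.

Lemma eval_nth k (a : kform V k) (f : 'I_k -> 'I_7) :
  a [tuple tnth b (f r) | r < k] = eval_seq a [seq b`_(f r) | r <- enum 'I_k].
Proof.
rewrite -eval_tuple; congr eval_seq => /=.
by apply: eq_map => r; rewrite -tnth_nth.
Qed.

(* The permutation of {0, .., 6} coded by (i0, i1, i2, i3) takes successively the
   i0-th, i1-th, i2-th and i3-th of the remaining elements, then the other three
   in increasing order. *)
Lemma hodge_component_criterion (T : kform V 4) (c : kform V 3) (nu : kform V (4 + 3)) :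
  alternating T -> alternating c -> alternating nu ->
  (forall a, alternating a -> wedge a c = form_metric h a T *: nu) <->
  (forall (i0 : 'I_7) (i1 : 'I_6) (i2 : 'I_5) (i3 : 'I_4),
    let f0 := bump i0 in let f1 j := f0 (bump i1 j) in
    let f2 j := f1 (bump i2 j) in let f3 j := f2 (bump i3 j) in
    component c (f3 0) (f3 1) (f3 2) =
    sign4 R i0 * sign4 R (f0 i1) * sign4 R (f1 i2) * sign4 R (f2 i3) *
    eval_seq T [:: b`_i0; b`_(f0 i1); b`_(f1 i2); b`_(f2 i3)] *
    ((-1) ^+ (i0 + i1 + i2 + i3) * nu b)).
Proof.
move=> altT altc altn.
pose s (i0 : 'I_7) (i1 : 'I_6) (i2 : 'I_5) (i3 : 'I_4) (t : 'S_3) : 'S_(4 + 3) :=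
  lift_perm ord0 i0 (lift_perm ord0 i1 (lift_perm ord0 i2 (lift_perm ord0 i3 t))).
have l0 : lshift 3 (ord0 : 'I_4) = (ord0 : 'I_7) by exact: val_inj.
have l1 : lshift 3 (lift ord0 ord0 : 'I_4) = lift ord0 (ord0 : 'I_6) by exact: val_inj.
have l2 : lshift 3 (lift ord0 (lift ord0 ord0) : 'I_4) =
    lift ord0 (lift ord0 (ord0 : 'I_5)) by exact: val_inj.
have l3 : lshift 3 (lift ord0 (lift ord0 (lift ord0 ord0)) : 'I_4) =
    lift ord0 (lift ord0 (lift ord0 (ord0 : 'I_4))) by exact: val_inj.
have r0 (j : 'I_3) : rshift 4 j =
    lift ord0 (lift ord0 (lift ord0 (lift ord0 j))) :> 'I_7 by exact: val_inj.
have sl i0 i1 i2 i3 t : [seq nat_of_ord (s i0 i1 i2 i3 t (lshift 3 i)) | i <- enum 'I_4] =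
    [:: nat_of_ord i0; bump i0 i1; bump i0 (bump i1 i2); bump i0 (bump i1 (bump i2 i3))].
  rewrite !enum_ordSl enum_ord0 /= /s; congr [:: _; _; _; _].
  - by rewrite l0 lift_perm_id.
  - by rewrite l1 lift_perm_lift lift_perm_id.
  - by rewrite l2 !lift_perm_lift lift_perm_id.
  - by rewrite l3 !lift_perm_lift lift_perm_id.
have sr i0 i1 i2 i3 t j : nat_of_ord (s i0 i1 i2 i3 t (rshift 4 j)) =
    bump i0 (bump i1 (bump i2 (bump i3 (t j)))).
  by rewrite /s r0 !lift_perm_lift.
have part i0 i1 i2 i3 t :
  (c [tuple tnth b (s i0 i1 i2 i3 t (rshift 4 j)) | j < 3] =
    (\prod_(i < 4) sign4 R (s i0 i1 i2 i3 t (lshift 3 i))) *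
      T [tuple tnth b (s i0 i1 i2 i3 t (lshift 3 i)) | i < 4] *
      ((-1) ^+ s i0 i1 i2 i3 t * nu b)) <->
  (let f0 := bump i0 in let f1 j := f0 (bump i1 j) in
    let f2 j := f1 (bump i2 j) in let f3 j := f2 (bump i3 j) in
    component c (f3 0) (f3 1) (f3 2) =
    sign4 R i0 * sign4 R (f0 i1) * sign4 R (f1 i2) * sign4 R (f2 i3) *
    eval_seq T [:: b`_i0; b`_(f0 i1); b`_(f1 i2); b`_(f2 i3)] *
    ((-1) ^+ (i0 + i1 + i2 + i3) * nu b)).
  (* Permuting the last three positions by [t] multiplies both sides by the sign of [t], so the
     increasing order is enough. *)
  have -> : c [tuple tnth b (s i0 i1 i2 i3 t (rshift 4 j)) | j < 3] =
      (-1) ^+ t * c [tuple tnth b (s i0 i1 i2 i3 1%g (rshift 4 j)) | j < 3].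
    rewrite -alternating_perm //; congr c; apply: eq_from_tnth => j.
    rewrite !tnth_mktuple; congr tnth; apply: val_inj => /=.
    by rewrite !sr perm1.
  rewrite !eval_nth.
  rewrite (map_comp (fun i => b`_i) (fun i => nat_of_ord (s i0 i1 i2 i3 t (lshift 3 i)))) sl.
  have -> : \prod_(i < 4) sign4 R (s i0 i1 i2 i3 t (lshift 3 i)) =
      sign4 R i0 * sign4 R (bump i0 i1) * sign4 R (bump i0 (bump i1 i2)) *
      sign4 R (bump i0 (bump i1 (bump i2 i3))).
    have := sl i0 i1 i2 i3 t; rewrite !enum_ordSl enum_ord0 => -[spinor1 e1 e2 enum_ord3].
    by rewrite !big_ord_recl big_ord0 spinor1 e1 e2 enum_ord3 mulr1 !mulrA.
  have -> : [seq b`_(s i0 i1 i2 i3 1%g (rshift 4 r)) | r <- enum 'I_3] =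
      [:: b`_(bump i0 (bump i1 (bump i2 (bump i3 0))));
          b`_(bump i0 (bump i1 (bump i2 (bump i3 1))));
          b`_(bump i0 (bump i1 (bump i2 (bump i3 2))))].
    by rewrite enum_ord3 /= !sr !perm1.
  have -> : (-1) ^+ s i0 i1 i2 i3 t = (-1) ^+ t * (-1) ^+ (i0 + i1 + i2 + i3) :> R.
    rewrite -(signr_odd _ (i0 + i1 + i2 + i3)) /s !odd_lift_perm /= !oddD -signr_addb; congr (_ ^+ nat_of_bool _).
    by case: (odd i0); case: (odd i1); case: (odd i2); case: (odd i3); case: (odd_perm t).
  rewrite /component /=; move: (eval_seq c _) (eval_seq T _) (nu b) (_ ^+ (_ + _)) => x y z w.
  have := signr_addb R (odd_perm t) (odd_perm t); rewrite addbb expr0 => /esym.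
  move: (_ ^+ t) => e ee; move: (_ * sign4 R _) => P.
  split=> [E|->]; last by ring.
  rewrite -[LHS]mul1r -ee -[LHS]mulrA E; transitivity ((e * e) * (P * y * (w * z))); first by ring.
  by rewrite ee mul1r.
have hc := hodge_criterion (p := 4) (q := 3) (nu := nu) hbil ob altT altc altn.
split=> [H i0 i1 i2 i3|H].
  by apply/(part i0 i1 i2 i3 1%g); exact: (hc.1 H _).
apply/hc => u.
have [i0 [u0 ->]] := lift_permP u; have [i1 [u1 ->]] := lift_permP u0.
have [i2 [u2 ->]] := lift_permP u1; have [i3 [u3 ->]] := lift_permP u2.
by apply/(part i0 i1 i2 i3 u3).
Qed.
End Seven.

(** * The form phi0 *)

(** Evaluated once, so that later computations look coefficients up instead of expanding
    determinants. *)
Definition phi0_table : seq (seq (seq int)) := Eval vm_compute in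
  mkseq (fun i => mkseq (fun j => mkseq (fun k =>
    phi0_poly (fun a x : nat => (a == x)%:Z) i j k) 7) 7) 7.

Definition phi0c (i j k : nat) : int := nth 0 (nth [::] (nth [::] phi0_table i) j) k.

Lemma phi0cE i j k : (i < 7)%N -> (j < 7)%N -> (k < 7)%N ->
  phi0_poly (fun a x : nat => (a == x)%:Z) i j k = phi0c i j k.
Proof.
move=> i7 j7 k7; rewrite /phi0c.
rewrite (_ : phi0_table = mkseq (fun i => mkseq (fun j => mkseq (fun k =>
    phi0_poly (fun a x : nat => (a == x)%:Z) i j k) 7) 7) 7); last by vm_compute.
by rewrite !nth_mkseq.
Qed.

(** In the coding of [hodge_component_criterion]: on an orthonormal basis of volume 1, the star of
    the triangle square of phi0 is -6 phi0. *)
Lemma phi0c_hodge : all (fun i0 => all (fun i1 => all (fun i2 => all (fun i3 =>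
    let f0 := bump i0 in let f1 j := f0 (bump i1 j) in
    let f2 j := f1 (bump i2 j) in let f3 j := f2 (bump i3 j) in
    - 6%:Z * phi0c (f3 0%N) (f3 1%N) (f3 2%N) ==
    sign4 int i0 * sign4 int (f0 i1) * sign4 int (f1 i2) * sign4 int (f2 i3) *
    triangle_component phi0c i0 (f0 i1) (f1 i2) (f2 i3) *
    (-1) ^+ (i0 + i1 + i2 + i3)%N)
  (iota 0 4)) (iota 0 5)) (iota 0 6)) (iota 0 7).
Proof. by vm_compute. Qed.

Lemma all_iotaP n (P : pred nat) : all P (iota 0 n) -> forall i : 'I_n, P i.
Proof. by move=> /allP H i; apply: H; rewrite mem_iota leq0n add0n ltn_ord. Qed.

Section Phi0.
Context {R : realType} {V : vectType R}.
Implicit Types (a : kform V 3) (b : 7.-tuple V).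

Lemma sign4_sq i : sign4 R i * sign4 R i = 1.
Proof. by rewrite /sign4; case: (4 <= i)%N; rewrite ?expr0 ?expr1 ?mulrNN mulr1. Qed.

Lemma sign4_intr i : (sign4 int i)%:~R = sign4 R i.
Proof. by rewrite /sign4 rmorphXn rmorphN1. Qed.

Lemma component_swap12 a b i j k : alternating a -> component (b := b) a j i k = - component (b := b) a i j k.
Proof. by move=> alta; exact: (@eval_swap R V 3 a [::] [:: b`_k] _ _ alta isT). Qed.

Lemma component_swap23 a b i j k : alternating a -> component (b := b) a i k j = - component (b := b) a i j k.
Proof. by move=> alta; exact: (@eval_swap R V 3 a [:: b`_i] [::] _ _ alta isT). Qed.

Lemma component_diag12 a b i k : alternating a -> component (b := b) a i i k = 0.
Proof. by move=> alta; exact: (@eval_diag R V 3 a [::] [:: b`_k] _ alta isT). Qed.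

Lemma component_diag23 a b i k : alternating a -> component (b := b) a i k k = 0.
Proof. by move=> alta; exact: (@eval_diag R V 3 a [:: b`_i] [::] _ alta isT). Qed.

Lemma alternating_ext3 a a' b : basis_of fullv b -> alternating a -> alternating a' ->
  (forall i j k, (i < j)%N -> (j < k)%N -> (k < 7)%N ->
    component (b := b) a i j k = component (b := b) a' i j k) -> a = a'.
Proof.
move=> hb alta alta' E; apply: (alternating_ext hb) => // I _.
rewrite !eval_nth enum_ord3 /=.
have {}E i j k : (i < 7)%N -> (j < 7)%N -> (k < 7)%N ->
    component (b := b) a i j k = component (b := b) a' i j k.
  move=> i7 j7 k7.
  case: (ltngtP i j) => [ij|ji|->]; last by rewrite !component_diag12.
    case: (ltngtP j k) => [jk|kj|->]; [exact: E| |by rewrite !component_diag23].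
    rewrite component_swap23 // [RHS]component_swap23 //; congr (- _).
    case: (ltngtP i k) => [ik|ki|->]; [exact: E| |by rewrite !component_diag12].
    by rewrite component_swap12 // [RHS]component_swap12 // E.
  rewrite component_swap12 // [RHS]component_swap12 //; congr (- _).
  case: (ltngtP i k) => [ik|ki|->]; [exact: E| |by rewrite !component_diag23].
  rewrite component_swap23 // [RHS]component_swap23 //; congr (- _).
  case: (ltngtP j k) => [jk|kj|->]; [exact: E| |by rewrite !component_diag12].
  by rewrite component_swap12 // [RHS]component_swap12 // E.
exact: E.
Qed.

Lemma component_phi0 (f : 7.-tuple 'Hom(V, R^o)) b i j k : dual_basis f b ->
  (i < 7)%N -> (j < 7)%N -> (k < 7)%N ->
  component (b := b) (phi0 f) i j k = (phi0c i j k)%:~R.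
Proof.
move=> fb i7 j7 k7; rewrite /component eval_phi0 -phi0cE //.
have F (m x : nat) : (m < 7)%N -> (x < 7)%N -> f`_m b`_x = ((m == x)%:Z)%:~R.
  move=> m7 x7; have := fb (Ordinal m7) (Ordinal x7).
  by rewrite !(tnth_nth 0) /= => ->.
by rewrite /phi0_poly /det3 !F //= !(rmorphD, rmorphB, rmorphN, rmorphM).
Qed.

Lemma componentZ a b c i j k : component (b := b) (c *: a) i j k = c * component (b := b) a i j k.
Proof. by []. Qed.

Section Metric.
Context {h : V -> V -> R} (hbil : symmetric_bilinear h).
Context {b : 7.-tuple V}.
Hypothesis ob : orthonormal_basis h (fun i : 'I_7 => sign4 R i) b.

Lemma volume_form_alternating n (o : n.-tuple V) : alternating (volume_form h o).
Proof. exact: (alternatingZ (Num.sqrt `|\det (gram h o)|) (det_alternating o)). Qed.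

(** Three negative directions give [b] the Gram determinant -1, and a change of basis multiplies
    Gram determinants by a square. Hence the volume form takes the value 1 or -1 on [b], depending
    on the orientation only. *)
Lemma volume_form_sq (o : 7.-tuple V) : basis_of fullv o ->
  volume_form h o b * volume_form h o b = 1.
Proof.
move=> ho; rewrite /volume_form.
set A := \matrix_(i, j) _.
have E : gram h b = A^T *m gram h o *m A.
  apply/matrixP => i j; rewrite !mxE.
  rewrite {1}(basis_expand (tnth b i) ho) {1}(basis_expand (tnth b j) ho).
  rewrite (bilin_suml hbil).
  under eq_bigr => k _ do rewrite (bilin_sumr hbil) big_distrr /=.
  rewrite exchange_big; apply: eq_bigr => l _; rewrite !mxE big_distrl.
  by apply: eq_bigr => k _; rewrite !mxE /=; ring.
have D : \det (gram h b) = -1.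
  have -> : gram h b = diag_mx (\row_i sign4 R i).
    apply/matrixP => i j; rewrite !mxE; case: ob => _ _ ->; by case: eqP.
  by rewrite det_diag !big_ord_recl big_ord0 !mxE /sign4 /=; ring.
have := congr1 determinant E; rewrite D !det_mulmx det_tr => H.
have H2 : `|\det (gram h o)| * (\det A * \det A) = 1.
  have -> : \det A * \det A = `|\det A * \det A| by rewrite ger0_norm // -expr2 sqr_ge0.
  rewrite -normrM -[RHS](normrN1 R) H; congr `|_|; ring.
by rewrite mulrACA -expr2 sqr_sqrtr // normr_ge0.
Qed.

Lemma form_metric3 a : alternating a ->
  form_metric h a a = 6^-1 * \sum_(i < 7) \sum_(j < 7) \sum_(k < 7)
    sign4 R i * sign4 R j * sign4 R k * component (b := b) a i j k ^+ 2.
Proof.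
move=> alta; rewrite (form_metricE hbil ob) //; last by case: alta.
rewrite (_ : 3`! = 6) //; congr (_ * _).
rewrite big_ffun_recl; apply: eq_bigr => i _; rewrite big_ffun_recl.
apply: eq_bigr => j _; rewrite big_ffun_recl; apply: eq_bigr => k _.
rewrite (big_ffun0 _ (ffun0 (card_ord 0))) -expr2 eval_nth.
rewrite enum_ord3 /= !big_ord_recl big_ord0 mulr1 mulrA.
by rewrite !(ffunE, liftK, unlift_none) /= !(ffunE, liftK, unlift_none) /= !(ffunE, liftK, unlift_none).
Qed.

Lemma form_metric_phi0 (f : 7.-tuple 'Hom(V, R^o)) x : dual_basis f b ->
  form_metric h (x *: phi0 f) (x *: phi0 f) = - 7 * x ^+ 2.
Proof.
move=> fb; rewrite form_metric3; last exact/alternatingZ/phi0_alternating.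
under eq_bigr => i _ do under eq_bigr => j _ do under eq_bigr => k _ do
  rewrite componentZ (component_phi0 fb) // exprMn mulrCA.
rewrite -[LHS]/(_ * (\sum_i _)).
under eq_bigr => i _ do (under eq_bigr => j _ do rewrite -big_distrr /=; rewrite -big_distrr /=).
rewrite -big_distrr /= mulrCA mulrC; congr (_ * _).
(* Each of the seven monomials has norm -1 and is met in six orders: -42 = 6 (-7). *)
transitivity (6^-1 * (- 42) : R); last by field.
congr (_ * _).
pose F i j k := sign4 int i * sign4 int j * sign4 int k * phi0c i j k ^+ 2.
transitivity ((\sum_(i < 7) \sum_(j < 7) \sum_(k < 7) F i j k)%:~R : R).
  rewrite rmorph_sum; apply: eq_bigr => i _; rewrite rmorph_sum; apply: eq_bigr => j _.
  rewrite rmorph_sum; apply: eq_bigr => k _.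
  by rewrite -!sign4_intr -rmorphXn -!rmorphM.
rewrite -(foldr_sum3 7 F).
by rewrite (_ : foldr _ _ _ = - 42%:Z) ?rmorphN //; vm_compute.
Qed.

(** Phrased by the defining condition of the star, so that it also supplies the existence of a star
    for these forms. The factor [nu b] keeps track of the orientation. *)
Lemma hodge_phi0 (f : 7.-tuple 'Hom(V, R^o)) (nu : kform V 7) x : dual_basis f b ->
  alternating nu ->
  forall a : kform V 4, alternating a ->
    wedge a (- 6 * x ^+ 2 * nu b *: phi0 f) =
    form_metric h a (triangle1 h (x *: phi0 f) (x *: phi0 f)) *: nu.
Proof.
move=> fb altn.
have alt0 := phi0_alternating f.
have altx : alternating (x *: phi0 f) by exact: alternatingZ.
apply: (hodge_component_criterion hbil ob (triangle1_alternating h altx) (alternatingZ _ alt0) altn).2.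
move=> i0 i1 i2 i3 f0 f1 f2 f3.
have l0 j : (j < 6)%N -> (f0 j < 7)%N by move=> j6; exact: (ltn_ord (lift i0 (Ordinal j6))).
have l1 j : (j < 5)%N -> (f1 j < 7)%N.
  by move=> j6; apply: l0; exact: (ltn_ord (lift i1 (Ordinal j6))).
have l2 j : (j < 4)%N -> (f2 j < 7)%N.
  by move=> j6; apply: l1; exact: (ltn_ord (lift i2 (Ordinal j6))).
have l3 j : (j < 3)%N -> (f3 j < 7)%N.
  by move=> j6; apply: l2; exact: (ltn_ord (lift i3 (Ordinal j6))).
rewrite componentZ (component_phi0 fb) ?l3 // (triangle1_component hbil ob) //.
have -> : triangle_component (component (b := b) (x *: phi0 f)) i0 (f0 i1) (f1 i2) (f2 i3) =
    x ^+ 2 * (triangle_component phi0c i0 (f0 i1) (f1 i2) (f2 i3))%:~R.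
  have C m j k : (m < 7)%N -> (j < 7)%N -> (k < 7)%N ->
      component (b := b) (x *: phi0 f) m j k = x * (phi0c m j k)%:~R.
    by move=> *; rewrite componentZ (component_phi0 fb).
  rewrite /triangle_component (foldr_sum 7 (fun m => sign4 R m * _)) (foldr_sum 7 (fun m => sign4 int m * _)).
  rewrite rmorphM rmorph_sum /= mulrCA; congr (_ * _).
  rewrite big_distrr; apply: eq_bigr => m _ /=.
  rewrite !C ?l2 ?l1 ?l0 ?ltn_ord // rmorphM rmorphD rmorphB !rmorphM /=.
  by rewrite sign4_intr; ring.
have E : - 6%:Z * phi0c (f3 0%N) (f3 1%N) (f3 2%N) =
    sign4 int i0 * sign4 int (f0 i1) * sign4 int (f1 i2) * sign4 int (f2 i3) *
    triangle_component phi0c i0 (f0 i1) (f1 i2) (f2 i3) * (-1) ^+ (i0 + i1 + i2 + i3)%N.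
  apply/eqP.
  exact: (all_iotaP (all_iotaP (all_iotaP (all_iotaP phi0c_hodge i0) i1) i2) i3).
have S : ((-1) ^+ (i0 + i1 + i2 + i3))%:~R = (-1) ^+ (i0 + i1 + i2 + i3) :> R.
  by rewrite rmorphXn rmorphN1.
move: (sign4_intr i0) (sign4_intr (f0 i1)) (sign4_intr (f1 i2)) (sign4_intr (f2 i3)).
move: (sign4 int i0) (sign4 int (f0 i1)) (sign4 int (f1 i2)) (sign4 int (f2 i3)) E.
rewrite -S; move: (triangle_component phi0c _ _ _ _) ((-1) ^+ _) => t w s0 s1 s2 s3 + <- <- <- <-.
move/(congr1 (fun z : int => z%:~R : R)); rewrite !rmorphM rmorphN => E.
transitivity (x ^+ 2 * nu b * (- 6%:~R * (phi0c (f3 0%N) (f3 1%N) (f3 2%N))%:~R)).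
  by ring.
by rewrite E; ring.
Qed.

End Metric.
End Phi0.

(** * Spinors *)

(* The matrix of the left multiplication by the i-th imaginary unit of the split
   octonions; the index 0 stands for the real unit and r.+1 for the r-th
   imaginary unit. *)
Definition octonion_coef (i r s : nat) : int :=
  match r, s with
  | 0, 0 => 0
  | r'.+1, 0 => (r' == i)%:Z
  | 0, s'.+1 => sign4 int i * (s' == i)%:Z
  | r'.+1, s'.+1 => sign4 int r' * phi0c i s' r'
  end.

Definition intsum (n : nat) (F : nat -> int) : int :=
  foldr (fun i acc => F i + acc) 0 (iota 0 n).

Definition gamma_table : seq (seq (seq int)) := Eval vm_compute in
  mkseq (fun i => mkseq (fun r => mkseq (octonion_coef i r) 8) 8) 7.

Definition gamma_coef i r s : int := nth 0 (nth [::] (nth [::] gamma_table i) r) s.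

Definition gamma3_coef i j k r s : int :=
  intsum 8 (fun x => intsum 8 (fun y => gamma_coef i r x * gamma_coef j x y * gamma_coef k y s)).

Definition triples : seq (nat * nat * nat) := Eval vm_compute in
  [seq t <- [seq (ij, k) | ij <- [seq (i, j) | i <- iota 0 7, j <- iota 0 7], k <- iota 0 7]
   | (t.1.1 < t.1.2 < t.2)%N].

(** The matrix M is the sum over i < j < k of eps_i eps_j eps_k p(i, j, k) times the product of the
    three gamma matrices. These are signed permutation matrices, so each entry of M involves few
    triples, and only those are stored. *)
Definition spin_table : seq (seq (seq (nat * nat * nat * int))) := Eval vm_compute in
  mkseq (fun r => mkseq (fun s =>
    [seq u <- [seq (t, sign4 int t.1.1 * sign4 int t.1.2 * sign4 int t.2 *
                 gamma3_coef t.1.1 t.1.2 t.2 r s) | t <- triples] | u.2 != 0]) 8) 8.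

(** The norm of the split octonions, of signature (4,4): the i-th imaginary unit squares to
    [sign4 i], so its norm is the opposite. *)
Definition spin_sign (A : pzRingType) (r : nat) : A :=
  if r is r'.+1 then - sign4 A r' else 1.

(** Positions are transposed, so that summing [spin_entry] against this list is the trace of a
    product of matrices. *)
Definition support3 i j k : seq (nat * nat * int) :=
  [seq u <- [seq (rs, gamma3_coef i j k rs.2 rs.1) |
     rs <- [seq (r, s) | r <- iota 0 8, s <- iota 0 8]] | u.2 != 0].

Section SpinMatrix.
Context {R : realType}.
Implicit Types (p : nat -> nat -> nat -> R).

Definition spin_entry p (r s : nat) : R :=
  foldr (fun u acc => u.2%:~R * p u.1.1.1 u.1.1.2 u.1.2 + acc) 0
    (nth [::] (nth [::] spin_table r) s).

Definition spin_matrix p : 'M[R]_8 := \matrix_(r, s) spin_entry p r s.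

(* The alternating extension of the values of p at the triples i < j < k. *)
Definition alternated p (i j k : nat) : R :=
  if (i < j)%N then
    if (j < k)%N then p i j k else if j == k then 0
    else if (i < k)%N then - p i k j else if i == k then 0 else p k i j
  else if i == j then 0
  else
    if (i < k)%N then - p j i k else if i == k then 0
    else if (j < k)%N then p j k i else if j == k then 0 else - p k j i.

(** For i < j < k, the component of the star of the triangle square when the basis has volume 1. The
    complement a < b < c < d comes in front, and the sign of that shuffle is that of a + b + c + d -
    6. *)
Definition dual_triangle p (i j k : nat) : R :=
  if [seq x <- iota 0 7 | x \notin [:: i; j; k]] is [:: a; b; c; d] then
    (-1) ^+ (a + b + c + d) *
    (sign4 R a * sign4 R b * sign4 R c * sign4 R d) * triangle_component p a b c d
  else 0.

Definition triple_norm p : R :=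
  - foldr (fun t acc => sign4 R t.1.1 * sign4 R t.1.2 * sign4 R t.2 *
      p t.1.1 t.1.2 t.2 ^+ 2 + acc) 0 triples.

(** Degrees 2 and 6 are absent from the Clifford square: reversing products changes the sign of a
    three-form, hence fixes its square, but changes the sign in degrees 2 and 6. The proof checks
    the 64 entries as polynomial identities in the components at increasing triples. *)
Lemma spin_matrix_sq p : spin_matrix p *m spin_matrix p =
  (triple_norm p)%:M + spin_matrix (dual_triangle (alternated p)).
Proof.
apply/matrixP => r s; rewrite !mxE.
transitivity (foldr (fun k acc => spin_entry p r k * spin_entry p k s + acc) 0 (iota 0 8)).
  rewrite (foldr_sum 8 (fun k => spin_entry p r k * _)).
  by apply: eq_bigr => k _; rewrite !mxE.
rewrite -val_eqE; move: r s => [[|[|[|[|[|[|[|[|r]]]]]]]] hr] // [[|[|[|[|[|[|[|[|s]]]]]]]] hs] //.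
all: rewrite /spin_entry /dual_triangle /triple_norm /= /triangle_component /sign4 /alternated /= ?mulr1n ?mulr0n.
all: ring.
Qed.

(** Each gamma matrix is skew for the octonion norm. The adjoint of a product of three has the sign
    (-1)^3, which cancels the sign of reversing three anticommuting factors. *)
Lemma spin_matrix_sym p (r s : 'I_8) :
  spin_sign R r * spin_matrix p r s = spin_sign R s * spin_matrix p s r.
Proof.
rewrite !mxE; move: r s => [[|[|[|[|[|[|[|[|r]]]]]]]] hr] // [[|[|[|[|[|[|[|[|s]]]]]]]] hs] //.
all: rewrite /spin_entry /spin_sign /sign4 /=.
all: ring.
Qed.

Lemma spin_matrix_tr p : \tr (spin_matrix p) = 0.
Proof.
rewrite /mxtrace; under eq_bigr => r _ do rewrite mxE.
rewrite -(foldr_sum 8 (fun r => spin_entry p r r)) /spin_entry /=; ring.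
Qed.

(** Products of three gamma matrices are orthogonal for the trace, so M determines the three-form.
    The square of such a product is -eps_i eps_j eps_k, whence the factor -8. *)
Lemma spin_matrix_component p t : t \in triples ->
  foldr (fun u acc => spin_entry p u.1.1 u.1.2 * u.2%:~R + acc) 0
    (support3 t.1.1 t.1.2 t.2) = - 8 * p t.1.1 t.1.2 t.2.
Proof.
rewrite !inE; do ![case/orP] => /eqP ->; cbn [fst snd].
all: match goal with |- context [support3 ?i ?j ?k] =>
  let l := eval vm_compute in (support3 i j k) in change (support3 i j k) with l end.
all: rewrite /spin_entry /=; ring.
Qed.

End SpinMatrix.

Lemma gamma_coef_clifford : all (fun i => all (fun j => all (fun r => all (fun s =>
   intsum 8 (fun k => gamma_coef i r k * gamma_coef j k s) + intsum 8 (fun k => gamma_coef j r k * gamma_coef i k s) ==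
   2 * (sign4 int i * ((i == j) && (r == s))%:Z))
   (iota 0 8)) (iota 0 8)) (iota 0 7)) (iota 0 7).
Proof. by vm_compute. Qed.

Lemma gamma_coef_skew : all (fun i => all (fun r => all (fun s =>
   gamma_coef i s r * spin_sign int s == - (spin_sign int r * gamma_coef i r s))
   (iota 0 8)) (iota 0 8)) (iota 0 7).
Proof. by vm_compute. Qed.

Lemma gamma3_trace : all (fun t => intsum 8 (fun r => gamma3_coef t.1.1 t.1.2 t.2 r r) == 0) triples.
Proof. by vm_compute. Qed.

(** The entry at the real unit is the real part of e_i (e_j e_k), so the three-form of the spinor 1
    is phi0. *)
Lemma gamma3_phi0 : all (fun t => gamma3_coef t.1.1 t.1.2 t.2 0 0 == phi0c t.1.1 t.1.2 t.2) triples.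
Proof. by vm_compute. Qed.

Lemma spin_table_triples : all (fun r => all (fun s =>
  all (fun u => u.1 \in triples) (nth [::] (nth [::] spin_table r) s))
  (iota 0 8)) (iota 0 8).
Proof. by vm_compute. Qed.

Lemma foldr_big (A : nmodType) (T : Type) (s : seq T) (F : T -> A) :
  foldr (fun u acc => F u + acc) 0 s = \sum_(u <- s) F u.
Proof. by elim: s => [|u s IH]; rewrite ?big_nil // big_cons -IH. Qed.

Lemma intsumE (A : pzRingType) n (F : nat -> int) :
  (intsum n F)%:~R = \sum_(i < n) (F i)%:~R :> A.
Proof. by rewrite /intsum (foldr_sum n F) rmorph_sum. Qed.

(** In a rank factorization P = C D, idempotency gives D C = 1, so the rank equals the trace. *)
Lemma idempotent_trace1 (F : numFieldType) n (P : 'M[F]_n) :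
  P *m P = P -> \tr P = 1 ->
  exists (u : 'cV[F]_n) (v : 'rV[F]_n), P = u *m v /\ v *m u = 1%:M.
Proof.
move=> PP trP.
have [L HL] : exists L, L *m col_base P = 1%:M.
  by exists (pinvmx (col_base P)); apply: mulVpmx; apply: col_base_full.
have [K HK] : exists K, row_base P *m K = 1%:M.
  by exists (pinvmx (row_base P)); apply: mulmxVp; apply: row_base_free.
move: (col_base P) (row_base P) L HL K HK (mulmx_base P).
move: (\rank P) => r C D L HL K HK CD.
have DC : D *m C = 1%:M.
  have : L *m (P *m P) *m K = L *m P *m K by rewrite PP.
  by rewrite -CD !mulmxA HL !mul1mx -!mulmxA HK mulmx1.
have r1 : r = 1%N.
  by have := trP; rewrite -CD mxtrace_mulC DC mxtrace1 => /eqP; rewrite (eqr_nat F r 1) => /eqP.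
by subst r; exists C, D.
Qed.

Section Spinors.
Context {R : realType}.
Local Notation spinor := 'cV[R]_8.

Definition gamma_mx (i : nat) : 'M[R]_8 := \matrix_(r, s) (gamma_coef i r s)%:~R.

Definition spin_form (u w : spinor) : R := \sum_(r < 8) spin_sign R r * (u r 0 * w r 0).

Lemma spin_formC u w : spin_form u w = spin_form w u.
Proof. by apply: eq_bigr => r _; rewrite [u r 0 * _]mulrC. Qed.

Lemma spin_formDl c u u' w : spin_form (c *: u + u') w = c * spin_form u w + spin_form u' w.
Proof. by rewrite /spin_form big_distrr -big_split; apply: eq_bigr => r _; rewrite !mxE /=; ring. Qed.

Lemma spin_formDr c u u' w : spin_form w (c *: u + u') = c * spin_form w u + spin_form w u'.
Proof. by rewrite spin_formC spin_formDl !(spin_formC _ w). Qed.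

Lemma spin_sign_intr r : (spin_sign int r)%:~R = spin_sign R r.
Proof.
case: r => [|r]; first by rewrite rmorph1.
by rewrite /spin_sign (rmorphN intr) /= sign4_intr.
Qed.

Lemma gamma_mx_clifford (i j : 'I_7) :
  gamma_mx i *m gamma_mx j + gamma_mx j *m gamma_mx i = (2 * (if i == j then sign4 R i else 0))%:M.
Proof.
apply/matrixP => r s; rewrite !mxE.
have /eqP/(congr1 (fun z : int => z%:~R : R)) :=
  all_iotaP (all_iotaP (all_iotaP (all_iotaP gamma_coef_clifford i) j) r) s.
rewrite intrD !intsumE !intrM sign4_intr => H.
transitivity (\sum_(k < 8) (gamma_coef i r k * gamma_coef j k s)%:~R +
              \sum_(k < 8) (gamma_coef j r k * gamma_coef i k s)%:~R : R).
  by congr (_ + _); apply: eq_bigr => k _; rewrite !mxE rmorphM.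
rewrite H -!val_eqE /=.
by case: (_ == _ :> nat); case: (_ == _ :> nat); rewrite /= ?mulr0 ?mulr1 ?mulr1n ?mulr0n.
Qed.

Lemma gamma_mx_skew (i : 'I_7) u w : spin_form (gamma_mx i *m u) w = - spin_form u (gamma_mx i *m w).
Proof.
rewrite /spin_form.
under eq_bigr => r _ do rewrite !mxE big_distrl big_distrr /=.
rewrite exchange_big -sumrN; apply: eq_bigr => s _.
rewrite mxE big_distrr big_distrr -sumrN; apply: eq_bigr => r _ /=; rewrite !mxE.
have /eqP/(congr1 (fun z : int => z%:~R : R)) :=
  all_iotaP (all_iotaP (all_iotaP gamma_coef_skew i) s) r.
rewrite intrM mulrNz intrM !spin_sign_intr => H.
transitivity ((gamma_coef i r s)%:~R * spin_sign R r * (u s 0 * w r 0)); first by ring.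
by rewrite H; ring.
Qed.

Definition spinor1 : spinor := \col_r (r == 0 :> nat)%:R.

Lemma gamma_mx3E (i j k : nat) r s :
  (gamma_mx i *m gamma_mx j *m gamma_mx k) r s = (gamma3_coef i j k r s)%:~R.
Proof.
rewrite /gamma3_coef intsumE mxE.
under eq_bigr => y _ do rewrite !mxE big_distrl /=.
rewrite exchange_big; apply: eq_bigr => x _ /=; rewrite intsumE.
by apply: eq_bigr => y _; rewrite !mxE !rmorphM.
Qed.

(* The rank one decomposition of (M + mu) / (8 mu), which is idempotent of trace 1. *)
Lemma spin_matrix_rank1 (p : nat -> nat -> nat -> R) mu : mu != 0 ->
  triple_norm p = 7 * mu ^+ 2 ->
  (forall t, t \in triples ->
    dual_triangle (alternated p) t.1.1 t.1.2 t.2 = 6 * mu * p t.1.1 t.1.2 t.2) ->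
  exists u : spinor, spin_form u u != 0 /\
    forall t, t \in triples -> p t.1.1 t.1.2 t.2 =
      - mu / spin_form u u *
      spin_form u (gamma_mx t.1.1 *m gamma_mx t.1.2 *m gamma_mx t.2 *m u).
Proof.
move=> mu0 np qp; set M := spin_matrix p.
have MM : M *m M = (7 * mu ^+ 2)%:M + (6 * mu) *: M.
  rewrite /M spin_matrix_sq np; congr (_ + _); apply/matrixP => r s; rewrite !mxE.
  rewrite /spin_entry.
  have := all_iotaP (all_iotaP spin_table_triples r) s.
  elim: (nth _ _ _) => [|u l IH] /=; first by rewrite mulr0.
  by case/andP => /qp -> /IH ->; ring.
(* By [MM], (M + mu)^2 = 8 mu (M + mu); the trace of M + mu is 8 mu. *)
pose P := (8 * mu)^-1 *: (M + mu%:M).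
have mu8 : 8 * mu != 0 by rewrite mulf_neq0 // pnatr_eq0.
have PP : P *m P = P.
  rewrite /P -scalemxAl -scalemxAr scalerA mulmxDl !mulmxDr MM.
  rewrite !mul_mx_scalar !mul_scalar_mx; apply/matrixP => r s; rewrite !mxE.
  by case: (_ == _); rewrite ?mulr1n ?mulr0n; field.
have trP : \tr P = 1.
  by rewrite /P mxtraceZ mxtraceD spin_matrix_tr mxtrace_scalar add0r; field.
have [u [v [Puv vu]]] := idempotent_trace1 PP trP.
have Psym (r s : 'I_8) : spin_sign R r * P r s = spin_sign R s * P s r.
  have := spin_matrix_sym p r s; rewrite /P !mxE => E.
  rewrite mulrCA [RHS]mulrCA !mulrDr E; congr (_ * _ + _ * _).
  by rewrite eq_sym; case: eqP => [->//|_]; rewrite !mulr0n !mulr0.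
have ss r : spin_sign R r * spin_sign R r = 1.
  by case: r => [|r]; rewrite /spin_sign ?mulr1 // mulrNN sign4_sq.
have vu1 : \sum_r v 0 r * u r 0 = 1.
  by have := congr1 (fun A : 'M_1 => A 0 0) vu; rewrite !mxE.
have Pe r s : P r s = u r 0 * v 0 s by rewrite Puv mxE big_ord1.
(* Self-adjointness of the rank one matrix [u *m v] makes the row [v] proportional to the dual of
   [u]. *)
have vE s : v 0 s * spin_form u u = spin_sign R s * u s 0.
  rewrite -[RHS]mulr1 -vu1 /spin_form !big_distrr /=; apply: eq_bigr => r _.
  transitivity (u r 0 * (spin_sign R r * P r s)); first by rewrite Pe; ring.
  by rewrite Psym Pe; ring.
(* A null [u] would vanish by [vE], against [v *m u = 1]. *)
have N0 : spin_form u u != 0.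
  apply/eqP => N; have u0 s : u s 0 = 0.
    by have := vE s; rewrite N mulr0 => /esym E; rewrite -[LHS]mul1r -(ss s) -mulrA E mulr0.
  by have /eqP := vu1; rewrite big1 ?(eq_sym 0) ?oner_eq0 // => r _; rewrite u0 mulr0.
exists u; split=> // t tT.
have Me (r s : 'I_8) : spin_entry p r s = 8 * mu * (u r 0 * v 0 s) - mu *+ (r == s).
  by rewrite -Pe /P /M !mxE mulrA mulfV // mul1r addrK.
pose g (r s : 'I_8) : R := (gamma3_coef t.1.1 t.1.2 t.2 r s)%:~R.
(* Pairing M with a product of three gamma matrices under the trace reads off a component; the
   summand -mu of M drops out since these products are traceless ([trg]). *)
have H : \sum_(r < 8) \sum_(s < 8) spin_entry p r s * g s r =
    - 8 * p t.1.1 t.1.2 t.2.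
  rewrite -(spin_matrix_component p tT) foldr_big big_filter big_map [RHS]big_mkcond.
  rewrite big_allpairs_dep -[in RHS]/(index_iota 0 8) big_mkord.
  apply: eq_bigr => r _; rewrite -[in RHS]/(index_iota 0 8) big_mkord.
  by apply: eq_bigr => s _; case: eqP => //= E; rewrite /g E mulr0.
have trg : \sum_r g r r = 0.
  rewrite /g -(intsumE _ 8 (fun r => gamma3_coef t.1.1 t.1.2 t.2 r r)).
  by have /allP/(_ t tT)/eqP -> := gamma3_trace.
have F : spin_form u (gamma_mx t.1.1 *m gamma_mx t.1.2 *m gamma_mx t.2 *m u) =
    \sum_(r < 8) \sum_(s < 8) spin_sign R s * u s 0 * (g s r * u r 0).
  rewrite exchange_big; apply: eq_bigr => s _.
  rewrite mxE [X in _ * X]big_distrr [LHS]big_distrr /=; apply: eq_bigr => r _.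
  by rewrite gamma_mx3E !mulrA.
suff E : - 8 * p t.1.1 t.1.2 t.2 =
    8 * mu / spin_form u u * spin_form u (gamma_mx t.1.1 *m gamma_mx t.1.2 *m gamma_mx t.2 *m u).
  apply: (@mulfI _ (- 8)); first by rewrite oppr_eq0 pnatr_eq0.
  by rewrite E; ring.
have vN s : v 0 s = (spin_form u u)^-1 * (spin_sign R s * u s 0).
  by rewrite -vE mulrC mulfK.
rewrite -H F big_distrr /=.
transitivity (\sum_(r < 8) ((\sum_(s < 8) 8 * mu / spin_form u u *
    (spin_sign R s * u s 0 * (g s r * u r 0))) - mu * g r r)).
  apply: eq_bigr => r _; rewrite -[in RHS](sum_delta (fun s => g s r) r).
  rewrite big_distrr -sumrB /=; apply: eq_bigr => s _; rewrite Me vN.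
  by rewrite -mulr_natr; ring.
rewrite sumrB -big_distrr /= trg mulr0 subr0.
by apply: eq_bigr => r _; rewrite big_distrr.
Qed.

End Spinors.

Lemma triplesP i j k : (i < j)%N -> (j < k)%N -> (k < 7)%N -> (i, j, k) \in triples.
Proof.
move=> ij jk k7.
have H : all (fun i => all (fun j => all (fun k =>
    (i < j < k)%N ==> ((i, j, k) \in triples)) (iota 0 7)) (iota 0 7)) (iota 0 7).
  by vm_compute.
have j7 := ltn_trans jk k7; have i7 := ltn_trans ij j7.
have /= := all_iotaP (all_iotaP (all_iotaP H (Ordinal i7)) (Ordinal j7)) (Ordinal k7).
by rewrite ij jk.
Qed.

(** * Clifford multiplication and the three-form of a spinor *)

Section Clifford.
Context {R : realType} {V : vectType R} {h : V -> V -> R}.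
Hypothesis hbil : symmetric_bilinear h.
Context {b : 7.-tuple V}.
Hypothesis ob : orthonormal_basis h (fun i : 'I_7 => sign4 R i) b.
Local Notation spinor := 'cV[R]_8.
Implicit Types (u w : spinor) (x y z : V).

Definition clifford x : 'M[R]_8 := \sum_(i < 7) coord b i x *: gamma_mx i.

Lemma cliffordP c x y : clifford (c *: x + y) = c *: clifford x + clifford y.
Proof.
rewrite /clifford scaler_sumr -big_split; apply: eq_bigr => i _ /=.
by rewrite linearP scalerDl scalerA.
Qed.

Lemma clifford0 : clifford 0 = 0.
Proof. by rewrite /clifford big1 // => i _; rewrite linear0 scale0r. Qed.

Lemma clifford_basis (i : 'I_7) : clifford b`_i = gamma_mx i.
Proof.
have [hb _ _] := ob; rewrite /clifford (bigD1 i) //= big1 => [|j ji].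
  by rewrite coord_free ?(basis_free hb) // eqxx scale1r addr0.
by rewrite coord_free ?(basis_free hb) // eq_sym (negPf ji) scale0r.
Qed.

Lemma clifford_anticomm x y :
  clifford x *m clifford y + clifford y *m clifford x = (2 * h x y)%:M.
Proof.
rewrite /clifford !mulmx_suml.
transitivity (\sum_(i < 7) \sum_(j < 7) (coord b i x * coord b j y) *:
   (gamma_mx i *m gamma_mx j + gamma_mx j *m gamma_mx i) : 'M[R]_8).
  under eq_bigr => i _ do rewrite mulmx_sumr.
  under [X in _ + X]eq_bigr => i _ do rewrite mulmx_sumr.
  rewrite [X in _ + X]exchange_big -big_split; apply: eq_bigr => i _.
  rewrite -big_split; apply: eq_bigr => j _ /=.
  rewrite -!scalemxAl -!scalemxAr !scalerA scalerDr; congr (_ + _ *: _).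
  exact: mulrC.
under eq_bigr => i _ do under eq_bigr => j _ do rewrite gamma_mx_clifford.
apply/matrixP => r s; rewrite summxE !mxE (orthonormal_metric hbil ob).
rewrite big_distrr -sumrMnl; apply: eq_bigr => i _.
rewrite summxE (bigD1 i) //= big1 => [|j ji].
  by rewrite !mxE eqxx addr0 mulrnAr; congr (_ *+ _); ring.
by rewrite !mxE eq_sym (negPf ji) mulr0 mul0rn mulr0.
Qed.

Lemma clifford_sq x w : clifford x *m (clifford x *m w) = h x x *: w.
Proof.
have := clifford_anticomm x x; rewrite -mulr2n => E.
have {}E : clifford x *m clifford x = (h x x)%:M.
  apply: (@scalerI _ _ 2); first by rewrite pnatr_eq0.
  by rewrite scaler_nat E scale_scalar_mx.
by rewrite mulmxA E mul_scalar_mx.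
Qed.

Lemma clifford_swap x y w :
  clifford x *m (clifford y *m w) = 2 * h x y *: w - clifford y *m (clifford x *m w).
Proof.
by rewrite !mulmxA -mul_scalar_mx -clifford_anticomm mulmxDl addrK.
Qed.

Lemma spin_form0r u : spin_form u 0 = 0.
Proof. by rewrite /spin_form big1 // => r _; rewrite mxE !mulr0. Qed.

Lemma spin_formZr c u w : spin_form u (c *: w) = c * spin_form u w.
Proof. by rewrite -[c *: w]addr0 spin_formDr spin_form0r addr0. Qed.

Lemma spin_formBr u w w' : spin_form u (w - w') = spin_form u w - spin_form u w'.
Proof. by rewrite -scaleN1r addrC spin_formDr mulN1r addrC. Qed.

Lemma spin_formNr u w : spin_form u (- w) = - spin_form u w.
Proof. by rewrite -scaleN1r spin_formZr mulN1r. Qed.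

Lemma clifford_skew x u w :
  spin_form (clifford x *m u) w = - spin_form u (clifford x *m w).
Proof.
have sl (I : finType) (c : I -> R) (F : I -> spinor) v :
    spin_form v (\sum_i c i *: F i) = \sum_i c i * spin_form v (F i).
  elim/big_rec2: _ => [|i y z _ <-]; first exact: spin_form0r.
  exact: spin_formDr.
have ml v : clifford x *m v = \sum_(i < 7) coord b i x *: (gamma_mx i *m v).
  by rewrite /clifford mulmx_suml; apply: eq_bigr => i _; rewrite -scalemxAl.
rewrite !ml spin_formC !sl -sumrN; apply: eq_bigr => i _.
by rewrite spin_formC gamma_mx_skew mulrN.
Qed.

Lemma clifford_null x u : spin_form u (clifford x *m u) = 0.
Proof. by have := clifford_skew x u u; rewrite spin_formC => E; lra. Qed.

Definition spinor_form u : kform V 3 := fun v =>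
  spin_form u (clifford (tnth v 0) *m (clifford (tnth v 1) *m (clifford (tnth v 2%:R) *m u))).

Lemma eval_spinor_form u x y z : eval_seq (spinor_form u) [:: x; y; z] =
  spin_form u (clifford x *m (clifford y *m (clifford z *m u))).
Proof. by rewrite /eval_seq /spinor_form !tnth_mktuple. Qed.

Lemma kform3_ext (a a' : kform V 3) :
  (forall x y z, eval_seq a [:: x; y; z] = eval_seq a' [:: x; y; z]) -> a = a'.
Proof.
by move=> E; apply/eval_seq_ext => -[[|x [|y [|z [|t l]]]] sz] //; apply: E.
Qed.

(** After a swap if necessary, a repeated vector squares to a scalar. What remains are multiples of
    the pairing of u with z u for a vector z, which vanishes by skewness. *)
Lemma spinor_form_alternating u : alternating (spinor_form u).
Proof.
have L x y c (w w' : spinor) : clifford x *m (c *: w + w') =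
    c *: (clifford x *m w) + clifford x *m w' by rewrite mulmxDr -scalemxAr.
have L' x y c (w : spinor) : clifford (c *: x + y) *m w =
    c *: (clifford x *m w) + clifford y *m w by rewrite cliffordP mulmxDl -scalemxAl.
have D12 x z : spin_form u (clifford x *m (clifford x *m (clifford z *m u))) = 0.
  by rewrite clifford_sq spin_formZr clifford_null mulr0.
have D23 x z : spin_form u (clifford z *m (clifford x *m (clifford x *m u))) = 0.
  by rewrite clifford_sq -scalemxAr spin_formZr clifford_null mulr0.
have D13 x z : spin_form u (clifford x *m (clifford z *m (clifford x *m u))) = 0.
  rewrite clifford_swap spin_formBr spin_formZr clifford_sq -scalemxAr spin_formZr.
  by rewrite !clifford_null !mulr0 subr0.
split=> [v i c x y|v i j]; rewrite /spinor_form.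
  rewrite !tnth_set -!val_eqE; case: i => [[|[|[|//]]] hi] /=.
  - by rewrite L' spin_formDr.
  - by rewrite L' // L // spin_formDr.
  - by rewrite L' // !L // spin_formDr.
have t0 k : tnth v k = v`_k by rewrite (tnth_nth 0).
rewrite !t0; case: i j => [[|[|[|//]]] hi] [[|[|[|//]]] hj] //= _ => [->|->|<-|->|<-|<-]; rewrite ?D12 ?D23 ?D13 //.
Qed.

End Clifford.

(** Orthogonality gives the square coordinate matrix a left inverse, which is then also a right
    inverse. *)
Lemma spin_form_orthogonal_expand (R : realType) (c : 'I_8 -> 'cV[R]_8) (d : 'I_8 -> R) w :
  (forall k, d k != 0) ->
  (forall k l, spin_form (c k) (c l) = if k == l then d k else 0) ->
  w = \sum_k (spin_form (c k) w / d k) *: c k.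
Proof.
move=> d0 cc.
pose A : 'M[R]_8 := \matrix_(r, k) c k r 0.
pose B : 'M[R]_8 := \matrix_(k, r) ((d k)^-1 * (spin_sign R r * c k r 0)).
have BA : B *m A = 1%:M.
  apply/matrixP => k l; rewrite !mxE.
  transitivity ((d k)^-1 * spin_form (c k) (c l)).
    by rewrite /spin_form big_distrr; apply: eq_bigr => r _; rewrite !mxE /=; ring.
  by rewrite cc; case: eqP => _; rewrite ?mulr0 // mulVf.
rewrite -[LHS]mul1mx -(mulmx1C BA) -mulmxA.
apply/colP => r; rewrite mxE summxE; apply: eq_bigr => k _.
rewrite !mxE mulrC; congr (_ * _).
rewrite [RHS]mulrC /spin_form big_distrr; apply: eq_bigr => s _; rewrite !mxE /=; ring.
Qed.

Lemma exists_lfun (F : fieldType) (U W : vectType F) (g : U -> W) :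
  linear g -> exists G : 'Hom(U, W), forall x, G x = g x.
Proof.
move=> lin; pose L : {linear U -> W} := HB.pack g (GRing.isLinear.Build F U W *:%R g lin).
by exists (linfun L) => x; rewrite lfunE.
Qed.

Lemma eq_phi0_poly (A : pzRingType) (T : Type) (f g : nat -> T -> A) x y z :
  (forall m t, (m < 7)%N -> f m t = g m t) -> phi0_poly f x y z = phi0_poly g x y z.
Proof.
move=> E; have {}E m : (m < 7)%N -> f m = g m by move=> m7; apply: funext => t; apply: E.
rewrite /phi0_poly /=.
by rewrite (E 0%N) // (E 1%N) // (E 2%N) // (E 3%N) // (E 4%N) // (E 5%N) // (E 6%N).
Qed.

(** * Reaching every non-null spinor from the spinor 1 *)

Section Spinors.
Context {R : realType} {V : vectType R} {h : V -> V -> R}.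
Hypothesis hbil : symmetric_bilinear h.
Context {b : 7.-tuple V}.
Hypothesis ob : orthonormal_basis h (fun i : 'I_7 => sign4 R i) b.
Local Notation spinor := 'cV[R]_8.
Local Notation clifford := (@clifford R V b).
Local Notation spinor_form := (@spinor_form R V b).
Implicit Types (u w : spinor) (x y z : V).

Lemma spinor_form1 (f : 7.-tuple 'Hom(V, R^o)) : dual_basis f b ->
  spinor_form (spinor1 : spinor) = phi0 f.
Proof.
move=> fb; have [hb _ _] := ob.
apply: (alternating_ext3 hb) => [||i j k ij jk k7].
- exact: (spinor_form_alternating hbil ob).
- exact: phi0_alternating.
rewrite (component_phi0 fb) // ?(ltn_trans jk k7) // ?(ltn_trans ij (ltn_trans jk k7)) //.
rewrite /component eval_spinor_form.
have j7 := ltn_trans jk k7; have i7 := ltn_trans ij j7.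
rewrite (clifford_basis ob (Ordinal i7)) (clifford_basis ob (Ordinal j7)).
rewrite (clifford_basis ob (Ordinal k7)) !mulmxA /=.
have /allP/(_ _ (triplesP ij jk k7))/eqP/= <- := gamma3_phi0.
rewrite -[RHS](gamma_mx3E (R := R) i j k ord0 ord0) /spin_form (bigD1 ord0) //= big1 ?addr0 => [|r r0].
  rewrite !mxE /= mul1r mul1r (bigD1 ord0) //= big1 ?addr0 => [|s s0].
    by rewrite !mxE /= mulr1.
  by rewrite !mxE -val_eqE in s0 *; rewrite (negPf s0) mulr0.
by rewrite !mxE -val_eqE in r0 *; rewrite (negPf r0) mul0r mulr0.
Qed.

Definition reflection v x : V := x - (2 * h x v / h v v) *: v.

Lemma reflectionP v c x y : reflection v (c *: x + y) = c *: reflection v x + reflection v y.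
Proof.
rewrite /reflection (hbil.2 c x y v) scalerBr scalerA addrACA -opprD -scalerDl.
by congr (_ - _ *: _); ring.
Qed.

Lemma reflection_isometry v x y : h v v != 0 ->
  h (reflection v x) (reflection v y) = h x y.
Proof.
move=> v0; have [hC hl] := hbil.
have hB z z' c t : h (z - c *: z') t = h z t - c * h z' t.
  by rewrite addrC -scaleNr hl mulNr addrC.
rewrite /reflection !hB ![h _ (y - _)]hC !hB ![h y _]hC ![h v x]hC [h v y]hC.
by field.
Qed.

Lemma reflectionK v x : h v v != 0 -> reflection v (reflection v x) = x.
Proof.
move=> v0; have [hC hl] := hbil.
rewrite {1}/reflection (_ : h (reflection v x) v = - h x v); last first.
  by rewrite /reflection addrC -scaleNr hl; field.
rewrite /reflection -addrA -opprD -scalerDl.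
by rewrite [X in X *: v](_ : _ = 0) ?scale0r ?subr0 //; field.
Qed.

Lemma clifford_reflection v x w : h v v != 0 ->
  clifford v *m (clifford x *m w) = - (clifford (reflection v x) *m (clifford v *m w)).
Proof.
move=> v0.
have -> : clifford (reflection v x) = clifford x - (2 * h x v / h v v) *: clifford v.
  by rewrite /reflection addrC -scaleNr cliffordP scaleNr addrC.
rewrite (clifford_swap hbil ob) mulmxBl -scalemxAl (clifford_sq hbil ob) scalerA opprB.
by rewrite (hbil.1 v x); congr (_ *: _ - _); field.
Qed.

(** Moving v through three vectors reflects each of them and costs three signs; the skewness of v
    gives the fourth, and the two copies of v meet in the factor [h v v]. *)
Lemma spinor_form_clifford v u x y z : h v v != 0 ->
  eval_seq (spinor_form (clifford v *m u)) [:: x; y; z] =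
  h v v * eval_seq (spinor_form u) [:: reflection v x; reflection v y; reflection v z].
Proof.
move=> v0; rewrite !eval_spinor_form clifford_skew.
rewrite (clifford_reflection x _ v0) (clifford_reflection y _ v0) (clifford_reflection z _ v0).
rewrite !mulmxN !opprK (clifford_sq hbil ob) -!scalemxAr.
by rewrite spin_formNr opprK spin_formZr.
Qed.

(** The pivot of the proof: both the stabilizer condition and the equation are shown to be
    equivalent to it. *)
Definition is_phi0_multiple (a : kform V 3) : Prop :=
  exists (c : R) (b' : 7.-tuple V) (f : 7.-tuple 'Hom(V, R^o)),
    [/\ c != 0, orthonormal_basis h (fun i : 'I_7 => sign4 R i) b', dual_basis f b' &
        a = c *: phi0 f].

Lemma isometry_basis (b' : 7.-tuple V) (g : V -> V) :
  orthonormal_basis h (fun i : 'I_7 => sign4 R i) b' ->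
  (forall x y, h (g x) (g y) = h x y) ->
  orthonormal_basis h (fun i : 'I_7 => sign4 R i) [tuple of map g b'].
Proof.
move=> [hb he hbb] iso; split=> // [|i j]; last by rewrite !tnth_map iso hbb.
have d7 : (\dim {:V} <= 7)%N by rewrite -(size_basis hb).
rewrite basisEfree subvf andbC; apply/andP; split; first by rewrite /= size_map size_tuple.
apply/freeP => c c0 i.
have H : h (\sum_j c j *: [tuple of map g b']`_j) (tnth [tuple of map g b'] i) = 0.
  by rewrite c0 (bilin0l hbil).
rewrite (bilin_suml hbil) (bigD1 i) //= big1 ?addr0 in H => [|j ji].
  move: H; rewrite -tnth_nth !tnth_map iso hbb eqxx => /eqP.
  rewrite mulf_eq0 => /orP[/eqP //|/eqP E].
  by have := he i; rewrite E mulr0 => /eqP; rewrite eq_sym oner_eq0.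
by rewrite -tnth_nth !tnth_map iso hbb (negPf ji) mulr0.
Qed.

Lemma is_phi0_multiple_clifford v u : h v v != 0 ->
  is_phi0_multiple (spinor_form u) -> is_phi0_multiple (spinor_form (clifford v *m u)).
Proof.
move=> v0 [c [b' [f [c0 ob' fb E]]]].
have lin i : linear (fun x => tnth f i (reflection v x) : R^o).
  by move=> z x y; rewrite reflectionP linearP.
have ex i := exists_lfun (lin i).
pose fv : 7.-tuple 'Hom(V, R^o) := [tuple sval (cid (ex i)) | i < 7].
have fvE i x : tnth fv i x = tnth f i (reflection v x).
  by rewrite tnth_mktuple (svalP (cid (ex i))).
pose bv := [tuple of map (reflection v) b'].
have fvbv : dual_basis fv bv by move=> i j; rewrite fvE tnth_map reflectionK.
exists (h v v * c), bv, fv; split=> //; first by rewrite mulf_neq0.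
  by apply: isometry_basis => // x y; apply: reflection_isometry.
apply: kform3_ext => x y z; rewrite spinor_form_clifford // E.
have evZ k (a : R) (g : kform V k) l : eval_seq (a *: g) l = a * eval_seq g l by [].
rewrite !evZ !eval_phi0 mulrA; congr (_ * _).
rewrite (@eq_phi0_poly _ _ (fun m t => fv`_m t) (fun m t => f`_m (reflection v t))) // => m t m7.
by have := fvE (Ordinal m7) t; rewrite !(tnth_nth 0).
Qed.

(** For non-null u, the spinors u, e_1 u, ..., e_7 u form an orthogonal basis of non-null spinors,
    so the vectors carry u onto its whole orthogonal complement. *)
Lemma exists_clifford_mul u w : spin_form u u != 0 -> spin_form u w = 0 ->
  exists v, w = clifford v *m u.
Proof.
move=> u0 uw; have [_ he hbb] := ob.
pose c (k : 'I_8) : spinor := oapp (fun i : 'I_7 => gamma_mx i *m u) u (unlift ord0 k).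
pose d (k : 'I_8) : R := oapp (fun i : 'I_7 => - sign4 R i * spin_form u u) (spin_form u u) (unlift ord0 k).
have s0 i : sign4 R i != 0.
  by apply/eqP => E; have := sign4_sq (R := R) i; rewrite E mulr0 => /eqP; rewrite eq_sym oner_eq0.
have gu i : spin_form u (gamma_mx (i : 'I_7) *m u) = 0.
  by rewrite -(clifford_basis ob i) clifford_null.
have d0 k : d k != 0.
  by rewrite /d; case: unliftP => [i|] _ //=; rewrite mulf_neq0 ?oppr_eq0.
have cc k l : spin_form (c k) (c l) = if k == l then d k else 0.
  rewrite /c /d; case: (unliftP ord0 k) => [i|] ->; case: (unliftP ord0 l) => [j|] -> /=.
  - rewrite (inj_eq lift_inj) gamma_mx_skew.
    rewrite -(clifford_basis ob i) -(clifford_basis ob j).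
    case: (i =P j) => [<-|/eqP ij].
      by rewrite (clifford_sq hbil ob) spin_formZr -tnth_nth hbb eqxx; ring.
    (* For i and j distinct, the pairing of u with e_i e_j u is antisymmetric in i, j by the
       Clifford relation and symmetric by skewness, hence zero. *)
    have E : spin_form u (clifford b`_i *m (clifford b`_j *m u)) =
        - spin_form u (clifford b`_j *m (clifford b`_i *m u)).
      rewrite (clifford_swap hbil ob) spin_formBr spin_formZr -!tnth_nth hbb (negPf ij).
      by rewrite mulr0 mul0r sub0r.
    have E2 : spin_form u (clifford b`_i *m (clifford b`_j *m u)) =
        spin_form u (clifford b`_j *m (clifford b`_i *m u)).
      by rewrite -[LHS]opprK -clifford_skew spin_formC clifford_skew opprK.
    by move: E; rewrite -E2; lra.
  - by rewrite spin_formC gu.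
  - by rewrite gu.
  - by [].
exists (\sum_(i < 7) (spin_form (gamma_mx i *m u) w / (- sign4 R i * spin_form u u)) *: b`_i).
rewrite {1}(spin_form_orthogonal_expand w d0 cc) big_ord_recl.
rewrite {1 2}/c unlift_none /= uw mul0r scale0r add0r.
have cs (F : 'I_7 -> R) : clifford (\sum_(i < 7) F i *: b`_i) = \sum_(i < 7) F i *: gamma_mx i.
  under [RHS]eq_bigr => i _ do rewrite -(clifford_basis ob i).
  by elim/big_rec2: _ => [|i y x _ <-]; [exact: clifford0 | exact: cliffordP].
rewrite cs mulmx_suml; apply: eq_bigr => i _.
by rewrite /c /d liftK /= scalemxAl.
Qed.

Lemma exists_orthogonal_spinor u : exists u1 : spinor,
  [/\ spin_form u1 u1 != 0, spin_form spinor1 u1 = 0 & spin_form u1 u = 0].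
Proof.
(* Coordinates 5 and 6 are positive for the spinor norm and orthogonal to the spinor 1. In this
   definite plane some nonzero, hence non-null, spinor is orthogonal to [u]. *)
pose o5 : 'I_8 := inord 5; pose o6 : 'I_8 := inord 6.
pose mk (x y : R) : spinor := \col_r (if r == o5 then x else if r == o6 then y else 0).
have E5 : o5 = 5%N :> nat by rewrite inordK.
have E6 : o6 = 6%N :> nat by rewrite inordK.
have n56 : (o6 == o5) = false by rewrite -val_eqE /= E5 E6.
have mkE (x y : R) w : spin_form (mk x y) w = x * w o5 0 + y * w o6 0.
  rewrite /spin_form (bigD1 o5) //= (bigD1 o6) ?n56 //= big1 ?addr0.
    rewrite !mxE eqxx n56 eqxx /spin_sign E5 E6 /sign4 /= expr1; ring.
  by move=> r /andP[/negPf r5 /negPf r6]; rewrite !mxE r5 r6 mul0r mulr0.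
have mk0 (x y : R) : spin_form spinor1 (mk x y) = 0.
  by rewrite spin_formC mkE !mxE E5 E6 /= !mulr0 addr0.
have mk5 (x y : R) : mk x y o5 0 = x by rewrite mxE eqxx.
have mk6 (x y : R) : mk x y o6 0 = y by rewrite mxE n56 eqxx.
have [/andP[/eqP u5 /eqP u6]|nz] := boolP ((u o5 0 == 0) && (u o6 0 == 0)).
  exists (mk 1 0); split=> //; rewrite mkE ?mk5 ?mk6 ?u5 ?u6.
    by rewrite mulr1 mulr0 addr0 oner_eq0.
  by rewrite !mulr0 addr0.
exists (mk (u o6 0) (- u o5 0)); split=> //; rewrite mkE; last by ring.
rewrite mk5 mk6 mulrNN -!expr2 paddr_eq0 ?sqr_ge0 // !sqrf_eq0.
by rewrite andbC.
Qed.

(** One vector only reaches the complement of the spinor 1, so the path goes through a non-null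
    spinor orthogonal to both ends. The sign of the norm of u is not constrained. *)
Lemma nonnull_is_phi0_multiple u : spin_form u u != 0 ->
  is_phi0_multiple (spinor_form u).
Proof.
move=> u0; have [hb _ _] := ob.
have [u1 [n1 eu1 uu1]] := exists_orthogonal_spinor u.
have ee : spin_form (spinor1 : spinor) spinor1 = 1.
  rewrite /spin_form (bigD1 ord0) //= big1 ?addr0 => [|r r0].
    by rewrite !mxE /= !mulr1.
  by rewrite -val_eqE in r0; rewrite !mxE (negPf r0) !mulr0.
have norm v w : spin_form (clifford v *m w) (clifford v *m w) = - (h v v * spin_form w w).
  by rewrite clifford_skew // (clifford_sq hbil ob) spin_formZr.
have [v Ev] : exists v, u1 = clifford v *m spinor1.
  by apply: exists_clifford_mul eu1; rewrite ee oner_eq0.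
have [w Ew] := exists_clifford_mul n1 uu1.
have v0 : h v v != 0.
  by apply/eqP => E; move: n1; rewrite Ev norm E mul0r oppr0 eqxx.
have w0 : h w w != 0.
  by apply/eqP => E; move: u0; rewrite Ew norm E mul0r oppr0 eqxx.
rewrite Ew Ev; do 2!apply: is_phi0_multiple_clifford => //.
have [f fb] := exists_dual_coframe hb.
by exists 1, b, f; split; rewrite ?oner_eq0 // scale1r; apply: spinor_form1.
Qed.

End Spinors.

(** * From the equation to a multiple of phi0 *)

Lemma triple_norm_sum (R : realType) (p : nat -> nat -> nat -> R) :
  6^-1 * (\sum_(i < 7) \sum_(j < 7) \sum_(k < 7)
    sign4 R i * sign4 R j * sign4 R k * alternated p i j k ^+ 2) = - triple_norm p.
Proof.
rewrite -(foldr_sum3 7 (fun i j k =>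
  sign4 R i * sign4 R j * sign4 R k * alternated p i j k ^+ 2)).
by rewrite /triple_norm /sign4 /alternated /=; field.
Qed.

Lemma dual_triangle_bump (R : realType) (p : nat -> nat -> nat -> R) c :
  (forall (i0 : 'I_7) (i1 : 'I_6) (i2 : 'I_5) (i3 : 'I_4),
    let f0 := bump i0 in let f1 j := f0 (bump i1 j) in
    let f2 j := f1 (bump i2 j) in let f3 j := f2 (bump i3 j) in
    c * p (f3 0%N) (f3 1%N) (f3 2%N) =
    sign4 R i0 * sign4 R (f0 i1) * sign4 R (f1 i2) * sign4 R (f2 i3) *
    triangle_component p i0 (f0 i1) (f1 i2) (f2 i3) * (-1) ^+ (i0 + i1 + i2 + i3)) ->
  forall t, t \in triples -> dual_triangle p t.1.1 t.1.2 t.2 = c * p t.1.1 t.1.2 t.2.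
Proof.
move=> H t; rewrite !inE; do ![case/orP] => /eqP ->; cbn [fst snd]; rewrite /dual_triangle.
all: match goal with |- context [seq.filter ?P ?l] =>
  let l2 := eval vm_compute in (seq.filter P l) in
  change (seq.filter P l) with l2; cbn beta iota end.
(* An increasing complement (a, b, c, d) has the code (a, b - 1, c - 2, d - 3), since each entry is
   counted among the elements not yet taken. *)
all: match goal with |- context [triangle_component _ ?x ?y ?z ?t] =>
  let y1 := eval vm_compute in y.-1 in
  let z1 := eval vm_compute in z.-2 in
  let t1 := eval vm_compute in (t.-2).-1 in
  refine (etrans _ (esym (H (@Ordinal 7 x isT) (@Ordinal 6 y1 isT)
                            (@Ordinal 5 z1 isT) (@Ordinal 4 t1 isT)))) end.
all: rewrite /sign4 /=; ring.
Qed.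

Section Equation.
Context {R : realType} {V : vectType R} {h : V -> V -> R}.
Hypothesis hbil : symmetric_bilinear h.
Context {b : 7.-tuple V}.
Hypothesis ob : orthonormal_basis h (fun i : 'I_7 => sign4 R i) b.
Context {a : kform V 3}.
Hypothesis alta : alternating a.
Local Notation p := (component (b := b) a).

Lemma alternated_component i j k : alternated p i j k = p i j k.
Proof.
rewrite /alternated; case: (ltngtP i j) => [ij|ji|->]; last by rewrite component_diag12.
  case: (ltngtP j k) => [jk|kj|->] //; last by rewrite component_diag23.
  rewrite (component_swap23 _ i k j) //.
  case: (ltngtP i k) => [ik|ki|->] //; last by rewrite component_diag12 ?oppr0.
  by rewrite component_swap12.
rewrite (component_swap12 _ j i k) //.
case: (ltngtP i k) => [ik|ki|->] //; last by rewrite component_diag23 ?oppr0.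
rewrite (component_swap23 _ j k i) // opprK.
case: (ltngtP j k) => [jk|kj|->] //; last by rewrite component_diag12.
by rewrite component_swap12 ?opprK.
Qed.

Lemma equation_phi0_multiple mu : mu != 0 ->
  form_metric h a a = - 7 * mu ^+ 2 ->
  (forall (i0 : 'I_7) (i1 : 'I_6) (i2 : 'I_5) (i3 : 'I_4),
    let f0 := bump i0 in let f1 j := f0 (bump i1 j) in
    let f2 j := f1 (bump i2 j) in let f3 j := f2 (bump i3 j) in
    6 * mu * p (f3 0%N) (f3 1%N) (f3 2%N) =
    sign4 R i0 * sign4 R (f0 i1) * sign4 R (f1 i2) * sign4 R (f2 i3) *
    triangle_component p i0 (f0 i1) (f1 i2) (f2 i3) * (-1) ^+ (i0 + i1 + i2 + i3)) ->
  is_phi0_multiple (h := h) a.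
Proof.
move=> mu0 na H.
have E : alternated p = p.
  by apply: funext => i; apply: funext => j; apply: funext => k; apply: alternated_component.
have np : triple_norm p = 7 * mu ^+ 2.
  apply: oppr_inj; rewrite -triple_norm_sum E -(form_metric3 hbil ob alta) na; ring.
have qp t : t \in triples ->
    dual_triangle (alternated p) t.1.1 t.1.2 t.2 = 6 * mu * p t.1.1 t.1.2 t.2.
  by rewrite E; apply: dual_triangle_bump.
have [u [u0 Eu]] := spin_matrix_rank1 mu0 np qp.
have [hb _ _] := ob.
have Ea : a = (- mu / spin_form u u) *: spinor_form (b := b) u.
  apply: (alternating_ext3 hb) => // [|i j k ij jk k7].
    by apply: alternatingZ; apply: (spinor_form_alternating hbil ob).
  have j7 := ltn_trans jk k7; have i7 := ltn_trans ij j7.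
  have /= -> := Eu _ (triplesP ij jk k7).
  rewrite componentZ /component eval_spinor_form.
  rewrite (clifford_basis ob (Ordinal i7)) (clifford_basis ob (Ordinal j7)).
  by rewrite (clifford_basis ob (Ordinal k7)) !mulmxA.
have [c [b' [f [c0 ob' fb' E']]]] := nonnull_is_phi0_multiple hbil ob u0.
exists (- mu / spin_form u u * c), b', f; split=> //.
  by rewrite !mulf_neq0 ?oppr_eq0 ?invr_eq0.
by rewrite -scalerA -E'.
Qed.

End Equation.

(** * The stabilizer of phi0 *)

Definition sign_matrix (s : seq int) (i j : nat) : int := if i == j then nth 0 s i else 0.

(* Four times the product of the hyperbolic rotations in the planes (x, y) and
   (z, w) with cosh = 5/4 and sinh = 3/4 c, 3/4 e respectively. *)
Definition boost_matrix (x y z w : nat) (c e : int) (i j : nat) : int :=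
  if i == j then if i \in [:: x; y; z; w] then 5 else 4
  else if ((i, j) == (x, y)) || ((i, j) == (y, x)) then 3 * c
  else if ((i, j) == (z, w)) || ((i, j) == (w, z)) then 3 * e
  else 0.

(** A rational matrix is kept as an integer matrix B over a denominator d. Here B' stands for d
    times the inverse of B / d, so the product is d^2; the cubic form phi0 picks up d^3. *)
Definition phi0_invertible (B B' : nat -> nat -> int) (d : int) : bool :=
  all (fun i => all (fun j =>
    intsum 7 (fun m => B' i m * B m j) == d ^+ 2 * (i == j)%:Z) (iota 0 7)) (iota 0 7).

Definition phi0_invariant (B : nat -> nat -> int) (d : int) : bool :=
  all (fun t => phi0_poly B t.1.1 t.1.2 t.2 == d ^+ 3 * phi0c t.1.1 t.1.2 t.2) triples.

Lemma eq_phi0_poly3 (A : pzRingType) (T U : Type) (f : nat -> T -> A) (g : nat -> U -> A)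
    x y z x' y' z' :
  (forall m, (m < 7)%N -> f m x = g m x') ->
  (forall m, (m < 7)%N -> f m y = g m y') ->
  (forall m, (m < 7)%N -> f m z = g m z') ->
  phi0_poly f x y z = phi0_poly g x' y' z'.
Proof.
move=> Ex Ey Ez.
(* Renaming the three points 0, 1, 2 brings both sides to the same type of points. *)
pose F m := nth 0 [:: f m x; f m y; f m z]; pose G m := nth 0 [:: g m x'; g m y'; g m z'].
rewrite -[LHS]/(phi0_poly F 0%N 1%N 2%N) -[RHS]/(phi0_poly G 0%N 1%N 2%N).
by apply: eq_phi0_poly => m t m7; rewrite /F /G Ex ?Ey ?Ez.
Qed.

Lemma phi0_polyZ (A : comPzRingType) (T : Type) c (f : nat -> T -> A) x y z :
  phi0_poly (fun m t => c * f m t) x y z = c ^+ 3 * phi0_poly f x y z.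
Proof.
have E m n k : det3 (fun t => c * f m t) (fun t => c * f n t) (fun t => c * f k t) x y z =
    c ^+ 3 * det3 (f m) (f n) (f k) x y z by rewrite /det3; ring.
by rewrite /phi0_poly /= !E; ring.
Qed.

Lemma phi0_poly_intr (A : pzRingType) (T : Type) (f : nat -> T -> int) x y z :
  phi0_poly (fun m t => (f m t)%:~R) x y z = (phi0_poly f x y z)%:~R :> A.
Proof.
have E m n k : det3 (fun t => (f m t)%:~R) (fun t => (f n t)%:~R) (fun t => (f k t)%:~R) x y z =
    (det3 (f m) (f n) (f k) x y z)%:~R :> A.
  by rewrite /det3 !(rmorphD, rmorphB, rmorphN, rmorphM).
by rewrite /phi0_poly /= !E !(rmorphD, rmorphB, rmorphN).
Qed.

Section Stabilizer.
Context {R : realType} {V : vectType R}.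

Lemma functional_linear (u : 'Hom(V, R^o)) (c : R) x y :
  u (c *: x + y) = c * u x + u y.
Proof. exact: linearP. Qed.

Lemma functional_sum (u : 'Hom(V, R^o)) (I : finType) (c : I -> R) (x : I -> V) :
  u (\sum_i c i *: x i) = \sum_i c i * u (x i).
Proof.
elim/big_rec2: _ => [|i y z _ <-]; first by rewrite linear0.
exact: functional_linear.
Qed.

Lemma eval_sum_slot k (a : kform V k) l l' (I : Type) (r : seq I) (c : I -> R) (x : I -> V) :
  multilinear a -> (size l < k)%N ->
  eval_seq a (l ++ (\sum_(i <- r) c i *: x i) :: l') =
  \sum_(i <- r) c i * eval_seq a (l ++ x i :: l').
Proof.
move=> la lk; have spinor1 : eval_seq a (l ++ 0 :: l') = 0.
  have := eval_linear l' (-1) 0 0 la lk; rewrite scaleN1r oppr0 addr0.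
  by rewrite mulN1r addNr.
elim: r => [|i r IH]; first by rewrite !big_nil.
by rewrite !big_cons eval_linear // IH.
Qed.

Lemma pullback_alternating k (a : kform V k) (g : 'End(V)) : alternating a ->
  alternating (fun v : k.-tuple V => a (map_tuple g v)).
Proof.
move=> [la alt]; split=> [v i c x y|v i j nij E].
  have S z : map_tuple g (set_tnth v i z) = set_tnth (map_tuple g v) i (g z).
    apply: eq_from_tnth => j; rewrite tnth_map !tnth_set.
    by case: eqP => // _; rewrite tnth_map.
  by rewrite !S linearP la.
by apply: (alt _ _ _ nij); rewrite !tnth_map E.
Qed.

Lemma eval3_sum (a : kform V 3) n (x y z : 'I_n -> R) (e : 'I_n -> V) : multilinear a ->
  eval_seq a [:: \sum_i x i *: e i; \sum_i y i *: e i; \sum_i z i *: e i] =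
  \sum_i \sum_j \sum_k x i * (y j * (z k * eval_seq a [:: e i; e j; e k])).
Proof.
move=> la; etransitivity; first exact: (@eval_sum_slot 3 a [::] _ _ _ _ _ la isT).
apply: eq_bigr => i _.
transitivity (x i * (\sum_j \sum_k y j * (z k * eval_seq a [:: e i; e j; e k]))); last first.
  by rewrite big_distrr; apply: eq_bigr => j _; rewrite big_distrr.
congr (_ * _); etransitivity; first exact: (@eval_sum_slot 3 a [:: e i] _ _ _ _ _ la isT).
apply: eq_bigr => j _; rewrite -big_distrr; congr (_ * _).
exact: (@eval_sum_slot 3 a [:: e i; e j] [::] _ _ _ _ la isT).
Qed.

Context {b : 7.-tuple V} {f : 7.-tuple 'Hom(V, R^o)}.
Hypothesis hb : basis_of fullv b.
Hypothesis fb : dual_basis f b.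

Lemma stabilizer_matrix (B B' : nat -> nat -> int) (d : int) : d != 0 ->
  phi0_invertible B B' d -> phi0_invariant B d ->
  exists2 g : 'End(V), stabilizer (phi0 f) g &
    forall j, (j < 7)%N -> g b`_j = \sum_(m < 7) ((d%:~R)^-1 * (B m j)%:~R) *: b`_m.
Proof.
move=> d0 inv pres.
have dR : d%:~R != 0 :> R by rewrite intr_eq0.
pose G x : V := \sum_(m < 7) ((d%:~R)^-1 * \sum_(t < 7) (B m t)%:~R * tnth f t x) *: b`_m.
have [g gE] : exists g : 'End(V), forall x, g x = G x.
  apply: exists_lfun => c x y; rewrite /G scaler_sumr -big_split; apply: eq_bigr => m _.
  rewrite /= scalerA -scalerDl; congr (_ *: _).
  rewrite !big_distrr -big_split; apply: eq_bigr => t _ /=.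
  by rewrite functional_linear; ring.
have fg (m : 'I_7) x : tnth f m (g x) = (d%:~R)^-1 * \sum_(t < 7) (B m t)%:~R * tnth f t x.
  rewrite gE functional_sum -[RHS](sum_delta (fun m : 'I_7 =>
    (d%:~R)^-1 * \sum_(t < 7) (B m t)%:~R * tnth f t x) m); apply: eq_bigr => j _.
  by rewrite -tnth_nth fb.
have gb j : (j < 7)%N -> g b`_j = \sum_(m < 7) ((d%:~R)^-1 * (B m j)%:~R) *: b`_m.
  move=> j7; rewrite gE; apply: eq_bigr => m _; congr (_ * _ *: _).
  rewrite -[RHS](sum_delta (fun t : 'I_7 => (B m t)%:~R) (Ordinal j7)).
  apply: eq_bigr => t _; rewrite -[j]/(nat_of_ord (Ordinal j7)) -tnth_nth fb eq_sym.
  by [].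
exists g => //; split.
  apply/lker0P => x y gxy.
  have E (s : 'I_7) z : \sum_(m < 7) (B' s m)%:~R * tnth f m (g z) = d%:~R * tnth f s z.
    under eq_bigr => m _ do rewrite fg !big_distrr /=.
    rewrite exchange_big /=.
    transitivity (\sum_(t < 7) d%:~R * tnth f t z * (s == t)%:R); last first.
      exact: (sum_delta (fun t => d%:~R * tnth f t z) s).
    apply: eq_bigr => t _.
    have /eqP/(congr1 (fun z : int => z%:~R : R)) := all_iotaP (all_iotaP inv s) t.
    rewrite intsumE intrM rmorphXn /= => H.
    transitivity ((d%:~R)^-1 * tnth f t z * \sum_(m < 7) (B' s m * B m t)%:~R).
      by rewrite big_distrr; apply: eq_bigr => m _; rewrite intrM /=; ring.
    by rewrite H -val_eqE; case: (_ == _); rewrite /= ?mulr0 ?mulr1 //; field.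
  rewrite (basis_expand x hb) (basis_expand y hb); apply: eq_bigr => s _.
  rewrite !(dual_basis_coord (size_basis hb) _ _ fb); congr (_ *: _).
  by apply: (mulfI dR); rewrite -!E gxy.
suff E : (fun v : 3.-tuple V => phi0 f (map_tuple g v)) = phi0 f by move=> v; rewrite -[in RHS]E.
apply: (alternating_ext3 hb) => [||i j k ij jk k7].
- exact/pullback_alternating/phi0_alternating.
- exact: phi0_alternating.
have j7 := ltn_trans jk k7; have i7 := ltn_trans ij j7.
rewrite (component_phi0 fb) // /component.
have -> : eval_seq (fun v : 3.-tuple V => phi0 f (map_tuple g v)) [:: b`_i; b`_j; b`_k] =
    eval_seq (phi0 f) [:: g b`_i; g b`_j; g b`_k].
  rewrite /eval_seq; congr (phi0 f); apply: eq_from_tnth => m.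
  by rewrite tnth_map !tnth_mktuple; case: m => [[|[|[|//]]] hm].
rewrite eval_phi0.
have F m t : (m < 7)%N -> (t < 7)%N -> f`_m (g b`_t) = (d%:~R)^-1 * (B m t)%:~R.
  move=> m7 t7; have := fg (Ordinal m7) b`_t; rewrite (tnth_nth 0) /= => ->.
  rewrite -[in RHS](sum_delta (fun t => (B m (t : 'I_7))%:~R) (Ordinal t7)).
  congr (_ * _); apply: eq_bigr => s _; rewrite -[t]/(nat_of_ord (Ordinal t7)) -tnth_nth fb eq_sym.
  by [].
have /allP/(_ _ (triplesP ij jk k7))/eqP/= := pres.
move/(congr1 (fun z : int => z%:~R : R)); rewrite intrM rmorphXn /= => H.
apply: (mulfI (expf_neq0 3 dR)); rewrite -H.
rewrite (eq_phi0_poly3 (g := fun m t => (d%:~R)^-1 * (B m t)%:~R) (x' := i) (y' := j) (z' := k)); first last.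
- by move=> m m7; rewrite F.
- by move=> m m7; rewrite F.
- by move=> m m7; rewrite F.
by rewrite phi0_polyZ phi0_poly_intr mulrA -exprMn divff // expr1n mul1r.
Qed.

(** Invariance under B / d, cleared of denominators and written as a sum that unfolds: a linear
    relation between components, ready for [lra]. *)
Lemma component_invariant (a : kform V 3) (B B' : nat -> nat -> int) (d : int) i j k :
  alternating a -> (stabilizer (phi0 f) `<=` stabilizer a)%classic -> d != 0 ->
  phi0_invertible B B' d -> phi0_invariant B d ->
  (i < 7)%N -> (j < 7)%N -> (k < 7)%N ->
  d%:~R ^+ 3 * alternated (component (b := b) a) i j k =
  foldr (fun x acc => foldr (fun y acc => foldr (fun z acc =>
    (B x i)%:~R * (B y j)%:~R * (B z k)%:~R * alternated (component (b := b) a) x y z + acc)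
    0 (iota 0 7) + acc) 0 (iota 0 7) + acc) 0 (iota 0 7).
Proof.
move=> alta sub d0 inv pres i7 j7 k7.
have [g /sub[_ ga] gb] := stabilizer_matrix d0 inv pres.
have la : multilinear a by case: alta.
have dR : d%:~R != 0 :> R by rewrite intr_eq0.
have -> : alternated (component (b := b) a) = component (b := b) a.
  by apply: funext => ?; apply: funext => ?; apply: funext => ?; exact: alternated_component.
have -> : component (b := b) a i j k = eval_seq a [:: g b`_i; g b`_j; g b`_k].
  rewrite /component /eval_seq -ga; congr a; apply: eq_from_tnth => m.
  by rewrite tnth_map !tnth_mktuple; case: m => [[|[|[|//]]] hm].
rewrite !gb // eval3_sum //.
rewrite (foldr_sum3 7 (fun x y z => (B x i)%:~R * (B y j)%:~R * (B z k)%:~R *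
  component (b := b) a x y z)).
rewrite big_distrr; apply: eq_bigr => x _; rewrite big_distrr; apply: eq_bigr => y _.
rewrite big_distrr; apply: eq_bigr => z _; rewrite /component /=.
by field.
Qed.

Lemma stabilizer_phi0_multiple (a : kform V 3) :
  alternating a -> (stabilizer (phi0 f) `<=` stabilizer a)%classic ->
  exists c, a = c *: phi0 f.
Proof.
move=> alta sub.
have I B B' d := component_invariant alta sub (B := B) (B' := B') (d := d).
set p := component (b := b) a in I.
have S (s : seq int) i j k : (i < 7)%N -> (j < 7)%N -> (k < 7)%N ->
    phi0_invertible (sign_matrix s) (sign_matrix s) 1 -> phi0_invariant (sign_matrix s) 1 ->
    alternated p i j k = (nth 0 s i * nth 0 s j * nth 0 s k)%:~R * alternated p i j k.
  move=> i7 j7 k7 inv pres; have := I i j k _ _ 1 isT inv pres i7 j7 k7.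
  rewrite expr1n mul1r (foldr_sum3 7 (fun x y z => (sign_matrix s x i)%:~R *
    (sign_matrix s y j)%:~R * (sign_matrix s z k)%:~R * alternated p x y z)).
  have D m (m7 : (m < 7)%N) (F : nat -> R) :
      \sum_(x < 7) (sign_matrix s x m)%:~R * F x = (nth 0 s m)%:~R * F m.
    rewrite (bigD1 (Ordinal m7)) //= big1 => [|x xm].
      by rewrite addr0 /sign_matrix eqxx.
    by rewrite /sign_matrix -val_eqE /= in xm *; rewrite (negPf xm) mul0r.
  move=> {1}->.
  transitivity (\sum_(x < 7) (sign_matrix s x i)%:~R * \sum_(y < 7) (sign_matrix s y j)%:~R *
     \sum_(z < 7) (sign_matrix s z k)%:~R * alternated p x y z).
    apply: eq_bigr => x _; rewrite big_distrr; apply: eq_bigr => y _.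
    by rewrite !big_distrr; apply: eq_bigr => z _; rewrite /= !mulrA.
  rewrite (D i i7 (fun x => \sum_(y < 7) (sign_matrix s y j)%:~R *
     \sum_(z < 7) (sign_matrix s z k)%:~R * alternated p x y z)).
  rewrite (D j j7 (fun y => \sum_(z < 7) (sign_matrix s z k)%:~R * alternated p i y z)).
  by rewrite (D k k7 (fun z => alternated p i j z)) !intrM !mulrA.
(* At the seven indices, (s1, s2, s3) takes the seven nontrivial values in {1, -1}^3. A product of
   three distinct ones is trivial exactly on the lines of the Fano plane, which are the monomials of
   phi0. *)
pose s1 : seq int := [:: 1; 1; -1; -1; -1; -1; 1].
pose s2 : seq int := [:: 1; -1; 1; -1; 1; -1; -1].
pose s3 : seq int := [:: -1; 1; 1; -1; -1; 1; -1].
have S1 i j k i7 j7 k7 := S s1 i j k i7 j7 k7 isT isT.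
have S2 i j k i7 j7 k7 := S s2 i j k i7 j7 k7 isT isT.
have S3 i j k i7 j7 k7 := S s3 i j k i7 j7 k7 isT isT.
have Z t : t \in triples -> phi0c t.1.1 t.1.2 t.2 = 0 -> p t.1.1 t.1.2 t.2 = 0.
  by rewrite !inE; do ![case/orP] => /eqP ->; cbn [fst snd] => //= _;
    match goal with |- ?q ?i ?j ?k = 0 =>
      move: (S1 i j k isT isT isT) (S2 i j k isT isT isT) (S3 i j k isT isT isT)
    end; rewrite /alternated /=; lra.
(* Each relation comes from the invariance at a triple off the monomials: of the four terms that
   remain, two vanish by [Z], as does the left-hand side, so two monomial components are tied. Six
   relations connect all seven. *)
have A1 : p 1%N 2%N 5%N = p 1%N 3%N 4%N.
  have := I 1%N 2%N 3%N (boost_matrix 2 4 3 5 1 1) (boost_matrix 2 4 3 5 (-1) (-1)) 4 isT isT isT isT isT isT.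
  move: (Z (1, 2, 3)%N isT erefl) (Z (1, 4, 5)%N isT erefl).
  by rewrite /alternated /boost_matrix /=; lra.
have A2 : p 2%N 3%N 6%N = - p 4%N 5%N 6%N.
  have := I 2%N 5%N 6%N (boost_matrix 2 4 3 5 1 1) (boost_matrix 2 4 3 5 (-1) (-1)) 4 isT isT isT isT isT isT.
  move: (Z (2, 5, 6)%N isT erefl) (Z (3, 4, 6)%N isT erefl).
  by rewrite /alternated /boost_matrix /=; lra.
have C1 : p 0%N 1%N 6%N = - p 0%N 3%N 5%N.
  have := I 0%N 1%N 3%N (boost_matrix 1 5 3 6 1 (-1)) (boost_matrix 1 5 3 6 (-1) 1) 4 isT isT isT isT isT isT.
  move: (Z (0, 1, 3)%N isT erefl) (Z (0, 5, 6)%N isT erefl).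
  by rewrite /alternated /boost_matrix /=; lra.
have C2 : p 1%N 3%N 4%N = p 4%N 5%N 6%N.
  have := I 1%N 4%N 6%N (boost_matrix 1 5 3 6 1 (-1)) (boost_matrix 1 5 3 6 (-1) 1) 4 isT isT isT isT isT isT.
  move: (Z (1, 4, 6)%N isT erefl) (Z (3, 4, 5)%N isT erefl).
  by rewrite /alternated /boost_matrix /=; lra.
have E1 : p 0%N 2%N 4%N = p 2%N 3%N 6%N.
  have := I 0%N 2%N 3%N (boost_matrix 0 6 3 4 1 (-1)) (boost_matrix 0 6 3 4 (-1) 1) 4 isT isT isT isT isT isT.
  move: (Z (0, 2, 3)%N isT erefl) (Z (2, 4, 6)%N isT erefl).
  by rewrite /alternated /boost_matrix /=; lra.
have E2 : p 0%N 3%N 5%N = p 4%N 5%N 6%N.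
  have := I 0%N 4%N 5%N (boost_matrix 0 6 3 4 1 (-1)) (boost_matrix 0 6 3 4 (-1) 1) 4 isT isT isT isT isT isT.
  move: (Z (0, 4, 5)%N isT erefl) (Z (3, 5, 6)%N isT erefl).
  by rewrite /alternated /boost_matrix /=; lra.
(* The monomial f^567 has coefficient 1 in phi0. *)
exists (p 4%N 5%N 6%N).
have alt0 := phi0_alternating f.
apply: (alternating_ext3 hb) => // [|i j k ij jk k7]; first exact: alternatingZ.
have j7 := ltn_trans jk k7; have i7 := ltn_trans ij j7.
rewrite componentZ (component_phi0 fb) // -/p.
have := triplesP ij jk k7; rewrite !inE.
by do ![case/orP] => /eqP[-> -> ->];
  match goal with |- ?q ?i ?j ?k = _ =>
    first [have /= := Z (i, j, k) isT erefl | idtac] end; rewrite /phi0c /=; lra.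
Qed.
End Stabilizer.

(** * The induced metric *)

(* The index 7 is out of range, where phi0c vanishes; the tests on c and c' only
   shorten the evaluation of the 5040 terms. *)
Definition phi0_pairing (i j : nat) (l : seq nat) : int :=
  let c := phi0c i (nth 7 l 0) (nth 7 l 1) in
  if c == 0 then 0 else
  let c' := phi0c j (nth 7 l 2) (nth 7 l 3) in
  if c' == 0 then 0 else
  c * c' * phi0c (nth 7 l 4) (nth 7 l 5) (nth 7 l 6).

(** The constant is -6 for the wedge product of the three forms; without the normalization 1 / (2!
    2! 3!) it becomes -6 times 24. *)
Lemma altsum_phi0_pairing : all (fun i => all (fun j =>
  altsum 7 7 (iota 0 7) (phi0_pairing i j) == - 144%:Z * (sign4 int i * (i == j)%:Z))
  (iota 0 7)) (iota 0 7).
Proof. by vm_compute. Qed.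

Section InducedMetric.
Context {R : realType} {V : vectType R}.

Lemma alternating_top n (b : n.-tuple V) (a : kform V n) v : basis_of fullv b ->
  alternating a -> a v = \det (\matrix_(i < n, j < n) coord b i (tnth v j)) * a b.
Proof.
move=> hb alta; pose d : kform V n := fun v => \det (\matrix_(i < n, j < n) coord b i (tnth v j)).
have E : a = a b *: d; last by rewrite {1}E fctE [LHS]mulrC.
apply: (alternating_top_ext hb) => //; first exact/alternatingZ/det_alternating.
rewrite fctE /d (_ : \matrix_(i, j) _ = 1%:M) ?det1 /GRing.scale /= ?mulr1 //.
apply/matrixP => i j; rewrite !mxE (tnth_nth 0) coord_free ?(basis_free hb) //.
by rewrite eq_sym.
Qed.

(* The components of the 7-form (i_x a) /\ (i_y a) /\ a, up to a constant factor. *)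
Definition pairing_form (a : kform V 3) (x y : V) : kform V 7 := fun v =>
  \sum_(s : 'S_7) (-1) ^+ s * shuffle_product (p := 4) (q := 3)
    (shuffle_product (p := 2) (q := 2) (interior x a) (interior y a)) a
    [tuple tnth v (s r) | r < 7].

Lemma pairing_form_alternating a x y : alternating a -> alternating (pairing_form a x y).
Proof.
move=> [la _]; apply: alternating_altsum.
apply: (@shuffle_product_multilinear _ _ 4 3) => //.
by apply: (@shuffle_product_multilinear _ _ 2 2); apply: interior_multilinear.
Qed.

Lemma eval_shuffle p q (a : kform V p) (c : kform V q) l :
  eval_seq (shuffle_product a c) l = eval_seq a (take p l) * eval_seq c (drop p l).
Proof.
rewrite /eval_seq /shuffle_product; congr (a _ * c _).
  by apply: eq_from_tnth => i; rewrite !tnth_mktuple nth_take.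
by apply: eq_from_tnth => i; rewrite !tnth_mktuple nth_drop.
Qed.

Lemma pairing_termE (a : kform V 3) x y (v : 7.-tuple V) :
  shuffle_product (p := 4) (q := 3)
    (shuffle_product (p := 2) (q := 2) (interior x a) (interior y a)) a v =
  eval_seq a (x :: take 2 (take 4 v)) * eval_seq a (y :: drop 2 (take 4 v)) * eval_seq a (drop 4 v).
Proof. by rewrite -[LHS](@eval_tuple _ _ (4 + 3)) eval_shuffle (@eval_shuffle 2 2) !eval_interior. Qed.

End InducedMetric.

Section CoframeMetric.
Context {R : realType} {V : vectType R}.
Implicit Types (b : 7.-tuple V) (f e : 7.-tuple 'Hom(V, R^o)).

Lemma pairing_form_basis b f (i j : 'I_7) : dual_basis f b ->
  pairing_form (phi0 f) b`_i b`_j b = - 144 * (sign4 R i * (i == j)%:R).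
Proof.
move=> fb.
have /eqP H := all_iotaP (all_iotaP altsum_phi0_pairing i) j.
transitivity ((altsum 7%N 7 (iota 0 7) (phi0_pairing i j))%:~R : R); last first.
  by rewrite H !intrM sign4_intr.
rewrite -altsum_intr -altsumE //; apply: eq_bigr => s _; congr (_ * _).
have -> : [seq nth 7%N (iota 0 7) (s r) | r <- enum 'I_7] = [seq val (s r) | r <- enum 'I_7].
  by apply: eq_map => r; rewrite nth_iota.
rewrite pairing_termE.
have -> : [tuple tnth b (s r) | r < 7] = [seq b`_m | m <- [seq val (s r) | r <- enum 'I_7]] :> seq V.
  by rewrite -map_comp; apply: eq_map => r /=; rewrite -tnth_nth.
have : all (fun m => m < 7)%N [seq val (s r) | r <- enum 'I_7].
  by rewrite all_map; apply/allP => r _ /=.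
have : size [seq val (s r) | r <- enum 'I_7] = 7%N by rewrite size_map size_enum_ord.
case: [seq _ | _ <- _] => [|m0 [|m1 [|m2 [|m3 [|m4 [|m5 [|m6 [|? ?]]]]]]]] //= _.
case/and5P => l0 l1 l2 l3 /and4P[l4 l5 l6 _].
have := component_phi0 fb; rewrite /component => C; rewrite !C //.
rewrite /phi0_pairing /=.
case: eqP => [->|_]; first by rewrite !mul0r.
by case: eqP => [->|_]; rewrite ?mulr0 ?mul0r // !intrM.
Qed.

Lemma pairing_form_coframe b f x y : basis_of fullv b -> dual_basis f b ->
  pairing_form (phi0 f) x y b = - 144 * coframe_metric f x y.
Proof.
move=> hb fb; have alt0 := phi0_alternating f.
have Le c x' y' l : eval_seq (phi0 f) ((c *: x' + y') :: l) =
    c * eval_seq (phi0 f) (x' :: l) + eval_seq (phi0 f) (y' :: l).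
  by apply: (@eval_linear _ _ 3 _ [::]) => //; case: alt0.
have P c x' y' z' : pairing_form (phi0 f) (c *: x' + y') z' b =
    c * pairing_form (phi0 f) x' z' b + pairing_form (phi0 f) y' z' b.
  rewrite big_distrr -big_split; apply: eq_bigr => s _ /=.
  by rewrite !pairing_termE Le 2!mulrDl mulrDr -!mulrA mulrCA.
have P' c x' y' z' : pairing_form (phi0 f) z' (c *: x' + y') b =
    c * pairing_form (phi0 f) z' x' b + pairing_form (phi0 f) z' y' b.
  rewrite big_distrr -big_split; apply: eq_bigr => s _ /=.
  have D (e A X Y Z : R) : e * (A * (c * X + Y) * Z) = c * (e * (A * X * Z)) + e * (A * Y * Z).
    by ring.
  by rewrite !pairing_termE Le D.
have S (x' : 'I_7 -> R) z' : pairing_form (phi0 f) (\sum_i x' i *: b`_i) z' b =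
    \sum_i x' i * pairing_form (phi0 f) b`_i z' b.
  elim/big_rec2: _ => [|i s t _ <-]; last exact: P.
  by have := P (-1) 0 0 z'; rewrite scaleN1r oppr0 addr0 mulN1r addNr.
have S' (x' : 'I_7 -> R) z' : pairing_form (phi0 f) z' (\sum_i x' i *: b`_i) b =
    \sum_i x' i * pairing_form (phi0 f) z' b`_i b.
  elim/big_rec2: _ => [|i s t _ <-]; last exact: P'.
  by have := P' (-1) 0 0 z'; rewrite scaleN1r oppr0 addr0 mulN1r addNr.
have X z : z = \sum_(i < 7) tnth f i z *: b`_i.
  rewrite {1}(basis_expand z hb); apply: eq_bigr => i _.
  by rewrite (dual_basis_coord (size_basis hb) _ _ fb) -tnth_nth.
rewrite {1}(X x) {1}(X y) S big_distrr; apply: eq_bigr => i _ /=.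
rewrite S'; transitivity (tnth f i x * \sum_(j < 7) - 144 * (sign4 R i * tnth f j y) * (i == j)%:R).
  by congr (_ * _); apply: eq_bigr => j _; rewrite (pairing_form_basis _ _ fb); ring.
rewrite (sum_delta (fun j => - 144 * (sign4 R i * tnth f j y)) i).
by rewrite /sign4; ring.
Qed.

Lemma coframe_metric_dual b f (i j : 'I_7) : dual_basis f b ->
  coframe_metric f (tnth b i) (tnth b j) = sign4 R i * (i == j)%:R.
Proof.
move=> fb; rewrite /coframe_metric.
transitivity (\sum_(k < 7) sign4 R k * (j == k)%:R * (i == k)%:R).
  by apply: eq_bigr => k _; rewrite !fb [k == i]eq_sym [k == j]eq_sym /sign4; ring.
by rewrite (sum_delta (fun k : 'I_7 => sign4 R k * (j == k)%:R)) eq_sym.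
Qed.

Lemma expr9_eq1 (x : R) : x ^+ 9 = 1 -> x = 1.
Proof.
move=> x9; have x0 : 0 <= x.
  rewrite leNgt; apply/negP => xn; have : x ^+ 9 <= 0.
    by rewrite exprS mulr_le0_ge0 ?(ltW xn) // (exprM x 4 2) sqr_ge0.
  by rewrite x9 ler10.
by apply/eqP; rewrite -(@pexpr_eq1 _ _ 9) // x9.
Qed.

(** The three-form determines the metric up to the choice of a volume. The two metrics thus differ
    by the determinant d of the change of basis, and comparing their determinants pins d down. *)
Lemma phi0_metric_unique b b' f f' : basis_of fullv b -> basis_of fullv b' ->
  dual_basis f b -> dual_basis f' b' -> phi0 f = phi0 f' ->
  coframe_metric f = coframe_metric f'.
Proof.
move=> hb hb' fb fb' E.
pose d := \det (\matrix_(i < 7, j < 7) coord b i (tnth b' j)).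
have G x y : coframe_metric f' x y = d * coframe_metric f x y.
  have n0 : - 144 != 0 :> R by rewrite oppr_eq0 pnatr_eq0.
  apply: (mulfI n0); rewrite -(pairing_form_coframe _ _ hb' fb') mulrCA.
  rewrite -(pairing_form_coframe _ _ hb fb).
  by rewrite -E; apply: alternating_top => //; apply/pairing_form_alternating/phi0_alternating.
suff d1 : d = 1 by apply: funext => x; apply: funext => y; rewrite G d1 mul1r.
pose A : 'M[R]_7 := \matrix_(i, j) coord b i (tnth b' j).
pose D : 'M[R]_7 := diag_mx (\row_i sign4 R i).
have H : D = d *: (A^T *m D *m A).
  apply/matrixP => i j.
  have := G (tnth b' i) (tnth b' j); rewrite coframe_metric_dual // => E'.
  rewrite !mxE -[LHS]mulr_natr E'; congr (_ * _); apply: eq_bigr => k _.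
  rewrite mul_mx_diag !mxE !(dual_basis_coord (size_basis hb) _ _ fb) /sign4; ring.
have D1 : \det D = -1.
  by rewrite det_diag !big_ord_recl big_ord0 !mxE /sign4 /=; ring.
(* In dimension 7 this reads -1 = d^7 d^2 (-1), so d^9 = 1; the odd exponent leaves only d = 1. *)
have := congr1 determinant H; rewrite detZ !det_mulmx det_tr D1 -/d => E9.
by apply: expr9_eq1; rewrite -[RHS]opprK E9; ring.
Qed.

End CoframeMetric.

(** * The equivalences and the induced metric of a multiple of phi0 *)

Lemma triples_bump t : t \in triples ->
  exists (i0 : 'I_7) (i1 : 'I_6) (i2 : 'I_5) (i3 : 'I_4),
    let f0 := bump i0 in let f1 j := f0 (bump i1 j) in
    let f2 j := f1 (bump i2 j) in let f3 j := f2 (bump i3 j) in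
    t = (f3 0%N, f3 1%N, f3 2%N).
Proof.
have H : all (fun t => has (fun i0 => has (fun i1 => has (fun i2 => has (fun i3 =>
    let f0 := bump i0 in let f1 j := f0 (bump i1 j) in
    let f2 j := f1 (bump i2 j) in let f3 j := f2 (bump i3 j) in
    t == (f3 0%N, f3 1%N, f3 2%N))
    (iota 0 4)) (iota 0 5)) (iota 0 6)) (iota 0 7)) triples by vm_compute.
move/(allP H) => /hasP[i0 h0 /hasP[i1 h1 /hasP[i2 h2 /hasP[i3 h3 /eqP ->]]]].
rewrite !mem_iota !add0n in h0 h1 h2 h3.
by exists (Ordinal h0), (Ordinal h1), (Ordinal h2), (Ordinal h3).
Qed.

Lemma exists_cube_root (R : rcfType) (c : R) : exists r : R, r ^+ 3 = c.
Proof.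
pose m := `|c| + 1.
have m1 : 1 <= m by rewrite lerDr.
have cm : `|c| <= m ^+ 3.
  apply: (le_trans (y := m)); first by rewrite lerDl.
  by rewrite -[leLHS]expr1 ler_weXn2l.
have [||r _ /rootP] := @poly_ivt R ('X^3 - c%:P) (- m) m.
- by rewrite ge0_cp // (le_trans _ m1).
- rewrite !hornerE subr_le0 subr_ge0 exprNn -signr_odd /= mulN1r.
  rewrite lerNl (le_trans _ cm) ?ler_norm //=; last by rewrite -normrN ler_norm.
  by rewrite (le_trans _ cm) // ler_norm.
by rewrite !hornerE => /eqP; rewrite subr_eq0 => /eqP <-; exists r.
Qed.

Section G2star.
Context {R : realType} {V : vectType R} {h : V -> V -> R}.
Hypothesis hbil : symmetric_bilinear h.
Hypothesis dimV : \dim {:V} = 7%N.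
Context {b0 : 7.-tuple V}.
Hypothesis ob0 : orthonormal_basis h (fun i : 'I_7 => sign4 R i) b0.
Implicit Types (phi : kform V 3).

Lemma stabilizerZ phi c : c != 0 -> stabilizer (c *: phi) = stabilizer phi.
Proof.
move=> c0; apply/seteqP; split=> g [kg E]; split=> // v; last first.
  by rewrite !fctE E.
by apply: (@scalerI _ _ c) => //; apply: E.
Qed.

Lemma is_G2starP phi : alternating phi ->
  is_G2star h (stabilizer phi) <-> is_phi0_multiple (h := h) phi.
Proof.
move=> alt; split=> [[e [[he oe] E]]|[c [b [f [c0 ob fb ->]]]]]; last first.
  rewrite stabilizerZ //; exists f; split=> //; split.
    exact: dual_basis_coframe fb.
  exact: (coframe_orthonormal_basis hbil dimV ob0 fb).2 ob.
have [b eb] := exists_dual_basis dimV he.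
have ob := (coframe_orthonormal_basis hbil dimV ob0 eb).1 oe.
have hb := dual_basis_basis dimV eb.
have sub : (stabilizer (phi0 e) `<=` stabilizer phi)%classic by rewrite E.
have [c Ec] := stabilizer_phi0_multiple hb eb alt sub.
exists c, b, e; split=> //; apply/eqP => c0.
(* If c were 0, then phi = 0 and -1 would lie in its stabilizer, but -1 reverses the sign of a
   three-form and phi0 is nonzero. *)
pose g : 'End(V) := (- \1)%VF.
have gE x : g x = - x by rewrite opp_lfunE id_lfunE.
have : stabilizer (phi0 e) g.
  rewrite -E Ec c0 scale0r; split=> //.
  by apply/lker0P => x y; rewrite !gE => /oppr_inj.
case=> _ /(_ [tuple b`_4; b`_5; b`_6]).
have alt0 := phi0_alternating e.
have : eval_seq (phi0 e) [:: b`_4; b`_5; b`_6] = 1.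
  by have := component_phi0 eb (isT : (4 < 7)%N) (isT : (5 < 7)%N) (isT : (6 < 7)%N).
rewrite -!eval_tuple /= !gE => E1.
have N l y l' : (size l < 3)%N -> eval_seq (phi0 e) (l ++ (- y) :: l') = - eval_seq (phi0 e) (l ++ y :: l').
  move=> l3; have L := alternating_multilinear alt0.
  have := eval_linear l' (-2) y y L l3.
  rewrite (_ : -2 *: y + y = - y) => [->|]; first by ring.
  by rewrite -[X in _ + X]scale1r -scalerDl -scaleN1r; congr (_ *: _); ring.
rewrite (N [::]) // (N [:: b`_4]) // (N [:: b`_4; b`_5]) // E1; lra.
Qed.

(** [xget] returns some form satisfying the condition; the component equations leave only one. *)
Lemma hodge_unique (b : 7.-tuple V) (T : kform V 4) (c : kform V 3) (nu : kform V (4 + 3)) :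
  orthonormal_basis h (fun i : 'I_7 => sign4 R i) b ->
  alternating T -> alternating c -> alternating nu ->
  (forall a, alternating a -> wedge a c = form_metric h a T *: nu) ->
  hodge (k := 4) (m := 3) h nu T = c.
Proof.
move=> ob altT altc altn H; have [hb _ _] := ob.
apply: xget_subset1; first by [].
move=> c1 c2 [alt1 H1] [alt2 H2].
have C1 := (hodge_component_criterion hbil ob altT alt1 altn).1 H1.
have C2 := (hodge_component_criterion hbil ob altT alt2 altn).1 H2.
apply: (alternating_ext3 hb) => // i j k ij jk k7.
have [i0 [i1 [i2 [i3 [-> -> ->]]]]] := triples_bump (triplesP ij jk k7).
by have /= -> := C1 i0 i1 i2 i3; have /= -> := C2 i0 i1 i2 i3.
Qed.

Section Equation.
Context {o : 7.-tuple V} (ho : basis_of fullv o) {l : R} (hl : l = -1 \/ l = 1).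
Let nu := volume_form h o.

Lemma sqr1_or (x : R) : x * x = 1 -> x = -1 \/ x = 1.
Proof.
move=> /eqP; rewrite -expr2 sqrf_eq1 => /orP[] /eqP ->; by [right | left].
Qed.

Lemma phi0_multiple_equation phi : is_phi0_multiple (h := h) phi ->
  form_metric h phi phi < 0 /\ exists kappa : R, (kappa = -1 \/ kappa = 1) /\
    (6 * kappa * Num.sqrt (- (form_metric h phi phi / 7))) *: phi =
    l *: hodge (k := 4) (m := 3) h nu (triangle1 h phi phi).
Proof.
move=> [c [b [f [c0 ob fb ->]]]].
have alt0 := phi0_alternating f; have altc := alternatingZ c alt0.
have altn : alternating nu by exact: volume_form_alternating.
rewrite (form_metric_phi0 hbil ob _ fb).
have c2 : 0 < c ^+ 2 by rewrite exprn_even_gt0.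
split; first by rewrite nmulr_rlt0 // oppr_lt0 ltr0n.
rewrite (_ : - (- 7 * c ^+ 2 / 7) = c ^+ 2); last by field.
rewrite sqrtr_sqr.
have nb := volume_form_sq hbil ob ho; rewrite -/nu in nb.
rewrite (hodge_unique ob (triangle1_alternating h altc)
  (alternatingZ _ alt0) altn (hodge_phi0 hbil ob c fb altn)).
have ll : l * l = 1 by case: hl => ->; ring.
have [s [ss sc]] : exists s : R, s * s = 1 /\ `|c| = s * c.
  case: (lerP 0 c) => hc; first by exists 1; rewrite ger0_norm // !mul1r.
  by exists (-1); rewrite ltr0_norm // mulrNN mulN1r mulr1.
(* With |c| = s c, the two sides to be compared are 6 kappa s c^2 and -6 l nu(b) c^2. *)
exists (- l * nu b * s); split.
  apply: sqr1_or.
  transitivity ((l * l) * (nu b * nu b) * (s * s)); first by ring.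
  by rewrite ll nb ss !mul1r.
rewrite !scalerA; congr (_ *: _); rewrite sc.
transitivity (- 6 * l * nu b * c ^+ 2 * (s * s)); first by ring.
by rewrite ss; ring.
Qed.

Lemma equation_is_phi0_multiple phi kappa : alternating phi ->
  form_metric h phi phi < 0 -> kappa = -1 \/ kappa = 1 ->
  (6 * kappa * Num.sqrt (- (form_metric h phi phi / 7))) *: phi =
    l *: hodge (k := 4) (m := 3) h nu (triangle1 h phi phi) ->
  is_phi0_multiple (h := h) phi.
Proof.
move=> alt N0 hk E.
have altn : alternating nu by exact: volume_form_alternating.
have altT := triangle1_alternating h alt.
set t := Num.sqrt _ in E; set c := hodge _ _ _ in E.
have t0 : 0 < t by rewrite sqrtr_gt0 oppr_gt0 pmulr_llt0 // invr_gt0 ltr0n.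
have tN : form_metric h phi phi = - 7 * t ^+ 2.
  rewrite sqr_sqrtr; first by field.
  by rewrite oppr_ge0 pmulr_lle0 ?invr_gt0 ?ltr0n // ltW.
have kk : kappa * kappa = 1 by case: hk => ->; ring.
have ll : l * l = 1 by case: hl => ->; ring.
have nz (x : R) : x * x = 1 -> x != 0.
  by move=> xx; apply/eqP => x0; move: xx; rewrite x0 mulr0 => /eqP; rewrite eq_sym oner_eq0.
have [altc H] : alternating c /\ forall a : kform V 4, alternating a ->
    wedge a c = form_metric h a (triangle1 h phi phi) *: nu.
  pose P : set (kform V 3) := [set c | alternating c /\ forall a : kform V 4,
    alternating a -> wedge a c = form_metric h a (triangle1 h phi phi) *: nu]%classic.
  (* If no form satisfied the star condition, [hodge] would be the default 0. The equation would
     then force phi = 0, against the negative norm. *)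
  have [[c' Pc']|nP] := pselect (exists c', P c').
    exact: (xgetPex 0 (ex_intro P c' Pc')).
  have c0 : c = 0 by apply: xgetPN => c' Pc'; apply: nP; exists c'.
  have phi00 : phi = 0.
    have /eqP := E; rewrite c0 scaler0 scaler_eq0 => /orP[|/eqP //].
    by rewrite !mulf_eq0 pnatr_eq0 (negPf (nz _ kk)) (gt_eqF t0).
  move: N0; rewrite (form_metric3 hbil ob0 alt) phi00.
  rewrite big1 ?mulr0 ?ltxx // => i _; rewrite big1 // => j _; rewrite big1 // => k _.
  by rewrite (_ : component _ _ _ _ = 0) // expr0n mulr0.
have nb := volume_form_sq hbil ob0 ho; rewrite -/nu in nb.
(* Multiplying the equation by [l] and [nu b0], whose squares are 1, collects all signs in mu, and
   mu^2 = t^2. *)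
pose mu := kappa * t * l * nu b0.
have mu0 : mu != 0.
  apply: mulf_neq0 (nz _ nb); apply: mulf_neq0 (nz _ ll).
  by apply: mulf_neq0 (nz _ kk) _; rewrite gt_eqF.
apply: (equation_phi0_multiple hbil ob0 alt mu0).
  rewrite tN; transitivity (- 7 * ((kappa * kappa) * (l * l) * (nu b0 * nu b0) * t ^+ 2)).
    by rewrite kk ll nb; ring.
  by rewrite /mu; ring.
move=> i0 i1 i2 i3 f0 f1 f2 f3.
have C : component (b := b0) c (f3 0%N) (f3 1%N) (f3 2%N) =
    sign4 R i0 * sign4 R (f0 i1) * sign4 R (f1 i2) * sign4 R (f2 i3) *
    triangle_component (component (b := b0) phi) i0 (f0 i1) (f1 i2) (f2 i3) *
    ((-1) ^+ (i0 + i1 + i2 + i3) * nu b0).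
  by rewrite -(triangle1_component hbil ob0) //; apply: (hodge_component_criterion hbil ob0 altT altc altn).1.
have {}E : 6 * kappa * t * component (b := b0) phi (f3 0%N) (f3 1%N) (f3 2%N) =
    l * component (b := b0) c (f3 0%N) (f3 1%N) (f3 2%N) by rewrite -!componentZ E.
transitivity (l * nu b0 * (6 * kappa * t * component (b := b0) phi (f3 0%N) (f3 1%N) (f3 2%N))).
  by rewrite /mu; ring.
rewrite E C.
set X := sign4 R _ * _ * _ * _; set Y := triangle_component _ _ _ _ _; set Z := _ ^+ (_ + _).
transitivity ((l * l) * (nu b0 * nu b0) * (X * Y * Z)); first by ring.
by rewrite ll nb !mul1r.
Qed.

End Equation.

Lemma induced_metric_phi0_multiple (c : R) (b : 7.-tuple V) (f : 7.-tuple 'Hom(V, R^o)) :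
  c != 0 -> orthonormal_basis h (fun i : 'I_7 => sign4 R i) b -> dual_basis f b ->
  exists r : R, [/\ r != 0, r ^+ 3 = c &
    forall x y, induced_metric (c *: phi0 f) x y = r ^+ 2 * h x y].
Proof.
move=> c0 ob fb; have [hb _ _] := ob.
have [r rc] := exists_cube_root c.
have r0 : r != 0 by apply/eqP => E; move: c0; rewrite -rc E expr0n eqxx.
exists r; split=> //.
(* With r^3 = c the factor c is absorbed into the coframe, c phi0(f) = phi0(r f), so the induced
   metric is that of the coframe r f. *)
pose f' := [tuple r *: tnth f i | i < 7]; pose b' := [tuple r^-1 *: tnth b i | i < 7].
have fb' : dual_basis f' b'.
  move=> i j; rewrite !tnth_mktuple lfunE /= linearZ /= fb.
  by rewrite -[LHS]/(r * (r^-1 * _)) mulVKf.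
have f'E m t : (m < 7)%N -> f'`_m t = r * f`_m t.
  move=> m7; have := tnth_mktuple (fun i => r *: tnth f i) (Ordinal m7).
  by rewrite (tnth_nth 0) /= => ->; rewrite lfunE /= (tnth_nth 0).
have E : c *: phi0 f = phi0 f'.
  apply: kform3_ext => x y z; rewrite eval_phi0.
  rewrite (eq_phi0_poly (g := fun m t => r * f`_m t)) => [|m t m7]; last exact: f'E.
  by rewrite phi0_polyZ rc -eval_phi0.
have -> : induced_metric (c *: phi0 f) = coframe_metric f'.
  apply: xget_subset1; first by exists f'; split=> //; exact: (dual_basis_coframe dimV fb').
  move=> _ _ [f1 [hf1 E1 ->]] [f2 [hf2 E2 ->]].
  have [b1 fb1] := exists_dual_basis dimV hf1; have [b2 fb2] := exists_dual_basis dimV hf2.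
  apply: (phi0_metric_unique (dual_basis_basis dimV fb1) (dual_basis_basis dimV fb2) fb1 fb2).
  by rewrite -E1 -E2.
move=> x y; rewrite (orthonormal_metric hbil ob) big_distrr /coframe_metric.
apply: eq_bigr => i _; rewrite !(dual_basis_coord (size_basis hb) _ _ fb).
rewrite !(tnth_nth 0) !f'E // /sign4 /=; ring.
Qed.

End G2star.

Theorem theorem1p7 (R : realType) (V : vectType R) (dimV : \dim {:V} = 7%N)
    (h : {symmetric V}) (hnd : nondegenerate h) (hsig : signature h 4 3)
    (o : 7.-tuple V) (ho : basis_of fullv o)
    (l : R) (hl : l = -1 \/ l = 1)
    (phi : kform V 3) (hphi : alternating phi) :
  (is_G2star h (stabilizer phi) <->
     form_metric h phi phi < 0 /\
     exists kappa : R, (kappa = -1 \/ kappa = 1) /\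
       (6 * kappa * Num.sqrt (- (form_metric h phi phi / 7))) *: phi =
         l *: hodge (k := 4) (m := 3) h (volume_form h o) (triangle1 h phi phi))
  /\
  (is_G2star h (stabilizer phi) ->
     homothetic (induced_metric phi) h /\
     (form_metric h phi phi = -7 ->
        forall x y : V, induced_metric phi x y = h x y)).
Proof.
have hbil : symmetric_bilinear h.
  split=> [x y|c x y z]; first by rewrite hermC /= expr0 mul1r.
  by rewrite linearDl linearZl_LR.
have [b0 [hb0 hbb]] := hsig.
have ob0 : orthonormal_basis h (fun i : 'I_7 => sign4 R i) b0.
  by split=> [//|i|//]; apply: sign4_sq.
rewrite (is_G2starP hbil dimV ob0 hphi).
split; first split.
- exact: (phi0_multiple_equation hbil ho hl).
- by move=> [N0 [kappa [hk E]]]; apply: (equation_is_phi0_multiple hbil ob0 ho hl hphi N0 hk E).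
move=> [c [b [f [c0 ob fb ->]]]].
have [r [r0 rc M]] := induced_metric_phi0_multiple hbil dimV c0 ob fb.
split; first by exists (r ^+ 2); split=> //; rewrite exprn_even_gt0.
rewrite (form_metric_phi0 hbil ob _ fb) => N x y; rewrite M.
(* The norm -7 c^2 equals -7, so r^6 = c^2 = 1; the nonnegative number r^2 is therefore 1. *)
have r6 : (r ^+ 2) ^+ 3 = 1.
  rewrite -exprM mulnC exprM rc; apply: (mulfI (_ : - 7 != 0 :> R)).
    by rewrite oppr_eq0 pnatr_eq0.
  by rewrite N mulr1.
have /eqP -> : r ^+ 2 == 1 by rewrite -(@pexpr_eq1 _ _ 3) ?sqr_ge0 // r6.
by rewrite mul1r.
Qed.
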